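(* Let $K$ be a long w-knot, let $Z(K)\in\mathcal{A}^{sw}(\uparrow)$ be its arrow-reservoir invariant, let $sl(K)$ be its self-linking number, let $A(K)(X)=\det\left(I+T(I-X^{-S})\right)\in\mathbb{Z}[X,X^{-1}]$ be its (w-knot) Alexander polynomial, let $D_A=D_L=D_R\in\mathcal{A}^{sw}(\uparrow)$ be the isolated arrow, and let $w$ be the (continuous) linear map sending $x^k$ to the $k$-wheel $w_k$. Then $$Z(K)=\exp_{\mathcal{A}^{sw}}\bigl(sl(K)\,D_A\bigr)\cdot\exp_{\mathcal{A}^{sw}}\Bigl(-w\bigl(\log_{\mathbb{Q}[[x]]}A(K)(e^x)\bigr)\Bigr)\quad\text{in }\mathcal{A}^{sw}(\uparrow),$$ where the logarithm and the substitution $X=e^x$ are computed by formal power series in $\mathbb{Q}[[x]]$ and the outer exponentials are computed by formal power series in the (degree-completed) algebra $\mathcal{A}^{sw}(\uparrow)$.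
   Context: **Long w-knots.** A long v-knot diagram is encoded by a Gauss diagram: an oriented line (''skeleton'') with finitely many arrows whose endpoints are distinct points of the line, each carrying a sign $\pm$, considered up to orientation-preserving diffeomorphism of the line. Each crossing gives one arrow, from its over strand (tail) to its under strand (head), with the sign of the crossing; virtual crossings are not recorded. A long (framed) w-knot is an equivalence class of such diagrams under the moves (local; the rest of the diagram is unchanged): - R1$^s$: an isolated arrow (its two endpoints are adjacent on the line) may be reversed, keeping its sign. - R2: two arrows of opposite signs with adjacent tails and adjacent heads (heads in either order) may be removed or added. - R3: given three disjoint intervals $i,j,k$ of the line, in any order along the line, and positive arrows $i\to j$, $i\to k$, $j\to k$ with exactly their six endpoints in these intervals, ordered along the line as: in $i$, $(ij)$ before $(ik)$; in $j$, $(ij)$ before $(jk)$; in $k$, $(ik)$ before $(jk)$; one may reverse the order in all three intervals simultaneously. - OC (overcrossings commute): two adjacent arrow tails may be exchanged. The move R1 (removing an isolated arrow) and the exchange of adjacent heads are not imposed. **Arrow diagrams.** An arrow diagram is an oriented line with finitely many unsigned arrows with distinct endpoints on it, up to orientation-preserving diffeomorphism; its degree is the number of arrows. $\mathcal{A}^{sw}(\uparrow)$ is the degree completion of the $\mathbb{Q}$-vector space spanned by arrow diagrams modulo: - TC: exchanging two adjacent tails does not change the diagram. - $\overrightarrow{4T}$: for an arrow $\alpha$ and a second arrow $\beta$ with fixed tail, the sum of the two diagrams in which the head of $\beta$ is immediately before the tail of $\alpha$, respectively immediately before the head of $\alpha$, equals the sum of the two diagrams in which it is immediately after the tail of $\alpha$,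 respectively immediately after the head of $\alpha$. - RI: reversing an isolated arrow (one with adjacent endpoints) does not change the diagram. It is an algebra under concatenation of lines. $D_R$ (resp. $D_L$) is the diagram with a single arrow whose tail precedes (resp. follows) its head along the line; by RI they agree in $\mathcal{A}^{sw}(\uparrow)$ and $D_A$ is their common value. **Wheels.** One may also use diagrams with internal trivalent vertices: directed graphs attached to the skeleton, each internal vertex having two incoming edges, one designated left ($l$) and one right ($r$), and one outgoing edge ($o$). These represent elements of $\mathcal{A}^{sw}(\uparrow)$ by eliminating vertices via: - $\overrightarrow{STU}_1$: if the outgoing edge of a vertex ends on the skeleton at a point $p$, the diagram equals (the diagram with the vertex removed and edges $l,r$ ending near $p$ in the order $l$, then $r$ along the skeleton) minus (the same in the order $r$, then $l$). - $\overrightarrow{STU}_2$: if the right incoming edge $r$ of a vertex starts on the skeleton at $p$, the diagram equals (vertex and $r$ removed, with near $p$ the tail of $o$ followed by the head of $l$) minus (head of $l$ followed by tail of $o$). If instead the left incoming edge starts on the skeleton at $p$, the same holds with $l$ and $r$ exchanged and the overall sign reversed. (These give a well-defined element.) The $k$-wheel $w_k$, $k\ge1$, is the diagram with an oriented cycle of $k$ edges through $k$ internal vertices and $k$ spokes, each spoke starting on the skeleton and ending at a cycle vertex, where at each vertex the spoke is the left incoming edge and the cycle edge is the right incoming edge, the $k$ tails being the only skeleton endpoints. The order of the tails is irrelevant by TC. For instance $w_1=D_L-D_R$, which is $0$ in $\mathcal{A}^{sw}(\uparrow)$. The map $w$ sends $\sum_k c_kx^k$ to $\sum_k c_kw_k$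 in $\mathcal{A}^{sw}(\uparrow)$; since $A(K)(1)=1$, it is applied only to series without constant term. **The invariant $Z$.** Given a Gauss diagram of $K$, $Z(K)$ is obtained by replacing each arrow of sign $\pm$ by the exponential reservoir $e^{\pm a}=\sum_{k\ge0}\frac{(\pm1)^k}{k!}a^k$, where $a^k$ denotes $k$ parallel unsigned arrows, with all $k$ tails near the original tail and all $k$ heads near the original head (the relative order is irrelevant by TC), and expanding multilinearly. This is a well-defined invariant of long w-knots with values in $\mathcal{A}^{sw}(\uparrow)$. **$sl$ and $A(K)$.** $sl(K)$ is the sum of the signs of all arrows (crossings). Number the arrows (crossings) $1,\dots,n$. The span of crossing $i$ is the open interval of the skeleton line between the two endpoints of arrow $i$. $T$ is the $n\times n$ matrix with $T_{ij}=1$ if the head (lower strand) of arrow $j$ lies in the span of crossing $i$, and $T_{ij}=0$ otherwise. $s_i\in\{\pm1\}$ is the sign of crossing $i$; $d_i=+1$ if the tail (over strand) of arrow $i$ comes before its head along the line, and $d_i=-1$ otherwise. $S$ is the diagonal matrix with $S_{ii}=s_id_i$, and $X^{-S}$ is the diagonal matrix with entries $X^{-s_id_i}$. *)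

(* Defs.v *)
From HB Require Import structures.
From Stdlib Require Import Relation_Operators.
From mathcomp Require Import all_boot all_order all_algebra.
From mathcomp Require Import monalg.

Set Implicit Arguments.
Unset Strict Implicit.
Unset Printing Implicit Defensive.

Import Order.TTheory GRing.Theory Num.Theory.
Local Open Scope ring_scope.

(* A diagram on the line is written as the word of its endpoints, read along  *)
(* the line: [tl a] is the tail of the arrow labelled a, [hd a] its head.     *)
Definition word (L : Type) := seq (L * bool).

Definition tl {L : Type} (a : L) : L * bool := (a, false).
Definition hd {L : Type} (a : L) : L * bool := (a, true).

(* every label that occurs does so exactly once as a tail and once as a head  *)
Definition arrow_word {L : eqType} (w : word L) : bool :=
  uniq w && all (fun x => (x.1, ~~ x.2) \in w) w.

Definition relabel {L M : Type} (f : L -> M) (w : word L) : word M :=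
  [seq (f x.1, x.2) | x <- w].

Definition subst {T : eqType} (x : T) (ys : seq T) (w : seq T) : seq T :=
  flatten [seq if z == x then ys else [:: z] | z <- w].

Definition insert_before {T : eqType} (x y : T) (w : seq T) : seq T :=
  subst x [:: y; x] w.
Definition insert_after {T : eqType} (x y : T) (w : seq T) : seq T :=
  subst x [:: x; y] w.

Record gauss := Gauss {
  narrows : nat;
  gword : word 'I_narrows;
  gpos : 'I_narrows -> bool;   (* [true] for the sign +1 *)
  gwordP : perm_eq gword (enum {: 'I_narrows * bool})
}.
Arguments gpos : clear implicits.

Inductive wmove (pos : nat -> bool) : word nat -> word nat -> Prop :=
| Renumber w : wmove pos w w
| R1s u v a :
    wmove pos (u ++ [:: tl a; hd a] ++ v) (u ++ [:: hd a; tl a] ++ v)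
| R2_tails_first (u v w T H : word nat) a b :
    pos a != pos b ->
    perm_eq T [:: tl a; tl b] -> perm_eq H [:: hd a; hd b] ->
    wmove pos (u ++ T ++ v ++ H ++ w) (u ++ v ++ w)
| R2_heads_first (u v w T H : word nat) a b :
    pos a != pos b ->
    perm_eq T [:: tl a; tl b] -> perm_eq H [:: hd a; hd b] ->
    wmove pos (u ++ H ++ v ++ T ++ w) (u ++ v ++ w)
| R3 (u v w x B1 B2 B3 : word nat) ij ik jk :
    pos ij -> pos ik -> pos jk ->
    perm_eq [:: B1; B2; B3]
            [:: [:: tl ij; tl ik]; [:: hd ij; tl jk]; [:: hd ik; hd jk]] ->
    wmove pos (u ++ B1 ++ v ++ B2 ++ w ++ B3 ++ x)
              (u ++ rev B1 ++ v ++ rev B2 ++ w ++ rev B3 ++ x)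
| OC u v a b :
    wmove pos (u ++ [:: tl a; tl b] ++ v) (u ++ [:: tl b; tl a] ++ v).

(* f and g give the arrows of D and E names in nat, so that the arrows that   *)
(* the two diagrams share can be matched                                      *)
Definition gmove (D E : gauss) : Prop :=
  exists (pos : nat -> bool)
         (f : 'I_(narrows D) -> nat) (g : 'I_(narrows E) -> nat),
  [/\ injective f /\ (forall i, pos (f i) = gpos D i),
      injective g /\ (forall i, pos (g i) = gpos E i) &
      wmove pos (relabel f (gword D)) (relabel g (gword E))].

Definition wequiv : gauss -> gauss -> Prop := clos_refl_sym_trans gauss gmove.

Record wknot := WKnot {
  diagram_of :> gauss -> Prop;
  wknot_class : exists D, forall E, diagram_of E <-> wequiv D E
}.

Definition series (R : Type) := nat -> R.

Section Series.
Context (R : lalgType rat).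

Definition ser1 : series R := fun n => (n == 0%N)%:R.

Definition ser_deg1 (c : R) : series R := fun n => if n == 1%N then c else 0.

Definition ser_opp (a : series R) : series R := fun n => - a n.

Definition ser_mul (a b : series R) : series R :=
  fun n => \sum_(i < n.+1) a i * b (n - i)%N.

Definition ser_pow (a : series R) (k : nat) : series R :=
  iter k (ser_mul a) ser1.

(* for a 0 = 0 the terms with k > n do not contribute in degree n             *)
Definition ser_exp (a : series R) : series R :=
  fun n => \sum_(k < n.+1) (k`!%:R)^-1 *: ser_pow a k n.

(* for a 0 = 1                                                                *)
Definition ser_log (a : series R) : series R :=
  fun n => \sum_(1 <= k < n.+1)
             ((-1) ^+ k.+1 / k%:R) *: ser_pow (fun m => a m - ser1 m) k n.

End Series.

Definition qseries := series rat^o.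

(* An arrow diagram is encoded by the sequence, along the line, of the pairs  *)
(* (is the endpoint a head?, offset to the position of the other endpoint).   *)
(* Labels are forgotten and concatenating lines concatenates codes, so the    *)
(* span of the codes of arrow diagrams is a subalgebra of the free algebra    *)
(* [free_alg] on such pairs.                                                  *)
Definition code {L : eqType} (w : word L) : seq (bool * int) :=
  [seq (x.2, (index (x.1, ~~ x.2) w)%:Z - (index x w)%:Z) | x <- w].

Definition free_alg := {malg rat[{fmonom (bool * int)%type}]}.

Definition dg {L : eqType} (w : word L) : free_alg := << FMonom (code w) >>.

Inductive relator : free_alg -> Prop :=
| TC (u v : word nat) a b :
    arrow_word (u ++ [:: tl a; tl b] ++ v) ->
    relator (dg (u ++ [:: tl a; tl b] ++ v) - dg (u ++ [:: tl b; tl a] ++ v))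
| FourT (w : word nat) (a b : nat) :   (* w lacks only the head of b *)
    arrow_word (hd b :: w) -> a != b -> hd a \in w ->
    relator (dg (insert_before (tl a) (hd b) w)
             + dg (insert_before (hd a) (hd b) w)
             - (dg (insert_after (tl a) (hd b) w)
                + dg (insert_after (hd a) (hd b) w)))
| RI (u v : word nat) a :
    arrow_word (u ++ [:: tl a; hd a] ++ v) ->
    relator (dg (u ++ [:: tl a; hd a] ++ v) - dg (u ++ [:: hd a; tl a] ++ v)).

Definition lin_span (P : free_alg -> Prop) (x : free_alg) : Prop :=
  exists s : seq (rat * free_alg),
    (forall c, c \in s -> P c.2) /\ x = \sum_(c <- s) c.1 *: c.2.

(* The relators are homogeneous, so the degree completion is the product of   *)
(* the graded pieces: its elements are represented by sequences whose n-th    *)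
(* term is a combination of diagrams of degree n, equal when they agree       *)
(* modulo relators in each degree.                                            *)
Definition Asw := series free_alg.

Definition Asw_eq (x y : Asw) : Prop := forall n, lin_span relator (x n - y n).

Definition D_A : free_alg := dg [:: tl 0%N; hd 0%N].

(* A diagram with internal vertices has labelled oriented edges: its skeleton *)
(* word lists the tails and heads of edges that lie on the line, and a vertex *)
(* is a triple (left incoming, right incoming, outgoing edge).                *)
Definition vertex : Type := (nat * nat * nat)%type.

Definition opt_sub (x y : option free_alg) : option free_alg :=
  if (x, y) is (Some a, Some b) then Some (a - b) else None.

(* The vertices are eliminated in the order of the list, by STU_2 when an     *)
(* incoming edge starts on the line and by STU_1 when the outgoing edge ends  *)
(* there; the class of the result does not depend on that order. [None] means *)
(* that the next vertex has none of these.                                    *)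
Fixpoint resolve (vs : seq vertex) (w : word nat) : option free_alg :=
  if vs is (l, r, o) :: vs' then
    if tl r \in w then
      opt_sub (resolve vs' (subst (tl r) [:: tl o; hd l] w))
              (resolve vs' (subst (tl r) [:: hd l; tl o] w))
    else if tl l \in w then
      opt_sub (resolve vs' (subst (tl l) [:: hd r; tl o] w))
              (resolve vs' (subst (tl l) [:: tl o; hd r] w))
    else if hd o \in w then
      opt_sub (resolve vs' (subst (hd o) [:: hd l; hd r] w))
              (resolve vs' (subst (hd o) [:: hd r; hd l] w))
    else None
  else Some (dg w).

(* the spokes are 0, .., k-1 and the cycle edges k, .., 2k-1                  *)
Definition wheel_vertices (k : nat) : seq vertex :=
  [seq (i, k + i, k + i.+1 %% k)%N | i <- iota 0 k].

Definition wheel_skeleton (k : nat) : word nat := [seq tl i | i <- iota 0 k].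

Definition wheel (k : nat) : free_alg :=
  odflt 0 (resolve (wheel_vertices k) (wheel_skeleton k)).

Lemma mem_subst (T : eqType) (x y : T) ys w :
  y \in w -> y != x -> y \in subst x ys w.
Proof.
move=> yw yx; apply/flatten_mapP; exists y => //.
by rewrite (negbTE yx) inE.
Qed.

Lemma resolve_defined (vs : seq vertex) (w : word nat) :
  uniq [seq v.1.1 | v <- vs] ->
  (forall u v, u \in vs -> v \in vs -> u.1.1 != v.1.2) ->
  (forall v, v \in vs -> tl v.1.1 \in w) ->
  resolve vs w.
Proof.
elim: vs w => [|[[l r] o] vs IH] w //= /andP[lvs uvs] lr lw.
have keep x ys : x \notin [seq tl v.1.1 | v <- vs] ->
    resolve vs (subst x ys w).
  move=> xvs; apply: IH => // [u v uvs' vvs|v vvs].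
    by apply: lr; rewrite inE ?uvs' ?vvs orbT.
  apply: mem_subst; first by apply: lw; rewrite inE vvs orbT.
  by apply: contraNneq xvs => <-; apply/mapP; exists v.
have subP a b : isSome a -> isSome b -> isSome (opt_sub a b).
  by case: a b => [a|] [b|].
have ll : tl l \notin [seq tl v.1.1 | v <- vs].
  apply: contraNN lvs => /mapP[v vvs [->]].
  by apply/mapP; exists v.
have rr : tl r \notin [seq tl v.1.1 | v <- vs].
  apply/mapP=> -[v vvs [rv]].
  have /= := lr v (l, r, o); rewrite !inE eqxx vvs orbT -rv eqxx.
  by move=> /(_ isT isT).
case: ifP => _; first by apply: subP; apply: keep.
by rewrite (lw (l, r, o)) ?inE ?eqxx //; apply: subP; apply: keep.
Qed.

Lemma wheel_defined (k : nat) :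
  resolve (wheel_vertices k) (wheel_skeleton k) = Some (wheel k).
Proof.
rewrite /wheel.
suff: resolve (wheel_vertices k) (wheel_skeleton k) by case: resolve.
apply: resolve_defined.
- by rewrite -map_comp map_id_in ?iota_uniq.
- move=> _ _ /mapP[i + ->] /mapP[j _ ->] /=.
  by rewrite mem_iota => ik; rewrite ltn_eqF // (leq_trans ik) // leq_addr.
- by move=> _ /mapP[i ik ->] /=; apply: map_f.
Qed.

(* for c 0 = 0                                                                *)
Definition wmap (c : qseries) : Asw := fun n => (c n : rat) *: wheel n.

Section Invariants.
Context (D : gauss).
Notation n := (narrows D).

Definition sign (i : 'I_n) : int := if gpos D i then 1 else -1.

Definition position (x : 'I_n * bool) : nat := index x (gword D).

Definition direction (i : 'I_n) : int :=
  if (position (tl i) < position (hd i))%N then 1 else -1.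

Definition head_in_span (i j : 'I_n) : bool :=
  (minn (position (tl i)) (position (hd i)) < position (hd j)
     < maxn (position (tl i)) (position (hd i)))%N.

Definition sl : int := \sum_(i < n) sign i.

Definition Xfrac : {fraction {poly int}} := tofrac 'X.

Definition trapping_mx : 'M[{fraction {poly int}}]_n :=
  \matrix_(i, j) (head_in_span i j)%:R.

(* X^{-S}, with S_ii = s_i d_i *)
Definition sign_mx : 'M[{fraction {poly int}}]_n :=
  diag_mx (\row_i Xfrac ^ (- (sign i * direction i))).

Definition alexander : {fraction {poly int}} :=
  \det (1%:M + trapping_mx *m (1%:M - sign_mx)).

(* by TC the order among the parallel copies is immaterial                    *)
Definition cable (k : 'I_n -> nat) : word ('I_n * nat)%type :=
  flatten [seq [seq ((x.1, j), x.2) | j <- iota 0 (k x.1)] | x <- gword D].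

Definition Zinv : Asw := fun m =>
  \sum_(k : {ffun 'I_n -> 'I_m.+1} | \sum_(i < n) (k i : nat) == m)
    (\prod_(i < n) ((sign i)%:~R ^+ k i / (k i)`!%:R))
      *: dg (cable (fun i => k i)).

End Invariants.

(* the Laurent polynomial X^-m p(X) and its value at X = e^x                  *)
Definition laurent (p : {poly int}) (m : nat) : {fraction {poly int}} :=
  tofrac p / Xfrac ^+ m.

Definition laurent_at_exp (p : {poly int}) (m : nat) : qseries := fun n =>
  \sum_(i < size p)
    (p`_i)%:~R * ser_exp (ser_deg1 ((i%:Z - m%:Z)%:~R : rat^o)) n.

Lemma alexander_laurent (D : gauss) :
  exists (p : {poly int}) (m : nat), alexander D = laurent p m.
Proof.
have X0 : Xfrac != 0 by rewrite tofrac_eq0 polyX_eq0.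
have X0n m : Xfrac ^+ m != 0 by rewrite expf_neq0.
have XE : tofrac 'X = Xfrac by [].
pose Lau f := exists p m, f = laurent p m.
have LauZ (z : int) : Lau z%:~R.
  by exists z%:~R, 0%N; rewrite /laurent expr0 divr1 rmorph_int.
have LauD f g : Lau f -> Lau g -> Lau (f + g).
  move=> [p [m ->]] [q [l ->]]; exists (p * 'X^l + q * 'X^m), (m + l)%N.
  rewrite /laurent (addf_div _ _ (X0n m) (X0n l)) exprD tofracD.
  by rewrite !tofracM !tofracXn XE.
have LauM f g : Lau f -> Lau g -> Lau (f * g).
  move=> [p [m ->]] [q [l ->]]; exists (p * q), (m + l)%N.
  by rewrite /laurent mulf_div exprD tofracM.
have LauN f : Lau f -> Lau (- f).
  by move=> Lf; rewrite -mulN1r; apply: (LauM) => //; apply: (LauZ (-1)).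
have LauX (z : int) : Lau (Xfrac ^ z).
  case: z => m; first by exists 'X^m, 0%N; rewrite /laurent expr0 divr1 tofracXn XE.
  by exists 1, m.+1; rewrite /laurent tofrac1 div1r.
have Lau0 : Lau 0 by apply: (LauZ 0).
have Lau1 : Lau 1 by apply: (LauZ 1).
have LauB (b : bool) : Lau b%:R by case: b.
rewrite -/(Lau _) /alexander /determinant; apply: (big_ind Lau) => // s _.
apply: (LauM); first by rewrite -signr_odd; case: odd => //; exact: LauN.
apply: (big_ind Lau) => [//|x y Lx Ly|i _]; first exact: LauM.
rewrite mxE; apply: (LauD).
  by rewrite mxE; exact: LauB.
rewrite mxE; apply: (big_ind Lau) => // j _.
rewrite !mxE; apply: (LauM); first exact: LauB.
apply: (LauD); first exact: LauB.
by apply: (LauN); case: eqP => _; [exact: LauX | exact: Lau0].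
Qed.

(* Main.v *)
(* Take one arrow k of a diagram and move its tail along the line until it
   meets its head. Every head that is crossed costs, by 4T, a bracket, whose
   own tail can be moved in turn; in the end the diagram is D_A times the
   diagram without k, plus one term for every cyclic sequence of distinct arrows
   through k: a wheel times the diagram without these arrows, weighted by a
   product of entries of N k l = [tail k < head l] - [head k < head l]. Expanding
   det N along the row of k gives the same recursion with scalars in place of
   D_A and of the wheels.

   Summed over all cablings, with weight s^k / k! for k copies of an arrow of
   sign s, both recursions become linear equations for the operator x d/dx: one
   for Z(K), and one for a(x), the weighted sum of the determinants. Parallel
   copies contribute only powers of -d to these determinants, so that
   a(x) = det (I + T (I - e^(-x S))) = A(K)(e^x). The equation for a determines
   x d/dx log a; since D_A and the wheels commute in the quotient,
   exp (sl D_A) exp (- w (log a)) solves the equation for Z(K), which has only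
   one solution with constant term 1. *)

From HB Require Import structures.
From Stdlib Require Import ClassicalEpsilon.
Require Import Defs.
From mathcomp Require Import all_boot all_order all_algebra.
From mathcomp Require Import fingroup perm.
From mathcomp Require Import monalg zify ring.

Set Implicit Arguments.
Unset Strict Implicit.
Unset Printing Implicit Defensive.

Import Order.TTheory GRing.Theory Num.Theory.
Local Open Scope ring_scope.

(** * The quotient by the relators *)

(** The weights s^k / k! turn into plain signs once parallel copies carry labels: m! times the part
    of degree m of Z(K) is a signed sum over sequences of m arrows, and singling out the first label
    yields the equations with x d/dx.

    Why only cycles survive: a tail commutes with a head that is already bracketed, since 4T carries
    that bracket away and leaves two tails. So a growing chain extends at a fresh head or closes at
    the head of its first arrow. When the moving tail of a chain of two or more arrows stops at its
    own head, 4T leaves two adjacent tails against a bracket of two heads; exchanging the two arrows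
    shows that the value is its own negative. For a single arrow the same endpoint is D_A.

    The obstacle is that a closed chain is spread along the line and is a wheel only after its
    vertices have been moved past everything else. Past a head, the Jacobi identity and 4T give a
    difference of two larger wheels, with the crossed arrow inserted before or after the moving
    vertex. They differ by the places of two vertices, so an induction on the number of letters
    outside the wheel applies. *)

Section Span.
Context (P : free_alg -> Prop).

Lemma span0 : lin_span P 0.
Proof. by exists [::]; split=> //; rewrite big_nil. Qed.

Lemma spanD x y : lin_span P x -> lin_span P y -> lin_span P (x + y).
Proof.
move=> [s [Ps ->]] [t [Pt ->]]; exists (s ++ t); split; last by rewrite big_cat.
by move=> c; rewrite mem_cat => /orP[/Ps|/Pt].
Qed.

Lemma spanZ a x : lin_span P x -> lin_span P (a *: x).
Proof.
move=> [s [Ps ->]]; exists [seq (a * c.1, c.2) | c <- s]; split.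
  by move=> _ /mapP[c /Ps Pc ->].
by rewrite scaler_sumr big_map; apply: eq_bigr => c _; rewrite scalerA.
Qed.

Lemma span_gen x : P x -> lin_span P x.
Proof.
move=> Px; exists [:: (1, x)]; split; last by rewrite big_seq1 scale1r.
by move=> c; rewrite inE => /eqP ->.
Qed.

Lemma spanN x : lin_span P x -> lin_span P (- x).
Proof. by move=> Px; rewrite -scaleN1r; apply: spanZ. Qed.

Lemma spanB x y : lin_span P x -> lin_span P y -> lin_span P (x - y).
Proof. by move=> Px Py; apply: spanD => //; apply: spanN. Qed.

Lemma span_lin (f : free_alg -> free_alg) x :
  (forall y z, f (y + z) = f y + f z) -> (forall a y, f (a *: y) = a *: f y) ->
  (forall y, P y -> lin_span P (f y)) -> lin_span P x -> lin_span P (f x).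
Proof.
move=> fD fZ Pf [s [Ps ->]].
have f0 : f 0 = 0 by have := fZ 0 0; rewrite !scale0r.
elim: s Ps => [|c s IH] Ps; first by rewrite big_nil f0; exact: span0.
rewrite big_cons fD fZ; apply: spanD.
  by apply/spanZ/Pf/Ps; rewrite inE eqxx.
by apply: IH => d ds; apply: Ps; rewrite inE ds orbT.
Qed.

End Span.

(** Excluded middle turns the span into a boolean predicate, the form in which a subgroup can be
    divided out. *)
Definition relspan : {pred free_alg} :=
  fun x => if excluded_middle_informative (lin_span relator x) then true else false.

Lemma relspanP x : reflect (lin_span relator x) (x \in relspan).
Proof.
by rewrite /in_mem /= /relspan; case: excluded_middle_informative => H; constructor.
Qed.

Fact relspan_zmod : zmod_closed relspan.
Proof.
split; first exact/relspanP/span0.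
by move=> x y /relspanP Px /relspanP Py; apply/relspanP/spanB.
Qed.
HB.instance Definition _ := GRing.isZmodClosed.Build free_alg relspan relspan_zmod.

Local Open Scope quotient_scope.
(** The quotient is formed as an abelian group only; its compatibility with rational scalars is
    [clsZ]. *)
Definition diagrams : zmodType := Quotient.quot relspan.
Definition cls (x : free_alg) : diagrams := \pi_(Quotient.quot relspan) x.
HB.instance Definition _ := GRing.Additive.copy cls (\pi_(Quotient.quot relspan)).

Lemma clsP x y : reflect (lin_span relator (x - y)) (cls x == cls y).
Proof. by rewrite /cls -Quotient.idealrBE; exact: relspanP. Qed.

Lemma cls_eq0 x : reflect (lin_span relator x) (cls x == 0).
Proof. by rewrite -(raddf0 cls) -{1}(subr0 x); exact: clsP. Qed.

Lemma clsZ_eq0 a x : cls x = 0 -> cls (a *: x) = 0.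
Proof. by move/eqP/cls_eq0 => Px; apply/eqP/cls_eq0/spanZ. Qed.

Lemma clsZ a x y : cls x = cls y -> cls (a *: x) = cls (a *: y).
Proof.
move=> xy; apply/eqP; rewrite -subr_eq0 -raddfB -scalerBr; apply/eqP/clsZ_eq0.
by rewrite raddfB /= xy subrr.
Qed.

Lemma arrow_word_perm (L : eqType) (w w' : word L) :
  perm_eq w w' -> arrow_word w = arrow_word w'.
Proof.
move=> pw; rewrite /arrow_word (perm_uniq pw) (perm_all _ pw); congr (_ && _).
by apply: eq_all => x; rewrite (perm_mem pw).
Qed.

Lemma subst_cat (T : eqType) (x : T) ys u v :
  subst x ys (u ++ v) = subst x ys u ++ subst x ys v.
Proof. by rewrite /subst map_cat flatten_cat. Qed.

Lemma subst_notin (T : eqType) (x : T) ys w : x \notin w -> subst x ys w = w.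
Proof.
rewrite /subst; elim: w => //= z w IH; rewrite inE negb_or eq_sym.
by case/andP=> /negbTE -> /IH ->.
Qed.

Lemma subst_mid (T : eqType) (x : T) ys u v :
  x \notin u -> x \notin v -> subst x ys (u ++ x :: v) = u ++ ys ++ v.
Proof.
move=> xu xv; rewrite subst_cat -cat1s subst_cat !(subst_notin _ xu, subst_notin _ xv).
by rewrite /subst /= eqxx cats0.
Qed.

(** * Words as monomials, and the relations in arbitrary contexts *)

Notation ffree := {malg rat[{fmonom (nat * bool)%type}]}.

Definition mono (w : word nat) : ffree := << FMonom w >>.

Lemma malgU_mul (T : choiceType) (u v : seq T) :
  << FMonom (u ++ v) >> = << FMonom u >> * << FMonom v >> :> {malg rat[{fmonom T}]}.
Proof.
rewrite malgM_def fgmulUU mulr1; congr << _ >>; apply/val_inj.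
by rewrite /= fmM.
Qed.

Lemma mono_cat u v : mono (u ++ v) = mono u * mono v.
Proof. exact: malgU_mul. Qed.

Lemma mono_nil : mono [::] = 1.
Proof. by congr << _ >>; apply/val_inj; rewrite /= fm1. Qed.

Lemma dg_code (L M : eqType) (u : word L) (v : word M) : code u = code v -> dg u = dg v.
Proof. by rewrite /dg => ->. Qed.

Definition eval_mono (k : {fmonom (nat * bool)%type}) : free_alg :=
  if arrow_word (k : seq _) then dg (k : seq _) else 0.

(* Words that are not arrow words are sent to 0, so that the local relations hold in
   arbitrary contexts. *)
Definition diag : ffree -> free_alg := mmap (@malgC _ _) eval_mono.
HB.instance Definition _ := GRing.Additive.copy diag (mmap (@malgC _ _) eval_mono).

Lemma diag_mono w : diag (mono w) = if arrow_word w then dg w else 0.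
Proof. by rewrite /diag /mono mmapU mul_malgC scale1r. Qed.

Lemma malgU_scale (K : choiceType) (c : rat) (k : K) :
  << c *g k >> = c *: << k >> :> {malg rat[K]}.
Proof. by apply/malgP => j; rewrite mcoeffZ !mcoeffU mulrnAr mulr1. Qed.

Lemma diag_malgU c k : diag << c *g k >> = c *: eval_mono k.
Proof. by rewrite /diag mmapU mul_malgC. Qed.

Lemma diagZ c x : diag (c *: x) = c *: diag x.
Proof.
rewrite (monalgE x) scaler_sumr (raddf_sum diag) [in RHS](raddf_sum diag) [RHS]scaler_sumr.
apply: eq_bigr => k _ /=; rewrite [in LHS](malgU_scale x@_k) scalerA -malgU_scale.
by rewrite [LHS]diag_malgU [in RHS]diag_malgU scalerA.
Qed.

Lemma ffree_ind (P : ffree -> Prop) :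
  P 0 -> (forall x y, P x -> P y -> P (x + y)) ->
  (forall c w, P (c *: mono w)) -> forall x, P x.
Proof.
move=> P0 PD Pm x; rewrite (monalgE x); apply: (big_ind P) => // k _.
by rewrite malgU_scale; case: k => w; apply: Pm.
Qed.

Definition psi (x : ffree) : diagrams := cls (diag x).

Lemma psiB x y : psi (x - y) = psi x - psi y. Proof. by rewrite /psi !raddfB. Qed.

Lemma psiZ_eq0 c x : psi x = 0 -> psi (c *: x) = 0.
Proof. by rewrite /psi diagZ; exact: clsZ_eq0. Qed.

Lemma malgC_comm (K : monomType) (c : rat) (x : {malg rat[K]}) : c%:MP * x = x * c%:MP.
Proof.
rewrite !malgM_def fgmulUg fgmulgU; apply: eq_bigr => k _.
by rewrite mul1m mulm1 mulrC.
Qed.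

Lemma malg_scalerAr (K : monomType) c (x y : {malg rat[K]}) : c *: (x * y) = x * (c *: y).
Proof. by rewrite -!mul_malgC mulrA malgC_comm -mulrA. Qed.

Lemma psi_mono c w :
  psi (c *: mono w) = if arrow_word w then cls (c *: dg w) else 0.
Proof. by rewrite /psi diagZ diag_mono; case: ifP; rewrite // scaler0 raddf0. Qed.

Lemma psi_mono1 w : psi (mono w) = if arrow_word w then cls (dg w) else 0.
Proof. by rewrite /psi diag_mono; case: ifP; rewrite // raddf0. Qed.

Lemma psi_mono2 u v : perm_eq u v ->
  (arrow_word u -> lin_span relator (dg u - dg v)) -> psi (mono u - mono v) = 0.
Proof.
move=> puv Huv; rewrite [LHS]psiB [psi (mono u)]psi_mono1 [psi (mono v)]psi_mono1.
rewrite -(arrow_word_perm puv); case: ifP => [/Huv/cls_eq0/eqP <-|_]; last exact: subrr.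
by rewrite [RHS]raddfB.
Qed.

Lemma psi_mono4 u v w z : perm_eq v u -> perm_eq w u -> perm_eq z u ->
  (arrow_word u -> lin_span relator (dg u - dg v - (dg w - dg z))) ->
  psi (mono u - mono v - (mono w - mono z)) = 0.
Proof.
move=> pv pw pz Huv.
have -> : psi (mono u - mono v - (mono w - mono z)) =
    psi (mono u) - psi (mono v) - (psi (mono w) - psi (mono z)).
  by rewrite [LHS]psiB; congr (_ - _); exact: psiB.
rewrite [psi (mono u)]psi_mono1 [psi (mono v)]psi_mono1.
rewrite [psi (mono w)]psi_mono1 [psi (mono z)]psi_mono1.
rewrite (arrow_word_perm pv) (arrow_word_perm pw) (arrow_word_perm pz).
case: ifP => [/Huv/cls_eq0/eqP <-|_]; last by rewrite !subr0.
by symmetry; rewrite [LHS]raddfB; congr (_ - _); exact: raddfB.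
Qed.

Lemma code_relabel (L M : eqType) (f : L -> M) (w : word L) :
  injective f -> code (relabel f w) = code w.
Proof.
move=> f_inj; rewrite /code /relabel -map_comp; apply: eq_map => x /=.
have g_inj : injective (fun x : L * bool => (f x.1, x.2)) by move=> [a b] [c d] [/f_inj -> ->].
by rewrite -[(f x.1, ~~ _)]/((fun x => (f x.1, x.2)) (x.1, ~~ x.2)) !(index_map g_inj).
Qed.

Lemma arrow_word_relabel (L M : eqType) (f : L -> M) (w : word L) :
  injective f -> arrow_word (relabel f w) = arrow_word w.
Proof.
move=> f_inj; have g_inj : injective (fun x : L * bool => (f x.1, x.2)).
  by move=> [a b] [c d] [/f_inj -> ->].
rewrite /arrow_word map_inj_uniq // all_map; congr (_ && _).
by apply: eq_all => x /=; rewrite -(mem_map g_inj).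
Qed.

Section Relabel.
Context (f : nat -> nat) (f_inj : injective f).

Definition rl_eval (k : {fmonom (nat * bool)%type}) : ffree := mono (relabel f (k : seq _)).
Definition rl : ffree -> ffree := mmap (@malgC _ _) rl_eval.

Fact rl_additive : {morph rl : x y / x - y}.
Proof. exact: mmap_is_additive. Qed.

Lemma rl_mono c w : rl (c *: mono w) = c *: mono (relabel f w).
Proof. by rewrite /mono -malgU_scale /rl mmapU mul_malgC. Qed.

Lemma psi_relabel c w : psi (c *: mono (relabel f w)) = psi (c *: mono w).
Proof.
have aw := arrow_word_relabel w f_inj.
apply: (etrans (psi_mono c (relabel f w))); rewrite aw.
by apply/esym/(etrans (psi_mono c w)); rewrite /dg code_relabel.
Qed.

End Relabel.

Ltac perm_count := apply/seq.permP => ?; rewrite /= ?count_cat /= ?count_cat /=; lia.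

Lemma uniq_mid (T : eqType) (x : T) u v :
  uniq (u ++ x :: v) -> x \notin u /\ x \notin v.
Proof. by rewrite cat_uniq /= negb_or => /and3P[_ /andP[-> _] /andP[-> _]]. Qed.

(* The ring of words is kept abstract: unification is too expensive in the free algebra. *)
Record word_model (F : lalgType rat) (A : zmodType) := WordModel {
  value : {additive F -> A};
  monom : word nat -> F;
  scaler_comm : forall c (x y : F), c *: (x * y) = x * (c *: y);
  val_scale : forall c x, value x = 0 -> value (c *: x) = 0;
  monom_nil : monom [::] = 1;
  monom_cat : forall u v, monom (u ++ v) = monom u * monom v;
  monom_ind : forall P : F -> Prop, P 0 -> (forall x y, P x -> P y -> P (x + y)) ->
    (forall c w, P (c *: monom w)) -> forall x, P x;
  val_monom2 : forall u v, perm_eq u v ->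
    (arrow_word u -> lin_span relator (dg u - dg v)) -> value (monom u - monom v) = 0;
  val_monom4 : forall u v w z, perm_eq v u -> perm_eq w u -> perm_eq z u ->
    (arrow_word u -> lin_span relator (dg u - dg v - (dg w - dg z))) ->
    value (monom u - monom v - (monom w - monom z)) = 0;
  class_of : {additive free_alg -> A};
  val_monom : forall c u, arrow_word u -> value (c *: monom u) = class_of (c *: dg u);
  rename : (nat -> nat) -> {additive F -> F};
  rename_monom : forall f c w, rename f (c *: monom w) = c *: monom (relabel f w);
  val_rename : forall f c w, injective f -> value (rename f (c *: monom w)) = value (c *: monom w)
}.

Section Local.
Context (F : lalgType rat) (A : zmodType) (M : word_model F A).
Notation psi := (value M).
Notation mono := (monom M).

Definition lt a : F := mono [:: tl a].
Definition lh a : F := mono [:: hd a].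
Definition br (x y : F) : F := x * y - y * x.

Let F_ind := @monom_ind _ _ M.

Lemma val_half x : psi x = - psi x -> psi x = 0.
Proof.
move=> xN; have -> : x = 2%:R^-1 *: (x + x) by rewrite -mulr2n -scaler_nat scalerK.
by apply: val_scale; rewrite raddfD {2}xN subrr.
Qed.

(** Relations are given between words; linearity extends them to contexts that are themselves sums,
    such as products of brackets. *)
Lemma val_ctx2 (r : F) :
  (forall u v, psi (mono u * r * mono v) = 0) -> forall X Y, psi (X * r * Y) = 0.
Proof.
move=> rP X Y; elim/F_ind: X => [|X1 X2 IH1 IH2|c u].
- by rewrite !mul0r raddf0.
- by rewrite !mulrDl raddfD IH1 IH2 addr0.
rewrite -!scalerAl; apply: val_scale.
elim/F_ind: Y => [|Y1 Y2 IH1 IH2|d v].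
- by rewrite !mulr0 raddf0.
- by rewrite !mulrDr raddfD IH1 IH2 addr0.
by rewrite -(scaler_comm M); apply: val_scale.
Qed.

(** Three contexts serve 4T, which acts at two places of the line at once. *)
Lemma val_ctx3 (p q r s : F) :
  (forall u v w,
     psi (mono u * p * mono v * q * mono w - mono u * r * mono v * s * mono w) = 0) ->
  forall X Y Z, psi (X * p * Y * q * Z) = psi (X * r * Y * s * Z).
Proof.
move=> rP X Y Z; apply/eqP; rewrite -subr_eq0 -raddfB; apply/eqP.
elim/F_ind: X => [|X1 X2 IH1 IH2|c u].
- by rewrite !mul0r subr0 raddf0.
- by rewrite !mulrDl opprD addrACA raddfD IH1 IH2 addr0.
rewrite -!scalerAl -scalerBr; apply: val_scale.
elim/F_ind: Z => [|Z1 Z2 IH1 IH2|d w].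
- by rewrite !mulr0 subr0 raddf0.
- by rewrite !mulrDr opprD addrACA raddfD IH1 IH2 addr0.
rewrite -!(scaler_comm M) -scalerBr; apply: val_scale.
elim/F_ind: Y => [|Y1 Y2 IH1 IH2|e v].
- by rewrite !(mulr0, mul0r) subr0 raddf0.
- by rewrite !(mulrDl, mulrDr) opprD addrACA raddfD IH1 IH2 addr0.
by rewrite -!(scaler_comm M) -!scalerAl -scalerBr; apply: val_scale.
Qed.

Lemma val_TC X Y a b : psi (X * br (lt a) (lt b) * Y) = 0.
Proof.
apply: val_ctx2 => u v; rewrite /br mulrBr mulrBl !mulrA -!monom_cat -!catA.
apply: val_monom2; [|by move=> uv; apply/span_gen/TC].
by perm_count.
Qed.

Lemma val_RI X Y a : psi (X * br (lt a) (lh a) * Y) = 0.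
Proof.
apply: val_ctx2 => u v; rewrite /br mulrBr mulrBl !mulrA -!monom_cat -!catA.
apply: val_monom2; [|by move=> uv; apply/span_gen/RI].
by perm_count.
Qed.

Lemma four_span (w : word nat) a b :
  arrow_word (hd b :: w) -> a != b -> hd a \in w ->
  lin_span relator (dg (insert_after (tl a) (hd b) w) - dg (insert_before (tl a) (hd b) w)
    - (dg (insert_before (hd a) (hd b) w) - dg (insert_after (hd a) (hd b) w))).
Proof.
move=> bw ab aw; have := span_gen (FourT bw ab aw); move/spanN; congr lin_span.
by rewrite opprB opprD addrACA opprB [X in _ + X]addrC.
Qed.

(** The relator [FourT] with its four terms regrouped into two commutators, one at each end of [a].
    Here the tail of [a] comes first along the line, in [val_4T_rl] its head. *)
Lemma val_4T_lr X Y Z a b :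
  psi (X * br (lt a) (lh b) * Y * lh a * Z) = psi (X * lt a * Y * br (lh b) (lh a) * Z).
Proof.
move: X Y Z; apply: val_ctx3 => u v w.
rewrite /br !(mulrBr, mulrBl) !mulrA -!monom_cat -!catA.
set x := [:: tl a]; set y := [:: hd b]; set z := [:: hd a].
apply: val_monom4; [perm_count..|]; rewrite /x /y /z => aw.
have bw : arrow_word (hd b :: u ++ tl a :: v ++ hd a :: w).
  by rewrite -(arrow_word_perm (w := u ++ x ++ y ++ v ++ z ++ w)) //; perm_count.
have /andP[uw _] := aw.
have [xu xv] := uniq_mid (uw : uniq (u ++ tl a :: hd b :: v ++ hd a :: w)).
have [zu zv] : hd a \notin u ++ tl a :: hd b :: v /\ hd a \notin w.
  by apply: uniq_mid; rewrite -catA.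
have ab : a != b by apply: contraNneq zu => ->; rewrite !(mem_cat, inE) eqxx !orbT.
have nott : tl a \notin v ++ hd a :: w by move: xv; rewrite inE => /norP[].
have noth : hd a \notin u ++ tl a :: v.
  by apply: contra zu; rewrite !(mem_cat, inE) => /or3P[] ->; rewrite ?orbT.
have := four_span bw ab; rewrite /insert_after /insert_before.
rewrite !(subst_mid _ xu nott) -[u ++ _ :: _ ++ _]/(u ++ (tl a :: v) ++ hd a :: w).
rewrite catA !(subst_mid _ noth zv) -!catA; apply.
by rewrite !(mem_cat, inE) eqxx !orbT.
Qed.

Lemma val_4T_rl X Y Z a b :
  psi (X * lh a * Y * br (lt a) (lh b) * Z) = psi (X * br (lh b) (lh a) * Y * lt a * Z).
Proof.
move: X Y Z; apply: val_ctx3 => u v w.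
rewrite /br !(mulrBr, mulrBl) !mulrA -!monom_cat -!catA.
set x := [:: tl a]; set y := [:: hd b]; set z := [:: hd a].
apply: val_monom4; [perm_count..|]; rewrite /x /y /z => aw.
have bw : arrow_word (hd b :: u ++ hd a :: v ++ tl a :: w).
  by rewrite -(arrow_word_perm (w := u ++ z ++ v ++ x ++ y ++ w)) //; perm_count.
have /andP[uw _] := aw.
have [zu zv] := uniq_mid (uw : uniq (u ++ hd a :: v ++ tl a :: hd b :: w)).
have [xu xv] : tl a \notin u ++ hd a :: v /\ tl a \notin hd b :: w.
  by apply: uniq_mid; rewrite -catA.
have ab : a != b by apply: contraNneq zv => ->; rewrite !(mem_cat, inE) eqxx !orbT.
have nott : tl a \notin w by move: xv; rewrite inE => /norP[].
have noth : hd a \notin v ++ tl a :: w.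
  by apply: contra zv; rewrite !(mem_cat, inE) => /or3P[] ->; rewrite ?orbT.
have := four_span bw ab; rewrite /insert_after /insert_before.
rewrite !(subst_mid _ zu noth) -[u ++ _ :: _ ++ _]/(u ++ (hd a :: v) ++ tl a :: w).
rewrite catA !(subst_mid _ xu nott) -!catA; apply.
by rewrite !(mem_cat, inE) eqxx !orbT.
Qed.

End Local.

Lemma mem_split (T : eqType) (x : T) s : x \in s -> exists u v, s = u ++ x :: v.
Proof. by case/splitPr=> u v; exists u, v. Qed.

(** * Products over slots, and linear contexts *)

Section Slots.
Context (F : lalgType rat) (A : zmodType) (M : word_model F A).
Notation psi := (value M).

(** The functions linear in one occurrence of [y]: they let a relation act on a letter that sits
    inside nested brackets. *)
Definition lctx (G : F -> F) :=
  exists s : seq (F * F), forall y, G y = \sum_(c <- s) c.1 * y * c.2.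

Lemma lctx_id : lctx id.
Proof. by exists [:: (1, 1)] => y; rewrite big_seq1 mul1r mulr1. Qed.

Lemma lctx_mull x G : lctx G -> lctx (fun y => x * G y).
Proof.
case=> s sP; exists [seq (x * c.1, c.2) | c <- s] => y.
by rewrite sP big_map mulr_sumr; apply: eq_bigr => c _; rewrite !mulrA.
Qed.

Lemma lctx_mulr x G : lctx G -> lctx (fun y => G y * x).
Proof.
case=> s sP; exists [seq (c.1, c.2 * x) | c <- s] => y.
by rewrite sP big_map mulr_suml; apply: eq_bigr => c _; rewrite !mulrA.
Qed.

Lemma lctx_comp G G' : lctx G -> lctx G' -> lctx (G \o G').
Proof.
case=> s sP [t tP]; exists [seq (c.1 * d.1, d.2 * c.2) | c <- s, d <- t] => y.
rewrite /= sP big_allpairs_dep /=; apply: eq_bigr => c _.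
by rewrite tP mulr_sumr mulr_suml; apply: eq_bigr => d _; rewrite !mulrA.
Qed.

Lemma lctxN G : lctx G -> lctx (fun y => - G y).
Proof.
case=> s sP; exists [seq (- c.1, c.2) | c <- s] => y.
by rewrite sP big_map -sumrN; apply: eq_bigr => c _; rewrite !mulNr.
Qed.

Lemma lctxD G G' : lctx G -> lctx G' -> lctx (fun y => G y + G' y).
Proof. by case=> s sP [s' sP']; exists (s ++ s') => y; rewrite big_cat -sP -sP'. Qed.

Lemma lctx_brr x G : lctx G -> lctx (fun y => br x (G y)).
Proof. by move=> Gc; apply: lctxD; [exact: lctx_mull|exact/lctxN/lctx_mulr]. Qed.

Lemma lctx_brl x G : lctx G -> lctx (fun y => br (G y) x).
Proof. by move=> Gc; apply: lctxD; [exact: lctx_mulr|exact/lctxN/lctx_mull]. Qed.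

Lemma lctxE_B G x y : lctx G -> G (x - y) = G x - G y.
Proof.
case=> s sP; rewrite !sP -sumrB; apply: eq_bigr => c _.
by rewrite mulrBr mulrBl.
Qed.

Lemma lctxE_N G x : lctx G -> G (- x) = - G x.
Proof.
by case=> s sP; rewrite !sP -sumrN; apply: eq_bigr => c _; rewrite mulrN mulNr.
Qed.

Lemma brN (x y : F) : br x y = - br y x. Proof. by rewrite /br opprB. Qed.
Lemma brNr (x y : F) : br x (- y) = - br x y.
Proof. by rewrite /br mulrN mulNr opprD opprK. Qed.

Context (S : eqType) (w : seq S) (uw : uniq w).
Implicit Types (r : S -> F) (p q : S).

(** The places of the line are named by the elements of [w], and [r] says what stands there. A
    relation then changes [r] at one or two names, wherever these lie along the line. *)
Definition slotprod r : F := \prod_(z <- w) r z.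
Notation V r := (psi (slotprod r)).

Definition agree (s : seq S) r r' := forall z, z \in w -> z \notin s -> r z = r' z.

Lemma slotprod_ext r r' : {in w, r =1 r'} -> slotprod r = slotprod r'.
Proof. by move=> rr; apply: eq_big_seq. Qed.

Lemma slotprod1 p r : p \in w ->
  exists X Y, forall r', agree [:: p] r r' -> slotprod r' = X * r' p * Y.
Proof.
case/mem_split=> u [v wE]; have [pu pv] : p \notin u /\ p \notin v.
  by apply: uniq_mid; rewrite -wE.
exists (\prod_(z <- u) r z), (\prod_(z <- v) r z) => r' rr'.
rewrite /slotprod wE big_cat big_cons /= mulrA; congr (_ * _ * _).
  apply: eq_big_seq => z zu; apply/esym/rr'; first by rewrite wE mem_cat zu.
  by rewrite inE; apply: contraNneq pu => <-.
apply: eq_big_seq => z zv; apply/esym/rr'; first by rewrite wE mem_cat inE zv !orbT.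
by rewrite inE; apply: contraNneq pv => <-.
Qed.

Lemma slotprod2_lr u1 u2 u3 p q r : w = u1 ++ p :: u2 ++ q :: u3 ->
  exists X Y Z, forall r', agree [:: p; q] r r' -> slotprod r' = X * r' p * Y * r' q * Z.
Proof.
move=> wE; have [p1 p2] : p \notin u1 /\ p \notin u2 ++ q :: u3.
  by apply: uniq_mid; rewrite -wE.
have [q1 q3] : q \notin u1 ++ p :: u2 /\ q \notin u3.
  by apply: uniq_mid; rewrite -catA -wE.
move: p2 q1; rewrite !(mem_cat, inE) => /norP[p2 /norP[pq p3]] /norP[q1 /norP[_ q2]].
exists (\prod_(z <- u1) r z), (\prod_(z <- u2) r z), (\prod_(z <- u3) r z) => r' rr'.
rewrite /slotprod wE !(big_cat, big_cons) /= !mulrA.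
have seg u : {subset u <= w} -> p \notin u -> q \notin u ->
    \prod_(z <- u) r' z = \prod_(z <- u) r z.
  move=> uw' pu qu; apply: eq_big_seq => z zu; apply/esym/rr'; first exact: uw'.
  by rewrite !inE; apply/norP; split; [apply: contraNneq pu | apply: contraNneq qu] => <-.
by rewrite !seg // => z zu; rewrite wE !(mem_cat, inE) zu ?orbT.
Qed.

Lemma slotprod2 p q r : p \in w -> q \in w -> p != q ->
  exists X Y Z, (forall r', agree [:: p; q] r r' -> slotprod r' = X * r' p * Y * r' q * Z)
    \/ (forall r', agree [:: p; q] r r' -> slotprod r' = X * r' q * Y * r' p * Z).
Proof.
case/mem_split=> u [v wE]; rewrite wE mem_cat inE eq_sym => qw pq.
rewrite (negbTE pq) /= in qw; case/orP: qw => /mem_split[u' [v' vE]].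
  have [|X [Y [Z H]]] := @slotprod2_lr u' v' v q p r.
    by rewrite wE vE -catA.
  exists X, Y, Z; right => r' rr'; apply: H => z zw zpq; apply: rr' => //.
  by move: zpq; rewrite !inE orbC.
have [|X [Y [Z H]]] := @slotprod2_lr u u' v' p q r; first by rewrite wE vE.
by exists X, Y, Z; left.
Qed.

Lemma val_linB p r r1 r2 : p \in w -> agree [:: p] r r1 -> agree [:: p] r r2 ->
  r p = r1 p - r2 p -> V r = V r1 - V r2.
Proof.
move=> pw a1 a2 E; have [X [Y H]] := slotprod1 r pw.
by rewrite !H // E mulrBr mulrBl raddfB.
Qed.

Lemma val_linN p r r1 : p \in w -> agree [:: p] r r1 -> r p = - r1 p -> V r = - V r1.
Proof.
move=> pw a1 E; have [X [Y H]] := slotprod1 r pw.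
by rewrite !H // E mulrN mulNr raddfN.
Qed.

Lemma val_slot0 p r : p \in w -> r p = 0 -> V r = 0.
Proof.
by move=> pw E; have [X [Y ->//]] := slotprod1 r pw; rewrite E mulr0 mul0r raddf0.
Qed.

Lemma val_slot_ctx p r G x : lctx G -> (forall X Y, psi (X * x * Y) = 0) ->
  p \in w -> r p = G x -> V r = 0.
Proof.
case=> s sP x0 pw E; have [X [Y ->//]] := slotprod1 r pw.
rewrite E sP mulr_sumr mulr_suml raddf_sum big1_seq // => c _.
by have := x0 (X * c.1) (c.2 * Y); rewrite !mulrA.
Qed.

(* The relation 4T, moved to the head of [a]: crossing the tail of [a] amounts to a
   bracket at the head of [a]. *)
Lemma val_slot_4T p q r r' G1 G2 a b : lctx G1 -> lctx G2 ->
  p \in w -> q \in w -> p != q -> agree [:: p; q] r r' ->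
  r p = G1 (br (lt M a) (lh M b)) -> r q = G2 (lh M a) ->
  r' p = G1 (lt M a) -> r' q = G2 (br (lh M b) (lh M a)) -> V r = V r'.
Proof.
move=> [s sP] [t tP] pw qw pq rr' rp rq r'p r'q.
have [X [Y [Z [H|H]]]] := slotprod2 r pw qw pq.
  rewrite !H // rp rq r'p r'q !sP !tP.
  rewrite !(mulr_sumr, mulr_suml) !raddf_sum; apply: eq_bigr => c _.
  rewrite !(mulr_sumr, mulr_suml) !raddf_sum; apply: eq_bigr => d _.
  have := val_4T_lr M (X * d.1) (d.2 * Y * c.1) (c.2 * Z) a b.
  by rewrite !mulrA.
rewrite !H // rp rq r'p r'q !sP !tP.
rewrite !(mulr_sumr, mulr_suml) !raddf_sum; apply: eq_bigr => c _.
rewrite !(mulr_sumr, mulr_suml) !raddf_sum; apply: eq_bigr => d _.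
have := val_4T_rl M (X * d.1) (d.2 * Y * c.1) (c.2 * Z) a b.
by rewrite !mulrA.
Qed.

End Slots.
Arguments lctx_id {F}.

Definition upd (T : eqType) (A : Type) (r : T -> A) (p : T) (x : A) : T -> A :=
  fun z => if z == p then x else r z.

Ltac agr := let z := fresh "z" in
  move=> z _ ; rewrite ?inE /upd; do ?[case: eqP => //= _].

Section Slots2.
Context (F : lalgType rat) (A : zmodType) (M : word_model F A).
Notation psi := (value M).
Notation lt := (lt M).
Notation lh := (lh M).
Let F_ind := @monom_ind _ _ M.

Lemma renameM f x y : rename M f (x * y) = rename M f x * rename M f y.
Proof.
elim/F_ind: x => [|x1 x2 IH1 IH2|c u]; first by rewrite !(mul0r, raddf0).
  by rewrite mulrDl !raddfD IH1 IH2 mulrDl.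
elim/F_ind: y => [|x1 x2 IH1 IH2|d v]; first by rewrite !(mulr0, raddf0).
  by rewrite mulrDr !raddfD IH1 IH2 mulrDr.
rewrite -scalerAl -(scaler_comm M) scalerA -monom_cat !rename_monom.
by rewrite -scalerAl -(scaler_comm M) scalerA -monom_cat /relabel map_cat.
Qed.

Lemma rename1 f : rename M f 1 = 1.
Proof. by rewrite -(monom_nil M) -[monom M _]scale1r rename_monom scale1r. Qed.

Lemma rename_lt f a : rename M f (lt a) = lt (f a).
Proof. by rewrite -[lt a]scale1r rename_monom scale1r. Qed.

Lemma rename_lh f a : rename M f (lh a) = lh (f a).
Proof. by rewrite -[lh a]scale1r rename_monom scale1r. Qed.

Lemma rename_br f x y : rename M f (br x y) = br (rename M f x) (rename M f y).
Proof. by rewrite raddfB !renameM. Qed.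

Lemma rename_prod f (S : Type) (s : seq S) (r : S -> F) :
  rename M f (\prod_(z <- s) r z) = \prod_(z <- s) rename M f (r z).
Proof.
by elim: s => [|z s IH]; rewrite ?big_nil ?rename1 // !big_cons renameM IH.
Qed.

Lemma value_rename f x : injective f -> psi (rename M f x) = psi x.
Proof.
move=> f_inj; elim/F_ind: x => [|x1 x2 IH1 IH2|c u]; first by rewrite !raddf0.
  by rewrite !raddfD IH1 IH2.
exact: val_rename.
Qed.

Definition swapn (j k x : nat) := if x == j then k else if x == k then j else x.

Lemma swapnK j k : involutive (swapn j k).
Proof. by move=> x; rewrite /swapn; do !case: eqP => //; congruence. Qed.

Lemma swapn_inj j k : injective (swapn j k).
Proof. exact: inv_inj (swapnK j k). Qed.

Lemma swapn_l j k : swapn j k j = k. Proof. by rewrite /swapn eqxx. Qed.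
Lemma swapn_r j k : swapn j k k = j.
Proof. by rewrite /swapn eqxx; case: eqP. Qed.
Lemma swapn_id j k x : x != j -> x != k -> swapn j k x = x.
Proof. by rewrite /swapn => /negbTE -> /negbTE ->. Qed.

Context (S : eqType) (w : seq S) (uw : uniq w).
Implicit Types (r : S -> F) (p q : S).
Notation V r := (psi (slotprod w r)).

Lemma upd_same r p x : upd r p x p = x. Proof. by rewrite /upd eqxx. Qed.
Lemma upd_other r p x q : q != p -> upd r p x q = r q.
Proof. by rewrite /upd => /negbTE ->. Qed.

Lemma val_upd_ctxB p r G x y : lctx G -> p \in w ->
  V (upd r p (G (x - y))) = V (upd r p (G x)) - V (upd r p (G y)).
Proof.
move=> Gc pw; apply: (val_linB M uw pw); [agr|agr|].
by rewrite !upd_same lctxE_B.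
Qed.

Lemma val_slot_TC p r G a b : lctx G -> p \in w -> r p = G (br (lt a) (lt b)) -> V r = 0.
Proof. by move=> Gc pw rp; apply: (val_slot_ctx uw Gc _ pw rp) => X Y; apply: val_TC. Qed.

Lemma val_slot_RI p r G a : lctx G -> p \in w -> r p = G (br (lt a) (lh a)) -> V r = 0.
Proof. by move=> Gc pw rp; apply: (val_slot_ctx uw Gc _ pw rp) => X Y; apply: val_RI. Qed.

Lemma slotprod_upd r p x : r p = x -> slotprod w (upd r p x) = slotprod w r.
Proof. by move=> rp; apply: slotprod_ext => z _; rewrite /upd; case: eqP => // ->. Qed.

(** 4T trades the inner bracket at [p] for one around the head of [a] in slot [q]. What is left at
    [p] is a bracket of two tails, and tails commute. *)
Lemma val_slot_tt p q r G1 G2 a b c : lctx G1 -> lctx G2 ->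
  p \in w -> q \in w -> p != q ->
  r p = G1 (br (lt c) (br (lt a) (lh b))) -> r q = G2 (lh a) -> V r = 0.
Proof.
move=> G1c G2c pw qw pq rp rq; rewrite -(slotprod_upd rp) {2}/br val_upd_ctxB //.
pose r1 := upd r q (G2 (br (lh b) (lh a))).
have E G : lctx G -> V (upd r p (G (br (lt a) (lh b)))) = V (upd r1 p (G (lt a))).
  move=> Gc; apply: (val_slot_4T uw Gc G2c pw qw pq) => //.
  - by rewrite /r1; agr.
  - by rewrite upd_same.
  - by rewrite upd_other // eq_sym.
  - by rewrite upd_same.
  - by rewrite upd_other 1?eq_sym // /r1 upd_same.
have Gl : lctx (fun y => G1 (lt c * y)) := lctx_comp G1c (lctx_mull (lt c) lctx_id).
have Gr : lctx (fun y => G1 (y * lt c)) := lctx_comp G1c (lctx_mulr (lt c) lctx_id).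
rewrite (E _ Gl) (E _ Gr).
by rewrite -val_upd_ctxB //; apply: (val_slot_TC G1c pw); rewrite upd_same.
Qed.

(* Two legs that meet are exchanged by renaming, whereas the bracket changes sign. *)
Lemma val_slot_anti p q r G j k : lctx G -> p \in w -> q \in w -> p != q ->
  (forall z, z \in w -> z != p -> z != q -> rename M (swapn j k) (r z) = r z) ->
  (forall y, rename M (swapn j k) (G y) = G (rename M (swapn j k) y)) ->
  r p = br (lt j) (lh k) * lt k -> r q = G (lh j) -> V r = 0.
Proof.
move=> Gc pw qw pq rz rG rp rq.
pose r1 := upd (upd r q (G (br (lh k) (lh j)))) p (lt j * lt k).
have E : V r = V r1.
  apply: (val_slot_4T uw (lctx_mulr (lt k) lctx_id) Gc pw qw pq _ rp rq).
  - by rewrite /r1; agr.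
  - by rewrite /r1 upd_same.
  - by rewrite /r1 upd_other 1?eq_sym // upd_same.
have qp : q != p by rewrite eq_sym.
have r1q : r1 q = G (br (lh k) (lh j)) by rewrite /r1 upd_other // upd_same.
have r1p : r1 p = lt j * lt k by rewrite /r1 upd_same.
have E1 : V r1 = - V r1.
  rewrite -{1}(value_rename _ (@swapn_inj j k)) rename_prod.
  pose r2 := upd r1 p (lt k * lt j).
  have -> : \prod_(z <- w) rename M (swapn j k) (r1 z) = slotprod w (upd r2 q (- r2 q)).
    apply: slotprod_ext => z zw; case: (eqVneq z q) => [->|zq].
      rewrite upd_same /r2 upd_other // r1q rG rename_br !rename_lh swapn_l swapn_r.
      by rewrite brN lctxE_N.
    rewrite upd_other // /r2; case: (eqVneq z p) => [->|zp].
      by rewrite upd_same r1p renameM !rename_lt swapn_l swapn_r.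
    by rewrite upd_other // /r1 !upd_other // rz.
  rewrite (val_linN M uw (r1 := r2) qw); [|by agr|by rewrite upd_same].
  congr (- _); have := @val_upd_ctxB p r1 id (lt k * lt j) (lt j * lt k) lctx_id pw.
  rewrite (val_slot_TC lctx_id pw (upd_same _ _ _)) => /esym/eqP.
  rewrite subr_eq0 => /eqP ->; rewrite slotprod_upd //; exact: upd_same.
by rewrite E; apply: val_half.
Qed.

End Slots2.

Definition tok : eqType := ((nat * bool) + nat)%type.
Definition is_token (z : tok) := if z is inr _ then true else false.
Definition plain (w : seq tok) : word nat :=
  pmap (fun z : tok => if z is inl x then Some x else None) w.

Lemma plain_cat u v : plain (u ++ v) = plain u ++ plain v.
Proof. exact: pmap_cat. Qed.

Lemma perm_plain u v : perm_eq u v -> perm_eq (plain u) (plain v).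
Proof. exact: perm_pmap. Qed.

Lemma mem_plain z w : (z \in plain w) = ((inl z : tok) \in w).
Proof.
rewrite /plain; elim: w => //= -[x|a] w IH; rewrite !inE IH //.
Qed.

Lemma plain_nil w : (plain w == [::]) = all is_token w.
Proof. by elim: w => //= -[x|a] w. Qed.

Section Reorder.
Context (R : Type) (f : seq tok -> R) (w0 : seq tok) (uw0 : uniq w0).
Hypothesis swap : forall u v x y, perm_eq (u ++ [:: x; y] ++ v) w0 ->
  is_token x || is_token y -> f (u ++ [:: x; y] ++ v) = f (u ++ [:: y; x] ++ v).

Lemma pull_front p x u v : perm_eq (p ++ u ++ x :: v) w0 ->
  is_token x || all is_token u -> f (p ++ u ++ x :: v) = f (p ++ x :: u ++ v).
Proof.
elim/last_ind: u v => // u y IH v; rewrite all_rcons.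
rewrite cat_rcons => pw xy.
have <- : f (p ++ u ++ [:: x; y] ++ v) = f (p ++ u ++ y :: x :: v).
  rewrite !(catA p u); apply/esym/swap; first by rewrite -catA.
  by case/orP: xy => [->|/andP[-> _]]; rewrite ?orbT.
rewrite [RHS]/= cat_rcons -IH //; last by case/orP: xy => [->|/andP[_ ->]]; rewrite ?orbT.
by apply: perm_trans pw; perm_count.
Qed.

(** An insertion sort in which every exchange involves a token: plain letters never pass each other,
    which is why equal plain words are asked for. *)
Lemma reorder w w' p : perm_eq (p ++ w) w0 -> perm_eq w w' -> plain w = plain w' ->
  f (p ++ w) = f (p ++ w').
Proof.
elim: w' w p => [|x w' IH] w p pw ww'.
  by move: ww' => /perm_nilP ->.
have /mem_split[u [v wE]] : x \in w by rewrite (perm_mem ww') inE eqxx.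
(* If [x] is a plain letter, it is the first one of [w'], hence of [w], so that only tokens stand
   before it. *)
move=> pww'; have xu : is_token x || all is_token u.
  case: x ww' wE pww' => //= x _ wE; rewrite wE plain_cat -plain_nil.
  have := pw; rewrite wE => /perm_uniq; rewrite uw0 cat_uniq => /and3P[_ _ /uniq_mid[xu _]].
  case: (plain u) (mem_plain x u) => //= y s xs [yx].
  by move: xs; rewrite yx inE eqxx (negbTE xu).
have pE : plain (u ++ v) = plain w'.
  move: pww'; rewrite wE !plain_cat; case: x {ww' wE} xu => [x|a] //=.
  by rewrite -plain_nil => /eqP -> /= [].
rewrite wE pull_front -?wE // -!cat_rcons; apply: IH => //.
  by rewrite cat_rcons; apply: perm_trans pw; rewrite wE; perm_count.
by move: ww'; rewrite wE perm_catC /= perm_cons perm_catC.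
Qed.

End Reorder.

Lemma uniq_del2 (T : eqType) (x y : T) u v :
  uniq (u ++ [:: x; y] ++ v) -> uniq (u ++ x :: v).
Proof.
rewrite (perm_uniq (_ : perm_eq _ (y :: u ++ x :: v))); first by case/andP.
by perm_count.
Qed.

(** * Wheels *)

Section Wheel.
Context (F : lalgType rat) (A : zmodType) (M : word_model F A).
Notation psi := (value M).
Notation lt := (lt M).
Notation lh := (lh M).
Implicit Types (pr nx : nat -> nat) (w u v : seq tok) (j g l : nat).

(* Token [a] carries the tail of [a] bracketed with the head of its predecessor. *)
Definition ev pr (z : tok) : F :=
  match z with inl x => monom M [:: x] | inr a => br (lt a) (lh (pr a)) end.
Definition V pr w := psi (slotprod w (ev pr)).

(** The tokens form closed cycles under [nx], with inverse [pr]. As no token is its own successor,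
    an arrow of a cycle has its head in another slot than its tail, so that 4T applies to the
    pair. *)
Record wheelstate pr nx w : Prop := WheelState {
  ws_uniq : uniq w;
  ws_nx : forall a, (inr a : tok) \in w -> [/\ (inr (nx a) : tok) \in w, nx a != a & pr (nx a) = a];
  ws_pr : forall a, (inr a : tok) \in w -> (inr (pr a) : tok) \in w /\ nx (pr a) = a;
  ws_plain : arrow_word (plain w);
  ws_disj : forall z, (inl z : tok) \in w -> (inr z.1 : tok) \notin w
}.

Lemma ws_perm pr nx w w' : perm_eq w w' -> wheelstate pr nx w -> wheelstate pr nx w'.
Proof.
move=> pw [h1 h2 h3 h4 h5]; have mw := perm_mem pw; split.
- by rewrite -(perm_uniq pw).
- by move=> a; rewrite -!mw; apply: h2.
- by move=> a; rewrite -!mw; apply: h3.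
- by rewrite -(arrow_word_perm (perm_plain pw)).
- by move=> z; rewrite -!mw; apply: h5.
Qed.

Lemma swap_diff pr u v x y : uniq (u ++ x :: v) ->
  V pr (u ++ [:: x; y] ++ v) - V pr (u ++ [:: y; x] ++ v) =
  psi (slotprod (u ++ x :: v) (upd (ev pr) x (br (ev pr x) (ev pr y)))).
Proof.
move=> /uniq_mid[xu xv]; rewrite /V -raddfB; congr (psi _).
rewrite /slotprod !big_cat !big_cons !big_nil /= !mulr1 upd_same.
rewrite -mulrBr -mulrBl; congr (_ * (_ * _)).
  by apply: eq_big_seq => z zu; rewrite upd_other //; apply: contraNneq xu => <-.
by apply: eq_big_seq => z zv; rewrite upd_other //; apply: contraNneq xv => <-.
Qed.

Lemma inr_neq (a b : nat) : a != b -> (inr a : tok) != inr b.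
Proof. by apply: contraNneq => -[->]. Qed.

(** The head of [j] stands in the token of [nx j], so [val_slot_tt] applies. *)
Lemma token_tail pr nx u v j g :
  wheelstate pr nx (u ++ [:: inr j; inl (tl g)] ++ v) ->
  V pr (u ++ [:: inr j; inl (tl g)] ++ v) = V pr (u ++ [:: inl (tl g); inr j] ++ v).
Proof.
move=> ws; set w := u ++ (inr j : tok) :: v.
have sw z : z \in (u ++ [:: inr j; inl (tl g)] ++ v) -> z != inl (tl g) -> z \in w.
  by move=> + zg; rewrite /w !(mem_cat, inE) (negbTE zg) orbF.
have uw : uniq w := uniq_del2 (ws_uniq ws).
have jw : (inr j : tok) \in w by rewrite mem_cat inE eqxx orbT.
have [] := ws_nx ws (a := j); first by rewrite !(mem_cat, inE) eqxx !orbT.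
move=> /sw/(_ isT) nw nj pj.
apply/eqP; rewrite -subr_eq0 swap_diff //; apply/eqP.
apply: (val_slot_tt (p := inr j) (q := inr (nx j)) uw (lctxN lctx_id)
  (lctx_brr (lt (nx j)) lctx_id) jw nw).
- by rewrite eq_sym inr_neq.
- by rewrite upd_same brN.
- by rewrite upd_other /= ?pj // inr_neq.
Qed.

(** In the bracket of the two tokens, 4T at the head of [l] removes the inner bracket of [l]. This
    leaves a tail bracketed with the token of [j], which [val_slot_tt] kills. The hypothesis keeps
    the head of [l] out of the slot of [j]. *)
Lemma token_token_aux pr nx u v j l :
  wheelstate pr nx (u ++ [:: inr j; inr l] ++ v) -> pr j != l ->
  V pr (u ++ [:: inr j; inr l] ++ v) = V pr (u ++ [:: inr l; inr j] ++ v).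
Proof.
move=> ws pjl.
have jl : j != l.
  have [_] := uniq_mid (ws_uniq ws); apply: contraNneq => ->.
  by rewrite inE eqxx.
set w := u ++ (inr j : tok) :: v.
have sw z : z \in (u ++ [:: inr j; inr l] ++ v) -> z != inr l -> z \in w.
  by move=> + zg; rewrite /w !(mem_cat, inE) (negbTE zg) orbF.
have uw : uniq w := uniq_del2 (ws_uniq ws).
have jw : (inr j : tok) \in w by rewrite mem_cat inE eqxx orbT.
have [] := ws_nx ws (a := j); first by rewrite !(mem_cat, inE) eqxx !orbT.
move=> njw nj pj.
have [] := ws_nx ws (a := l); first by rewrite !(mem_cat, inE) eqxx !orbT.
move=> /sw/(_ (inr_neq _)) nlw nl pl; have {}nlw := nlw nl.
have nlj : nx l != j by apply: contraNneq pjl => <-; rewrite pl.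
apply/eqP; rewrite -subr_eq0 swap_diff //; apply/eqP.
pose r1 := upd (upd (ev pr) (inr (nx l)) (br (lt (nx l)) (br (lh (pr l)) (lh l))))
  (inr j) (br (ev pr (inr j)) (lt l)).
have -> : psi (slotprod w (upd (ev pr) (inr j) (br (ev pr (inr j)) (ev pr (inr l))))) =
    psi (slotprod w r1).
  apply: (val_slot_4T (p := inr j) (q := inr (nx l)) uw (lctx_brr (ev pr (inr j)) lctx_id)
    (lctx_brr (lt (nx l)) lctx_id) jw nlw).
  - by rewrite eq_sym inr_neq.
  - by rewrite /r1; agr.
  - by rewrite upd_same.
  - by rewrite (upd_other _ _ (inr_neq nlj)) /= pl.
  - by rewrite /r1 upd_same.
  - by rewrite /r1 (upd_other _ _ (inr_neq nlj)) upd_same.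
(* The slot of [l] has been merged into that of [j]; if [l] follows [j], the head of [j] is now
   found in the commutator at [nx l]. *)
have [njl|njl] := eqVneq (nx j) l.
  apply: (val_slot_tt (p := inr j) (q := inr (nx l)) uw (lctxN lctx_id)
    (lctx_brr (lt (nx l)) (lctx_brl (lh l) lctx_id)) jw nlw).
  - by rewrite eq_sym inr_neq.
  - by rewrite /r1 upd_same brN.
  - by rewrite /r1 (upd_other _ _ (inr_neq nlj)) upd_same -njl pj.
have {}njw := sw _ njw (inr_neq njl).
apply: (val_slot_tt (p := inr j) (q := inr (nx j)) uw (lctxN lctx_id)
    (lctx_brr (lt (nx j)) lctx_id) jw njw).
- by rewrite eq_sym inr_neq.
- by rewrite /r1 upd_same brN.
- rewrite /r1 (upd_other _ _ (inr_neq nj)) upd_other /=; first by rewrite pj.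
  by apply: inr_neq; apply: contraNneq jl => njl'; rewrite -pj njl' pl.
Qed.

Lemma rename_ev s pr (z : tok) : rename M s (ev pr z) =
  match z with
  | inl x => monom M [:: (s x.1, x.2)]
  | inr a => br (lt (s a)) (lh (s (pr a)))
  end.
Proof.
case: z => [x|a] /=; first by rewrite -[monom M _]scale1r rename_monom scale1r.
by rewrite rename_br rename_lt rename_lh.
Qed.

Lemma V_rename s pr pr' (t : tok -> tok) w : injective s ->
  {in w, forall z, rename M s (ev pr z) = ev pr' (t z)} -> V pr w = V pr' (map t w).
Proof.
move=> s_inj H; rewrite /V -(value_rename M _ s_inj) rename_prod; congr (psi _).
by rewrite /slotprod big_map; apply: eq_big_seq.
Qed.

Lemma token_token pr nx u v j l :
  wheelstate pr nx (u ++ [:: inr j; inr l] ++ v) ->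
  V pr (u ++ [:: inr j; inr l] ++ v) = V pr (u ++ [:: inr l; inr j] ++ v).
Proof.
move=> ws; have [pjl|] := eqVneq (pr j) l; last exact: token_token_aux ws.
have [plj|plj] := eqVneq (pr l) j; last first.
  by symmetry; apply: token_token_aux plj; apply: ws_perm ws; perm_count.
have uw := ws_uniq ws; set w := u ++ _ in ws uw *.
have jw : (inr j : tok) \in w by rewrite !(mem_cat, inE) eqxx !orbT.
have lw : (inr l : tok) \in w by rewrite !(mem_cat, inE) eqxx !orbT.
have ju : (inr j : tok) \notin u ++ v /\ (inr l : tok) \notin u ++ v.
  have := uw; rewrite (perm_uniq (_ : perm_eq _ ([:: inr j; inr l] ++ u ++ v))); last by perm_count.
  by rewrite /= inE negb_or => /and3P[/andP[_ ->] ->].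
(* The remaining case is a cycle of two tokens that are neighbours on the line: exchanging the names
   [j] and [l] exchanges their places. *)
have -> : u ++ [:: inr l; inr j] ++ v =
    map (fun z : tok => if z is inr a then inr (swapn j l a) else z) w.
  rewrite /w !map_cat /= swapn_l swapn_r; congr (_ ++ _ :: _ :: _);
    rewrite map_id_in // => -[x //|a] az; rewrite swapn_id //;
    by apply: contraTneq az => ->; move: ju; rewrite !mem_cat => -[/norP[? ?] /norP[? ?]].
apply: (V_rename (@swapn_inj j l)) => -[x xw|a aw]; rewrite rename_ev.
  have := ws_disj ws xw; case: x {xw} => x b /= xw.
  by rewrite swapn_id //; apply: contraNneq xw => ->.
have [->|aj] := eqVneq a j; first by rewrite swapn_l /= pjl swapn_r plj.
have [->|al] := eqVneq a l; first by rewrite swapn_r /= plj swapn_l pjl.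
rewrite /= !swapn_id //; have [_ na] := ws_pr ws aw.
  by apply: contraNneq al => paj; rewrite -na paj -plj; have [_ ->] := ws_pr ws lw.
by apply: contraNneq aj => pal; rewrite -na pal -pjl; have [_ ->] := ws_pr ws jw.
Qed.

End Wheel.

Definition restrict (P : pred nat) (w : word nat) : word nat := [seq x <- w | P x.1].

Lemma arrow_word_restrict P (w : word nat) : arrow_word w -> arrow_word (restrict P w).
Proof.
case/andP=> uw /allP aw; rewrite /arrow_word filter_uniq //=; apply/allP => x.
by rewrite !mem_filter => /andP[-> /aw].
Qed.

Lemma mem_hd_tl (w : word nat) a : arrow_word w -> (hd a \in w) = (tl a \in w).
Proof. by case/andP=> _ /allP aw; apply/idP/idP => /aw. Qed.

Section Pullout.
Context (F : lalgType rat) (A : zmodType) (M : word_model F A).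
Notation psi := (value M).
Notation lt := (lt M).
Notation lh := (lh M).
Notation ev := (ev M).
Notation V := (V M).
Implicit Types (pr nx : nat -> nat) (w u v : seq tok) (j g l : nat).

(* The tail of [g] becomes a token when [g] is inserted in the cycle. *)
Definition retok g (z : tok) : tok := if z == inl (tl g) then inr g else z.

Definition ins_before pr j g := fun a => if a == j then g else if a == g then pr j else pr a.

Lemma plain_retok g w : plain (map (retok g) w) = [seq x <- plain w | x != tl g].
Proof.
elim: w => //= -[x|a] w IH //=; rewrite /retok.
rewrite (_ : (inl x == inl (tl g) :> tok) = (x == tl g)); last by [].
by case: eqP => //= _; rewrite IH.
Qed.

Lemma plain_insert u v j g : hd g \notin plain (u ++ v) ->
  plain (map (retok g) (u ++ (inr j : tok) :: v)) =
  restrict (predC1 g) (plain (u ++ [:: inr j; inl (hd g)] ++ v)).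
Proof.
rewrite plain_retok !plain_cat /= mem_cat /restrict !filter_cat /= eqxx /= => /norP[gu gv].
congr (_ ++ _); apply: eq_in_filter => -[a b] xs /=; rewrite /tl xpair_eqE.
  by case: b xs => xs; rewrite ?andbT // andbF; apply/esym; apply: contraNneq gu => <-.
by case: b xs => xs; rewrite ?andbT // andbF; apply/esym; apply: contraNneq gv => <-.
Qed.

Lemma ws_ins_before pr nx u v j g :
  wheelstate pr nx (u ++ [:: inr j; inl (hd g)] ++ v) ->
  wheelstate (ins_before pr j g)
    (fun a => if a == pr j then g else if a == g then j else nx a)
    (map (retok g) (u ++ (inr j : tok) :: v)).
Proof.
set w0 := u ++ [:: inr j; inl (hd g)] ++ v; set w := u ++ (inr j : tok) :: v => ws.
have w0E z : (z \in w0) = (z == inl (hd g)) || (z \in w).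
  by rewrite (perm_mem (_ : perm_eq w0 (inl (hd g) :: w))) ?inE //; perm_count.
have hw : (inl (hd g) : tok) \in w0 by rewrite w0E eqxx.
have gw : (inr g : tok) \notin w0 := ws_disj ws hw.
have uw0 : uniq ((inl (hd g) : tok) :: w).
  by rewrite -(perm_uniq (_ : perm_eq w0 _)) ?(ws_uniq ws) //; perm_count.
have tw : (inl (tl g) : tok) \in w.
  have : (inl (tl g) : tok) \in w0 by rewrite -mem_plain -mem_hd_tl ?mem_plain ?(ws_plain ws).
  by rewrite w0E => /orP[/eqP[]|].
have wE (a : nat) : ((inr a : tok) \in w0) = ((inr a : tok) \in w) by rewrite w0E.
have jw : (inr j : tok) \in w by rewrite mem_cat inE eqxx orbT.
have wN (a : nat) : (inr a : tok) \in w -> a != g.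
  by rewrite -wE; apply: contraTneq => ->.
have memr (a : nat) : ((inr a : tok) \in map (retok g) w) = (a == g) || ((inr a : tok) \in w).
  apply/mapP/orP => [[[x|b] bw]|[/eqP->|aw]].
  - by rewrite /retok; case: eqP => // _ [->]; rewrite eqxx; left.
  - by move=> [->]; right.
  - by exists (inl (tl g)); rewrite // /retok eqxx.
  - by exists (inr a).
have meml x : ((inl x : tok) \in map (retok g) w) -> (inl x : tok) \in w.
  by case/mapP=> -[y|b] bw //; rewrite /retok; case: eqP => // _ [->].
have [pjw npj] : (inr (pr j) : tok) \in w /\ nx (pr j) = j.
  by have := ws_pr ws (a := j); rewrite !wE; apply.
have hgp : hd g \notin plain (u ++ v).
  by move: uw0; rewrite mem_plain => /andP[+ _]; rewrite !mem_cat inE.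
have jg := wN _ jw; have pjg := wN _ pjw.
split.
- rewrite map_inj_in_uniq; first by case/andP: uw0.
  move=> x y xw yw; rewrite /retok; do 2!case: eqP => [->|?] //.
    by move=> E; move: gw; rewrite wE E yw.
  by move=> E; move: gw; rewrite wE -E xw.
- move=> a; rewrite !memr /ins_before.
  have [-> _|apj] := eqVneq a (pr j).
    by rewrite eqxx (eq_sym g j) (negbTE jg) eq_sym.
  have [-> _|ag /= aw] := eqVneq a g; first by rewrite jw orbT eqxx.
  have := ws_nx ws (a := a); rewrite !wE => /(_ aw)[nw na pa].
  rewrite nw orbT; split=> //; case: eqP => [naj|_]; first by rewrite -naj pa eqxx in apj.
  by rewrite (negbTE (wN _ nw)).
- move=> a; rewrite !memr /ins_before.
  have [-> _|aj] := eqVneq a j; first by rewrite eqxx (eq_sym g) (negbTE pjg).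
  have [-> _|ag /= aw] := eqVneq a g; first by rewrite pjw orbT eqxx.
  have := ws_pr ws (a := a); rewrite !wE => /(_ aw)[nw na].
  rewrite nw orbT (negbTE (wN _ nw)); split=> //; case: eqP => // pa.
  by move: aj; rewrite -na pa npj eqxx.
- by rewrite plain_insert // arrow_word_restrict // (ws_plain ws).
- move=> z zw; rewrite memr; apply/norP; split.
    by move: zw; rewrite -mem_plain plain_insert // mem_filter => /andP[].
  by have := ws_disj ws (z := z); rewrite wE; apply; rewrite w0E meml ?orbT.
Qed.

Lemma jacobi (t h x : F) : br (br t h) x = br t (br h x) - br h (br t x).
Proof.
have E (V : zmodType) (a b c d e f : V) :
    a - b - (c - d) = a - e - (f - d) - (b - f - (e - c)).
  rewrite !opprB [RHS]addrACA [a - e + _]addrA subrK [d - f + _]addrA subrK.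
  by rewrite [LHS]addrACA [RHS]addrACA [- b - c]addrC.
by rewrite /br !(mulrBl, mulrBr) !mulrA; apply: E.
Qed.

Lemma slotprod_retok pr r g w : (inr g : tok) \notin w ->
  (forall z, z \in w -> r z = ev pr (retok g z)) ->
  psi (slotprod w r) = V pr (map (retok g) w).
Proof.
move=> gw H; rewrite /V; congr (psi _).
by rewrite /slotprod big_map; apply: eq_big_seq.
Qed.

(** The Jacobi identity splits the bracket of a token with the head of [g] into a difference. 4T
    turns each term into a wheel with [g] inserted in the cycle, before [j] or after it. Up to
    renaming, the two wheels differ by exchanging the places of the tokens [g] and [j], which the
    hypothesis on the larger wheel allows. *)
Lemma token_head pr nx u v j g (w2 := map (retok g) (u ++ (inr j : tok) :: v)) :
  wheelstate pr nx (u ++ [:: inr j; inl (hd g)] ++ v) ->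
  (forall w', perm_eq w2 w' -> plain w2 = plain w' ->
    V (ins_before pr j g) w2 = V (ins_before pr j g) w') ->
  V pr (u ++ [:: inr j; inl (hd g)] ++ v) = V pr (u ++ [:: inl (hd g); inr j] ++ v).
Proof.
move=> ws IH; have ws2 := ws_ins_before ws.
set w := u ++ (inr j : tok) :: v in w2 IH ws2.
have uw : uniq w := uniq_del2 (ws_uniq ws).
have w0E z : (z \in u ++ [:: inr j; inl (hd g)] ++ v) = (z == inl (hd g)) || (z \in w).
  rewrite (perm_mem (_ : perm_eq _ ((inl (hd g) : tok) :: w))) ?inE //.
  by rewrite /w; perm_count.
have jw : (inr j : tok) \in w by rewrite mem_cat inE eqxx orbT.
have gw : (inr g : tok) \notin w.
  by have := ws_disj ws (z := hd g); rewrite !w0E eqxx => /(_ isT).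
have tw : (inl (tl g) : tok) \in w.
  have : (inl (tl g) : tok) \in u ++ [:: inr j; inl (hd g)] ++ v.
    by rewrite -mem_plain -mem_hd_tl ?(ws_plain ws) // mem_plain w0E eqxx.
  by rewrite w0E => /orP[/eqP[]|].
have wN (a : nat) : (inr a : tok) \in w -> a != g by apply: contraTneq => ->.
have [nw nj pn] : [/\ (inr (nx j) : tok) \in w, nx j != j & pr (nx j) = j].
  by have := ws_nx ws (a := j); rewrite !w0E; apply.
have jg := wN _ jw.
apply/eqP; rewrite -subr_eq0 swap_diff //; apply/eqP.
pose C := br (lt j) (lh (pr j)).
rewrite [br _ _](_ : _ = br (lt j) (br (lh (pr j)) (lh g)) - br (lh (pr j)) (br (lt j) (lh g)));
  last exact: jacobi.
pose rB := upd (upd (ev pr) (inr j) (br (lt j) (lh g))) (inl (tl g)) (br (lt g) (lh (pr j))).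
pose rA := upd (upd (ev pr) (inr (nx j)) (br (lt (nx j)) (lh g))) (inl (tl g)) (br (lt g) (lh j)).
pose r1 := upd (ev pr) (inr j) (br (lt j) (br (lh (pr j)) (lh g))).
pose r2 := upd (ev pr) (inr j) (br (lh (pr j)) (br (lt j) (lh g))).
rewrite (val_linB M uw (p := inr j) (r1 := r1) (r2 := r2) jw);
  [|by rewrite /r1; agr|by rewrite /r2; agr|by rewrite /r1 /r2 !upd_same].
have tj : (inl (tl g) : tok) != inr j by [].
have jt : (inr j : tok) != inl (tl g) by [].
have nt : (inr (nx j) : tok) != inl (tl g) by [].
have tn : (inl (tl g) : tok) != inr (nx j) by [].
(* 4T for [g], read backwards: [g] enters the cycle between [pr j] and [j]. *)
have E1 : psi (slotprod w r1) = psi (slotprod w rB).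
  symmetry; apply: (val_slot_4T (p := inl (tl g)) (q := inr j) uw lctx_id
    (lctx_brr (lt j) lctx_id) tw jw tj).
  - by rewrite /rB /r1; agr.
  - by rewrite /rB upd_same.
  - by rewrite /rB (upd_other _ _ jt) upd_same.
  - by rewrite /r1 (upd_other _ _ tj).
  - by rewrite /r1 upd_same.
pose r3 := upd (upd (ev pr) (inr (nx j)) (br (lt (nx j)) (br (lh g) (lh j))))
  (inr j) (br (lh (pr j)) (lt j)).
(* In the second term 4T for [j] carries the bracket to the head of [j], from where [E4] carries it
   to the tail of [g]: here [g] enters between [j] and [nx j]. *)
have E2 : psi (slotprod w r2) = psi (slotprod w r3).
  apply: (val_slot_4T (p := inr j) (q := inr (nx j)) uw (lctx_brr (lh (pr j)) lctx_id)
    (lctx_brr (lt (nx j)) lctx_id) jw nw).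
  - by rewrite eq_sym inr_neq.
  - by rewrite /r2 /r3; agr.
  - by rewrite /r2 upd_same.
  - by rewrite /r2 (upd_other _ _ (inr_neq nj)) /= pn.
  - by rewrite /r3 upd_same.
  - by rewrite /r3 (upd_other _ _ (inr_neq nj)) upd_same.
pose r4 := upd (ev pr) (inr (nx j)) (br (lt (nx j)) (br (lh j) (lh g))).
(* Two brackets are reversed, and the signs cancel. *)
have E3 : psi (slotprod w r3) = psi (slotprod w r4).
  pose r5 := upd r4 (inr j) (br (lh (pr j)) (lt j)).
  rewrite (val_linN M uw (r1 := r5) nw); last first.
  - rewrite /r3 /r5 /r4 !(upd_other _ _ (inr_neq nj)) !upd_same.
    by rewrite (brN (lh g)) brNr.
  - by rewrite /r3 /r5 /r4; agr.
  rewrite (val_linN M uw (r1 := r4) jw) ?opprK //; first by rewrite /r5; agr.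
  rewrite /r5 upd_same /r4 upd_other; first exact: brN.
  by rewrite inr_neq // eq_sym.
have E4 : psi (slotprod w r4) = psi (slotprod w rA).
  symmetry; apply: (val_slot_4T (p := inl (tl g)) (q := inr (nx j)) uw lctx_id
    (lctx_brr (lt (nx j)) lctx_id) tw nw tn).
  - by rewrite /rA /r4; agr.
  - by rewrite /rA upd_same.
  - by rewrite /rA (upd_other _ _ nt) upd_same.
  - by rewrite /r4 (upd_other _ _ tn).
  - by rewrite /r4 upd_same.
rewrite E1 E2 E3 E4.
pose prA a := if a == nx j then g else if a == g then j else pr a.
have VB : psi (slotprod w rB) = V (ins_before pr j g) w2.
  apply: slotprod_retok => // -[x|a] aw.
    rewrite /retok /rB; case: (eqVneq (inl x : tok) (inl (tl g))) => [->|xg].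
      by rewrite upd_same /= /ins_before eq_sym (negbTE jg) eqxx.
    by rewrite (upd_other _ _ xg) upd_other.
  rewrite /retok /rB upd_other // /ev /= /ins_before (negbTE (wN _ aw)).
  by case: (eqVneq a j) => [->|aj]; [rewrite upd_same | rewrite (upd_other _ _ (inr_neq aj))].
have VA : psi (slotprod w rA) = V prA w2.
  apply: slotprod_retok => // -[x|a] aw.
    rewrite /retok /rA; case: (eqVneq (inl x : tok) (inl (tl g))) => [->|xg].
      by rewrite upd_same /= /prA eq_sym (negbTE (wN _ nw)) eqxx.
    by rewrite (upd_other _ _ xg) upd_other.
  rewrite /retok /rA upd_other // /ev /= /prA (negbTE (wN _ aw)).
  case: (eqVneq a (nx j)) => [->|aj]; first by rewrite upd_same.
  by rewrite (upd_other _ _ (inr_neq aj)).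
rewrite VB VA; apply/eqP; rewrite subr_eq0; apply/eqP.
pose t (z : tok) : tok := if z is inr a then inr (swapn g j a) else z.
have tK : involutive t by case=> [x|a] //=; rewrite swapnK.
have gw2 : (inr g : tok) \in w2 by apply/mapP; exists (inl (tl g)); rewrite // /retok eqxx.
have jw2 : (inr j : tok) \in w2 by apply/mapP; exists (inr j).
have w2E (a : nat) : (inr a : tok) \in w2 -> a != g -> (inr a : tok) \in w.
  case/mapP=> -[x|b] bw; rewrite /retok; last by move=> [->].
  by case: eqP => // _ [->]; rewrite eqxx.
have plt : plain w2 = plain (map t w2) by elim: (w2) => //= -[x|a] l /= ->.
have pw2 : perm_eq w2 (map t w2).
  apply: uniq_perm; rewrite ?(map_inj_uniq (inv_inj tK)) ?(ws_uniq ws2) //.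
  move=> z; rewrite -{2}(tK z) (mem_map (inv_inj tK)); case: z => [x|a] //=.
  rewrite /swapn; case: (eqVneq a g) => [->|ag]; first by rewrite gw2 jw2.
  by case: (eqVneq a j) => [->|aj] //; rewrite gw2 jw2.
have -> : V prA w2 = V (ins_before pr j g) (map t w2); last exact: IH.
have [pjw npj] : (inr (pr j) : tok) \in w /\ nx (pr j) = j.
  by have := ws_pr ws (a := j); rewrite !w0E; apply.
apply: (V_rename (@swapn_inj g j)) => -[x xw|a aw]; rewrite rename_ev.
  have := ws_disj ws2 xw; case: x {xw} => x b xw.
  by rewrite swapn_id //=; apply: contraNneq xw => ->.
rewrite /t /ev; congr (br _ (lh _)); rewrite /prA /ins_before.
have [->|ag] := eqVneq a g.
  by rewrite (eq_sym g) (negbTE (wN _ nw)) swapn_r swapn_l eqxx.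
have {}aw := w2E _ aw ag; have [->|an] := eqVneq a (nx j).
  by rewrite swapn_l swapn_id ?(wN _ nw) // (negbTE nj) (negbTE (wN _ nw)) pn.
have [->|aj] := eqVneq a j.
  rewrite swapn_r (eq_sym g) (negbTE jg) eqxx swapn_id ?(wN _ pjw) //.
  by apply: contraNneq nj => pjj; rewrite -{1}pjj npj.
have [paw na] : (inr (pr a) : tok) \in w /\ nx (pr a) = a.
  by have := ws_pr ws (a := a); rewrite !w0E aw; apply.
rewrite (@swapn_id g j a) // (negbTE aj) (negbTE ag) swapn_id ?(wN _ paw) //.
by apply: contraNneq an => paj; rewrite -na paj.
Qed.

(** Crossing a head draws its arrow into the wheel, which leaves fewer plain letters; hence the
    induction on their number, with the wheel arbitrary. *)
Lemma wheel_pullout pr nx w w' : wheelstate pr nx w -> perm_eq w w' ->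
  plain w = plain w' -> V pr w = V pr w'.
Proof.
have [n] := ubnP (size (plain w)); elim: n => // n IH in pr nx w w' *.
move=> /ltnSE ws_n ws ww' pww'.
apply: (@reorder _ (V pr) w (ws_uniq ws) _ w w' [::]) => // u v.
have swapP j x : perm_eq (u ++ [:: inr j; x] ++ v) w ->
    V pr (u ++ [:: inr j; x] ++ v) = V pr (u ++ [:: x; inr j] ++ v).
  rewrite perm_sym => pw; have := ws_perm pw ws; case: x pw => [[g [|]]|l] pw wsu.
  - apply: (token_head wsu) => w1; apply: IH; last exact: ws_ins_before wsu.
    apply: leq_trans ws_n; rewrite plain_retok (perm_size (perm_plain pw)) size_filter.
    apply: (leq_ltn_trans (count_size _ _)).
    by rewrite !plain_cat /= !size_cat /= addnS.
  - exact: token_tail wsu.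
  - exact: token_token wsu.
move=> x y pxy /orP[]; first by case: x pxy => // j pxy _; apply: swapP.
case: y pxy => // j pxy _; symmetry; apply: swapP.
by apply: perm_trans pxy; perm_count.
Qed.

End Pullout.

(** * Moving the tail of an arrow to its head *)

Lemma next_at_indep (T : eqType) (x y y0 y1 : T) p :
  x != last y p -> next_at x y0 y p = next_at x y1 y p.
Proof. by elim: p y => [|z p IH] y /= xl; [rewrite (negbTE xl)|case: eqP => // _; apply: IH]. Qed.

Lemma next_cons (T : eqType) (l a y : T) p : a != l -> a != last y p ->
  next [:: l, y & p] a = next (y :: p) a.
Proof. by move=> al ay; rewrite /= (negbTE al) (next_at_indep l y ay). Qed.

Lemma next_head (T : eqType) (l y : T) p : next [:: l, y & p] l = y.
Proof. by rewrite /= eqxx. Qed.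

Lemma next_neq (T : eqType) (a : T) p : uniq p -> a \in p -> (1 < size p)%N -> next p a != a.
Proof.
move=> up ap sp; case/rot_to: ap => i p' pE.
rewrite -(next_rot i) // pE; case: p' pE => [|b p'] pE.
  by have := congr1 size pE; rewrite size_rot => E; rewrite E in sp.
rewrite next_head; have : uniq (rot i p) by rewrite rot_uniq.
by rewrite pE /= inE negb_or eq_sym => /and3P[/andP[]].
Qed.

Lemma next_last (T : eqType) (k : T) s : uniq (k :: s) -> next (k :: s) (last k s) = k.
Proof. by move=> us; rewrite next_nth mem_last index_last // nth_default. Qed.

Lemma next_inj (T : eqType) (p : seq T) : uniq p -> injective (next p).
Proof. by move=> up; apply: can_inj (prev_next up). Qed.

Section Moves.
Context (F : lalgType rat) (A : zmodType) (M : word_model F A).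
Notation psi := (value M).
Context (S : eqType).
Implicit Types (u v w : seq S) (r : S -> F).

Lemma mul_slotprod x u r : uniq u ->
  x * slotprod u r = slotprod u r * x + \sum_(z <- u) slotprod u (upd r z (br x (r z))).
Proof.
elim: u => [|y u IH]; first by rewrite /slotprod !big_nil mulr1 mul1r addr0.
case/andP=> yu uu; rewrite /slotprod !big_cons -!/(slotprod _ _) upd_same.
have -> : slotprod u (upd r y (br x (r y))) = slotprod u r.
  by apply: slotprod_ext => z zu; rewrite upd_other //; apply: contraNneq yu => <-.
have -> : \sum_(z <- u) \prod_(i <- y :: u) upd r z (br x (r z)) i =
    r y * \sum_(z <- u) slotprod u (upd r z (br x (r z))).
  rewrite mulr_sumr; apply: eq_big_seq => z zu; rewrite big_cons upd_other //.
  by apply: contraNneq yu => ->.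
rewrite -[_ * x]mulrA addrCA -mulrDr -IH // !mulrA -mulrDl.
by rewrite /br subrK.
Qed.

Lemma slot_insert x y w r : uniq w -> y \in w ->
  slotprod w (upd r y (r y * x)) = slotprod w r * x +
  \sum_(z <- w) slotprod w (upd r z (br x (r z))) *+ (index y w < index z w)%N.
Proof.
move=> uw /mem_split[u [v wE]]; have uw' : uniq (u ++ y :: v) by rewrite -wE.
have [yu yv] := uniq_mid uw'.
move: (uw'); rewrite cat_uniq => /and3P[_ ndis /andP[_ uv]].
have vN z : z \in v -> z \notin u /\ z != y.
  move=> zv; split; last by apply: contraNneq yv => <-.
  by apply: contraNN ndis => zu; apply/hasP; exists z; rewrite ?inE ?zv ?orbT.
have iy : index y w = size u by rewrite wE index_cat (negbTE yu) /= eqxx addn0.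
have split r' : slotprod w r' = slotprod u r' * r' y * slotprod v r'.
  by rewrite wE /slotprod big_cat big_cons /= mulrA.
have -> : \sum_(z <- w) slotprod w (upd r z (br x (r z))) *+ (index y w < index z w)%N =
    \sum_(z <- v) slotprod w (upd r z (br x (r z))).
  rewrite {1}wE big_cat big_cons /= ltnn mulr0n add0r big1_seq ?add0r => [|z /= zu].
    apply: eq_big_seq => z zv; rewrite iy wE index_cat /=.
    have [/negbTE -> zy] := vN z zv.
    by rewrite eq_sym (negbTE zy) addnS ltnS leq_addr.
  by rewrite iy wE index_cat zu ltnNge ltnW // index_mem.
rewrite !split upd_same.
have -> : slotprod u (upd r y (r y * x)) = slotprod u r.
  by apply: slotprod_ext => z zu; rewrite upd_other //; apply: contraNneq yu => <-.
have -> : slotprod v (upd r y (r y * x)) = slotprod v r.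
  by apply: slotprod_ext => z zu; rewrite upd_other //; apply: contraNneq yv => <-.
rewrite -!mulrA (mul_slotprod x r uv) !mulrDr; congr (_ + _).
rewrite !mulr_sumr; apply: eq_big_seq => z zv.
rewrite split; have [zu zy] := vN z zv; rewrite (upd_other _ _ (_ : y != z)) 1?eq_sym //.
rewrite mulrA; congr (_ * _ * _); apply: slotprod_ext => t tu; rewrite upd_other //.
by apply: contraNneq zu => <-.
Qed.

(** Both positions of [x] are compared with [x] at the end of the line, so the order of [p] and [q]
    does not matter; the difference of the indicators selects, with a sign, the slots between
    them. *)
Lemma slot_move x p q w r : uniq w -> p \in w -> q \in w -> r p = 1 ->
  slotprod w (upd r p x) = slotprod w (upd r q (r q * x)) +
  \sum_(z <- w) (slotprod w (upd r z (br x (r z))) *+ (index p w < index z w)%N -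
                 slotprod w (upd r z (br x (r z))) *+ (index q w < index z w)%N).
Proof.
move=> uw pw qw rp; rewrite sumrB addrA addrAC slot_insert // addrK.
by rewrite -slot_insert // rp mul1r.
Qed.

End Moves.

Section Chain.
Context (F : lalgType rat) (A : zmodType) (M : word_model F A).
Notation psi := (value M).
Notation lt := (lt M).
Notation lh := (lh M).
Context (w : word nat) (aw : arrow_word w).

Definition letter (z : nat * bool) : F := monom M [:: z].

(* The chain k :: .. :: b (first arrow last) stands for a partial comb: each head but the
   first is bracketed with the tail of the preceding arrow of the chain. *)
Definition rho (ys : seq nat) (z : nat * bool) : F :=
  if z.2 then if (z.1 \in ys) && (z.1 != last 0%N ys) then br (lt (next ys z.1)) (lh z.1)
              else lh z.1
  else if z.1 \in behead ys then 1 else lt z.1.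

(** The chain closed into a cycle: the head of the last entry of [ys] is bracketed as well, with the
    tail of the first entry, which [next] reaches by wrapping around. *)
Definition rhoc (ys : seq nat) (z : nat * bool) : F :=
  if z.2 then if z.1 \in ys then br (lt (next ys z.1)) (lh z.1) else lh z.1
  else if z.1 \in ys then 1 else lt z.1.

Lemma rho_hd ys a : rho ys (hd a) =
  if (a \in ys) && (a != last 0%N ys) then br (lt (next ys a)) (lh a) else lh a.
Proof. by []. Qed.

Lemma rhoc_hd ys a : rhoc ys (hd a) = if a \in ys then br (lt (next ys a)) (lh a) else lh a.
Proof. by []. Qed.

Definition comb ys := psi (slotprod w (rho ys)).
Definition wheelv ys := psi (slotprod w (rhoc ys)).

Definition nmx (k l : nat) : int :=
  (index (tl k) w < index (hd l) w)%N%:Z - (index (hd k) w < index (hd l) w)%N%:Z.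

Section Step.
Context (k : nat) (s : seq nat).
Notation ys := (k :: s).
Hypothesis uys : uniq ys.
Hypothesis ysw : forall a, a \in ys -> (hd a \in w).

Let rho0 := upd (rho ys) (tl k) 1.
Let T z := psi (slotprod w (upd rho0 z (br (lt k) (rho0 z)))).
Let uw : uniq w. Proof. by case/andP: aw. Qed.

Let br1 x : br x 1 = 0 :> F. Proof. by rewrite /br mulr1 mul1r subrr. Qed.

Let hdtl a b : (hd a == tl b :> nat * bool) = false. Proof. by rewrite xpair_eqE andbF. Qed.
Let hdhd a b : (hd a == hd b :> nat * bool) = (a == b). Proof. by rewrite xpair_eqE andbT. Qed.
Let tltl a b : (tl a == tl b :> nat * bool) = (a == b). Proof. by rewrite xpair_eqE andbT. Qed.

Lemma rho0_tl a : rho0 (tl a) = if a \in ys then 1 else lt a.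
Proof. by rewrite /rho0 /upd tltl /rho /= inE; case: eqP. Qed.

Lemma rho0_hd a : rho0 (hd a) =
  if (a \in ys) && (a != last k s) then br (lt (next ys a)) (lh a) else lh a.
Proof. by rewrite /rho0 /upd hdtl. Qed.

Lemma term_tl a : tl a \in w -> T (tl a) = 0.
Proof.
move=> aw'; rewrite /T rho0_tl; case: ifP => _.
  by apply: (val_slot0 M uw aw'); rewrite upd_same br1.
by apply: (val_slot_TC uw lctx_id aw'); rewrite upd_same.
Qed.

(** The head of [a] is already bracketed with the tail of the next arrow of the chain, whose own
    head lies in another slot: this is the situation of [val_slot_tt]. *)
Lemma term_hd_comb a : a \in ys -> a != last k s -> T (hd a) = 0.
Proof.
move=> ay al; have ny : next ys a \in ys by rewrite mem_next.
have sy : (1 < size ys)%N.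
  by move: ay al; rewrite inE; case: (s) => //=; rewrite orbF => ->.
have na := next_neq uys ay sy.
have [nl|nl] := altP (next ys a =P last k s).
  apply: (val_slot_tt (p := hd a) (q := hd (next ys a)) uw lctx_id lctx_id
    (ysw ay) (ysw ny)).
  - by rewrite hdhd eq_sym.
  - by rewrite upd_same rho0_hd ay al.
  - by rewrite upd_other ?hdhd // rho0_hd ny nl eqxx.
apply: (val_slot_tt (p := hd a) (q := hd (next ys a)) uw lctx_id
  (lctx_brr (lt (next ys (next ys a))) lctx_id) (ysw ay) (ysw ny)).
- by rewrite hdhd eq_sym.
- by rewrite upd_same rho0_hd ay al.
- by rewrite upd_other ?hdhd // rho0_hd ny nl.
Qed.

Lemma term_hd_new l : l \notin ys -> T (hd l) = comb (l :: ys).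
Proof.
move=> ly; congr (psi _); apply: slotprod_ext => -[a b] _.
have [E|zl] := eqVneq (a, b) (hd l).
  rewrite E upd_same rho0_hd (negbTE ly) /rho /= inE eqxx /=.
  by case: eqP ly => // ->; rewrite mem_last.
rewrite (upd_other _ _ zl); case: b zl => zl; last first.
  by rewrite -/(tl a) rho0_tl.
rewrite -/(hd a) rho0_hd rho_hd.
have al : a != l by move: zl; rewrite -/(hd a) hdhd.
rewrite (in_cons l) (negbTE al) orFb [last 0%N (l :: ys)]/=; case: ifP => // /andP[ay an].
by rewrite (next_cons al an).
Qed.

Lemma term_hd_last : (0 < size s)%N -> T (hd (last k s)) = wheelv ys.
Proof.
move=> s0; have ly : last k s \in ys by exact: mem_last.
congr (psi _); apply: slotprod_ext => -[a b] _.
have [E|zl] := eqVneq (a, b) (hd (last k s)).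
  rewrite E upd_same rho0_hd ly eqxx rhoc_hd ly.
  by rewrite next_last.
rewrite (upd_other _ _ zl); case: b zl => zl; last by rewrite -/(tl a) rho0_tl.
rewrite -/(hd a) rho0_hd rhoc_hd.
by move: zl; rewrite -/(hd a) hdhd => ->; rewrite andbT.
Qed.

Lemma term_hd_RI : s = [::] -> T (hd k) = 0.
Proof.
move=> s0; have kw : hd k \in w by apply: ysw; rewrite inE eqxx.
apply: (val_slot_RI uw lctx_id kw (a := k)).
by rewrite upd_same rho0_hd s0 /= inE eqxx.
Qed.

End Step.
End Chain.

Section ChainStep.
Context (F : lalgType rat) (A : zmodType) (M : word_model F A).
Notation psi := (value M).
Notation lt := (lt M).
Notation lh := (lh M).
Context (w : word nat) (aw : arrow_word w).

Lemma sum_heads (B : zmodType) (s : seq nat) (X : nat * bool -> B) :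
  uniq s -> (forall a, (hd a \in w) = (a \in s)) ->
  (forall a, tl a \in w -> X (tl a) = 0) ->
  \sum_(z <- w) X z = \sum_(a <- s) X (hd a).
Proof.
move=> us sw X0; have uw : uniq w by case/andP: aw.
rewrite (bigID (fun z => z.2)) /= [X in _ + X]big1_seq ?addr0; last first.
  by move=> [a []] //= zw; apply: X0.
rewrite -big_filter -(big_map hd predT X); apply: perm_big.
have hdI : injective (@hd nat) by move=> a b [].
apply: uniq_perm; rewrite ?filter_uniq ?(map_inj_uniq hdI) //.
move=> [a b]; rewrite mem_filter /=; case: b => /=.
  by rewrite -/(hd a) sw (mem_map hdI).
by apply/esym/mapP => -[c _ []].
Qed.

Lemma slotprod_letter (v : word nat) r : {in v, forall z, r z = letter M z} ->
  slotprod v r = monom M v.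
Proof.
rewrite /slotprod; elim: v => [|z v IH] H; first by rewrite big_nil monom_nil.
rewrite big_cons H ?inE ?eqxx // IH; first by rewrite /letter -monom_cat.
by move=> t tv; apply: H; rewrite inE tv orbT.
Qed.

Lemma comb1 k : comb M w [:: k] = psi (monom M w).
Proof.
congr (psi _); apply: slotprod_letter => -[a [|]] _ //=.
by rewrite /rho /= inE; case: eqP.
Qed.

Context (k : nat) (s : seq nat).
Notation ys := (k :: s).
Hypothesis uys : uniq ys.
Hypothesis ysw : forall a, a \in ys -> (hd a \in w).
Context (S : seq nat) (uS : uniq (ys ++ S)).
Hypothesis wS : forall a, (hd a \in w) = (a \in ys ++ S).
Let rho0 := upd (rho M ys) (tl k) 1.

(** The tail of [k] is moved until it stands just behind its own head. Brackets with tails vanish by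
    TC, so only heads remain in the sum. *)
Lemma comb_move : comb M w ys =
  psi (slotprod w (upd rho0 (hd k) (rho0 (hd k) * lt k))) +
  \sum_(a <- ys ++ S)
    psi (slotprod w (upd rho0 (hd a) (br (lt k) (rho0 (hd a))))) *~ nmx w k a.
Proof.
have uw : uniq w by case/andP: aw.
have ks : k \notin s by case/andP: uys.
have kw : hd k \in w by apply: ysw; rewrite inE eqxx.
have tw : tl k \in w by rewrite -mem_hd_tl.
have -> : comb M w ys = psi (slotprod w (upd rho0 (tl k) (lt k))).
  congr (psi _); apply: slotprod_ext => z _; rewrite /rho0 /upd.
  by case: eqP => // ->; rewrite /rho /= (negbTE ks).
rewrite (slot_move (lt k) uw tw kw (upd_same _ _ _)) raddfD raddf_sum; congr (_ + _).
rewrite -(sum_heads (X := fun z => psi (slotprod w (upd rho0 z (br (lt k) (rho0 z))))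
  *~ ((index (tl k) w < index z w)%N%:Z - (index (hd k) w < index z w)%N%:Z)) uS wS).
  by apply: eq_bigr => z _; rewrite raddfB !(raddfMn psi) mulrzBr.
by move=> a tw'; rewrite (term_tl M aw k s tw') mul0rz.
Qed.

Lemma comb_step : (0 < size s)%N ->
  comb M w ys = wheelv M w ys *~ nmx w k (last k s) +
    \sum_(l <- S) comb M w (l :: ys) *~ nmx w k l.
Proof.
case: (s) uys ysw uS wS @rho0 comb_move => // k' s' uys' ysw' uS' wS' r0 + _.
move: uS'; rewrite cat_uniq => /and3P[_ SD _] ->.
have kk' : k != k' by move: uys'; rewrite /= inE negb_or; case/andP => /andP[].
have uw : uniq w by case/andP: aw.
have kw : hd k \in w by apply: ysw'; rewrite inE eqxx.
have kw' : hd k' \in w by apply: ysw'; rewrite !inE eqxx orbT.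
have kl : k != last k' s'.
  by apply: contraTneq uys' => {1}->; rewrite /= mem_last.
(* The slot of the head of [k] now reads [br (lt k') (lh k) * lt k], with the head of [k']
   elsewhere: the situation of [val_slot_anti]. *)
rewrite [X in X + _](_ : _ = 0) ?add0r; last first.
  have r0E a : r0 (hd a) = if (a \in [:: k, k' & s']) && (a != last k' s')
      then br (lt (next [:: k, k' & s'] a)) (lh a) else lh a by exact: rho0_hd.
  have r0k : r0 (hd k) = br (lt k') (lh k) by rewrite r0E mem_head kl next_head.
  have k'y : k' \in [:: k, k' & s'] by rewrite !inE eqxx orbT.
  pose n := next [:: k, k' & s'] k'.
  have fixlt a : a != k' -> a != k -> rename M (swapn k' k) (lt a) = lt a.
    by move=> ak' ak; rewrite rename_lt swapn_id.
  have fixlh a : a != k' -> a != k -> rename M (swapn k' k) (lh a) = lh a.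
    by move=> ak' ak; rewrite rename_lh swapn_id.
  have nk' a : a != k -> next [:: k, k' & s'] a != k'.
    move=> ak; apply: contraNneq ak => nk; apply/eqP/(next_inj uys').
    by rewrite nk next_head.
  have nk a : a != last k' s' -> next [:: k, k' & s'] a != k.
    move=> ak; apply: contraNneq ak => nk; apply/eqP/(next_inj uys').
    by rewrite nk -[last k' s']/(last k (k' :: s')) next_last.
  have rz z : z \in w -> z != hd k -> z != hd k' ->
      rename M (swapn k' k) (upd r0 (hd k) (r0 (hd k) * lt k) z) =
      upd r0 (hd k) (r0 (hd k) * lt k) z.
    move=> zw zk zk'; rewrite (upd_other _ _ zk); case: z zw zk zk' => a [|] zw zk zk'.
      have ak : a != k by apply: contraNneq zk => ->.
      have ak' : a != k' by apply: contraNneq zk' => ->.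
      rewrite -/(hd a) r0E; case: ifP => [/andP[ay al]|_]; last exact: fixlh.
      by rewrite rename_br fixlh // fixlt ?nk ?nk'.
    rewrite -/(tl a) /r0 rho0_tl; case: ifP => [_|ay]; first exact: rename1.
    apply: fixlt; first by apply: contraFneq ay => ->.
    by apply: contraFneq ay => ->; exact: mem_head.
  (* The head of [k'] is bare if [k'] is the last entry of the chain, and bracketed with the tail of
     [n] otherwise. *)
  have [kl'|kl'] := eqVneq k' (last k' s').
    apply: (val_slot_anti (p := hd k) (q := hd k') uw lctx_id kw kw' _ rz) => //.
    - by apply: contraNneq kk' => -[->].
    - by rewrite upd_same r0k.
    - rewrite upd_other; last by apply: contraNneq kk' => -[->].
      by rewrite r0E -kl' eqxx andbF.
  apply: (val_slot_anti (p := hd k) (q := hd k') uw (lctx_brr (lt n) lctx_id) kw kw' _ rz).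
  - by apply: contraNneq kk' => -[->].
  - move=> y; rewrite rename_br fixlt ?nk //.
    by rewrite next_neq.
  - by rewrite upd_same r0k.
  - rewrite upd_other; last by apply: contraNneq kk' => -[->].
    by rewrite r0E kl' k'y.
rewrite big_cat; congr (_ + _).
  have ly : last k' s' \in [:: k, k' & s'] by rewrite inE mem_last orbT.
  rewrite (bigD1_seq _ ly uys') [last _ (_ :: _)]/=.
  rewrite (term_hd_last M w (k := k) (s := k' :: s')) // big1_seq => [|a /andP[al ay]].
    exact: addr0.
  by rewrite (term_hd_comb M aw uys' ysw' ay al) mul0rz.
apply: eq_big_seq => l lS; rewrite (term_hd_new M w (k := k) (s := k' :: s')) //.
by apply: contraNN SD => ly; apply/hasP; exists l.
Qed.

End ChainStep.

Section Pull.
Context (F : lalgType rat) (A : zmodType) (M : word_model F A).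
Notation psi := (value M).
Notation lt := (lt M).
Notation lh := (lh M).
Notation mono := (monom M).

(** The commutator unfolds into the two sides of 4T for [k], with nothing between its head and its
    tail. *)
Lemma isolated_comm_hd X Y k g :
  psi (X * br (lh g) (lh k * lt k) * Y) = 0.
Proof.
have E : br (lh g) (lh k * lt k) = br (lh g) (lh k) * lt k - lh k * br (lt k) (lh g).
  by rewrite /br !(mulrBl, mulrBr) !mulrA opprB addrA subrK.
rewrite E mulrBr mulrBl raddfB; apply/eqP; rewrite subr_eq0; apply/eqP.
by have := val_4T_rl M X 1 Y k g; rewrite !mulr1 !mulrA.
Qed.

(** Crossing the tail of [k] is free by TC, and crossing its head is free by [val_slot_anti]. The
    latter uses the head of [g] elsewhere on the line, so the context is a whole arrow word instead
    of arbitrary factors. *)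
Lemma isolated_comm_tl u v k g : arrow_word (u ++ tl g :: v) ->
  k \notin [seq x.1 | x <- u ++ tl g :: v] ->
  psi (mono u * br (lt g) (lh k * lt k) * mono v) = 0.
Proof.
set w := u ++ tl g :: v => aw kw; have uw : uniq w by case/andP: aw.
have gw : tl g \in w by rewrite mem_cat inE eqxx orbT.
have gw' : hd g \in w by rewrite mem_hd_tl.
have E : br (lt g) (lh k * lt k) = br (lt g) (lh k) * lt k + lh k * br (lt g) (lt k).
  by rewrite /br !(mulrBl, mulrBr) !mulrA addrA subrK.
rewrite E mulrDr mulrDl raddfD [_ * (lh k * _)]mulrA val_TC addr0.
pose r := upd (letter M) (tl g) (br (lt g) (lh k) * lt k).
have -> : mono u * (br (lt g) (lh k) * lt k) * mono v = slotprod w r.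
  have [gu gv] := uniq_mid uw.
  have rg : r (tl g) = br (lt g) (lh k) * lt k by rewrite /r upd_same.
  rewrite /slotprod big_cat big_cons /= rg [RHS]mulrA -!/(slotprod _ _).
  congr (_ * _ * _); apply/esym; apply: slotprod_letter => z zu; rewrite /r upd_other //.
    by apply: contraNneq gu => <-.
  by apply: contraNneq gv => <-.
have gk : g != k by apply: contraNneq kw => <-; apply/mapP; exists (tl g).
apply: (val_slot_anti (p := tl g) (q := hd g) (j := g) (k := k) uw lctx_id gw gw').
- by apply/eqP => -[].
- move=> [a b] zw zg zg'; rewrite /r (upd_other _ _ zg) /letter.
  rewrite -[mono _]scale1r rename_monom /= swapn_id ?scale1r //.
    by case: b {zw} zg zg' => zg zg'; [apply: contraNneq zg'|apply: contraNneq zg] => ->.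
  by apply: contraNneq kw => <-; apply/mapP; exists (a, b).
- by [].
- by rewrite /r upd_same.
- by rewrite /r upd_other //; apply/eqP => -[].
Qed.

Lemma isolated_front u v k : arrow_word (u ++ v) -> k \notin [seq x.1 | x <- u ++ v] ->
  psi (mono u * (lh k * lt k) * mono v) = psi (lh k * lt k * mono (u ++ v)).
Proof.
elim/last_ind: u v => [|u z IH] v; first by rewrite monom_nil mul1r.
rewrite cat_rcons => aw kw; rewrite -IH // (monom_cat M [:: z] v) -cats1 monom_cat.
apply/eqP; rewrite -subr_eq0 -raddfB !mulrA.
have -> : mono u * mono [:: z] * lh k * lt k * mono v -
    mono u * lh k * lt k * mono [:: z] * mono v = mono u * br (mono [:: z]) (lh k * lt k) * mono v.
  by rewrite /br mulrBr mulrBl !mulrA.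
case: z aw kw => g [|] aw kw; apply/eqP; first exact: isolated_comm_hd.
exact: isolated_comm_tl.
Qed.

Lemma slotprod_restrict P (u : word nat) r :
  {in u, forall z, r z = if P z.1 then letter M z else 1} ->
  slotprod u r = mono (restrict P u).
Proof.
rewrite /slotprod; elim: u => [|z u IH] H; first by rewrite big_nil monom_nil.
rewrite big_cons H ?inE ?eqxx // IH /=; last first.
  by move=> t tu; apply: H; rewrite inE tu orbT.
by case: ifP => _; rewrite ?mul1r // /letter -monom_cat.
Qed.

Section First.
Context (w : word nat) (aw : arrow_word w) (k : nat) (S : seq nat).
Hypotheses (uS : uniq (k :: S)) (wS : forall a, (hd a \in w) = (a \in k :: S)).

(** Unlike in [comb_step], the tail arrives behind a bare head: the arrow [k] becomes isolated and
    can be taken to the front of the line. *)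
Lemma comb_first :
  comb M w [:: k] = psi (lh k * lt k * mono (restrict (predC1 k) w)) +
    \sum_(l <- S) comb M w [:: l; k] *~ nmx w k l.
Proof.
have uw : uniq w by case/andP: aw.
have ysw a : a \in [:: k] -> hd a \in w by rewrite wS !inE => ->.
rewrite (comb_move M aw (k := k) (s := [::]) isT ysw uS wS).
rewrite cat1s big_cons (term_hd_RI M aw ysw) // mul0rz add0r; congr (_ + _); last first.
  apply: eq_big_seq => l lS; rewrite (term_hd_new M w (k := k) (s := [::])) //.
  by rewrite inE; apply: contraTneq lS => ->; case/andP: uS.
rewrite rho0_hd inE eqxx /=; set r := upd _ (hd k) _.
have rE z : z != hd k -> r z = if predC1 k z.1 then letter M z else 1.
  move=> zk; rewrite /r (upd_other _ _ zk) /upd; case: z zk => a [|] zk.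
    have ak : a != k by apply: contraNneq zk => ->.
    by rewrite xpair_eqE andbF /rho /= inE (negbTE ak).
  by rewrite /= xpair_eqE andbT; case: eqP.
have [u [v wE]] : exists u v, w = u ++ hd k :: v by apply/mem_split/ysw; rewrite inE.
have [ku kv] : hd k \notin u /\ hd k \notin v by apply: uniq_mid; rewrite -wE.
have -> : slotprod w r = mono (restrict (predC1 k) u) * (lh k * lt k) *
    mono (restrict (predC1 k) v).
  rewrite wE /slotprod big_cat big_cons /= {2}/r upd_same mulrA -!/(slotprod _ _).
  rewrite !(slotprod_restrict (P := predC1 k)) // => z zu; apply: rE.
    by apply: contraNneq kv => <-.
  by apply: contraNneq ku => <-.
have E : restrict (predC1 k) w = restrict (predC1 k) u ++ restrict (predC1 k) v.
  by rewrite wE /restrict filter_cat /= eqxx.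
rewrite E; apply: isolated_front; first by rewrite -E; apply: arrow_word_restrict.
by rewrite -E; apply/mapP => -[z]; rewrite mem_filter /= => /andP[/eqP zk _ kz]; apply: zk.
Qed.

End First.

End Pull.

Lemma plain_inr s : plain [seq inr a | a <- s] = [::].
Proof. by elim: s. Qed.

Lemma plain_inl s : plain [seq inl z | z <- s] = s.
Proof. by elim: s => //= z s ->. Qed.

Section Closed.
Context (F : lalgType rat) (A : zmodType) (M : word_model F A).
Notation psi := (value M).
Notation lt := (lt M).
Notation lh := (lh M).
Notation mono := (monom M).
Context (w : word nat) (aw : arrow_word w) (ys : seq nat) (uys : uniq ys).
Hypothesis sys : (1 < size ys)%N.
Hypothesis ysw : forall a, a \in ys -> hd a \in w.

(** The slot at the head of [a] also holds the tail of [next ys a], and a token is named after its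
    tail; the tails of the cycle have left their own places. *)
Definition wtok (z : nat * bool) : seq tok :=
  if z.1 \in ys then if z.2 then [:: inr (next ys z.1)] else [::] else [:: inl z].
Let wt := flatten [seq wtok z | z <- w].

Let back (t : tok) : nat * bool := match t with inl z => z | inr a => hd (prev ys a) end.

Lemma map_back (u : word nat) :
  map back (flatten [seq wtok z | z <- u]) = [seq z <- u | z.2 || (z.1 \notin ys)].
Proof.
elim: u => //= -[a b] u IH; rewrite map_cat IH /wtok /=.
by case: (boolP (a \in ys)) => ay; case: b => //=; rewrite /hd prev_next.
Qed.

Lemma mem_wtok_inr a : ((inr a : tok) \in wt) = (a \in ys).
Proof.
apply/flatten_mapP/idP => [[[b c] bw]|ay].
  rewrite /wtok /=; case: ifP => by'; last by rewrite inE.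
  by case: c bw => // bw; rewrite inE => /eqP[->]; rewrite mem_next.
exists (hd (prev ys a)); first by apply: ysw; rewrite mem_prev.
by rewrite /wtok /= mem_prev ay next_prev // inE.
Qed.

Lemma mem_wtok_inl z : ((inl z : tok) \in wt) = (z \in w) && (z.1 \notin ys).
Proof.
apply/flatten_mapP/andP => [[[b c] bw]|[zw zy]].
  rewrite /wtok /=; case: ifP => by'; last by rewrite inE => /eqP[->] /=; rewrite by'.
  by case: c bw.
by exists z; rewrite // /wtok (negbTE zy) inE.
Qed.

Lemma plain_wtok (u : word nat) :
  plain (flatten [seq wtok z | z <- u]) = restrict (fun a => a \notin ys) u.
Proof.
elim: u => //= -[a b] u IH; rewrite plain_cat IH /wtok /=.
by case: ifP => //=; case: b.
Qed.

Lemma wheelv_pullout : wheelv M w ys =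
  psi (\prod_(a <- ys) br (lt a) (lh (prev ys a)) * mono (restrict (fun a => a \notin ys) w)).
Proof.
have uw : uniq w by case/andP: aw.
have uwt : uniq wt by apply: (@map_uniq _ _ back); rewrite map_back filter_uniq.
have -> : wheelv M w ys = V M (prev ys) wt.
  congr (psi _); rewrite /slotprod /wt big_flatten big_map; apply: eq_bigr => -[a b] _.
  rewrite /rhoc /wtok /=; case: (boolP (a \in ys)) => ay; case: b; rewrite ?big_seq1 ?big_nil //.
  by rewrite /= prev_next.
have ws : wheelstate (prev ys) (next ys) wt.
  split=> //.
  - move=> a; rewrite !mem_wtok_inr mem_next => ay.
    by rewrite ay prev_next // next_neq.
  - by move=> a; rewrite !mem_wtok_inr mem_prev next_prev.
  - by rewrite plain_wtok; apply: arrow_word_restrict.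
  - by move=> z; rewrite mem_wtok_inl mem_wtok_inr => /andP[].
have in1 : injective (inr : nat -> tok) by move=> a b [].
have in2 : injective (inl : nat * bool -> tok) by move=> a b [].
rewrite (wheel_pullout M (w' := map inr ys ++ map inl (plain wt)) ws).
- rewrite /V /slotprod big_cat !big_map plain_wtok; congr (psi (_ * _)).
  exact: slotprod_letter.
- apply: uniq_perm => //.
    rewrite cat_uniq !map_inj_uniq // uys plain_wtok filter_uniq // andbT.
    by apply/hasPn => _ /mapP[z _ ->]; apply/mapP => -[].
  move=> [z|a]; rewrite mem_cat.
    rewrite (mem_map in2) mem_plain orbC; case: (_ \in wt) => //=.
    by apply/esym/mapP => -[].
  rewrite (mem_map in1) mem_wtok_inr; case: (a \in ys) => //=.
  by apply/esym/mapP => -[].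
- by rewrite plain_cat plain_inr plain_inl.
Qed.

End Closed.

(** * Comparison with the wheels defined by STU *)

Section Official.
Context (F : lalgType rat) (A : zmodType) (M : word_model F A).
Notation psi := (value M).
Notation lt := (lt M).
Notation lh := (lh M).

Lemma pair_4T G1 G2 a b : lctx G1 -> lctx G2 ->
  psi (G2 (lh a) * G1 (br (lt a) (lh b))) = psi (G2 (br (lh b) (lh a)) * G1 (lt a)) /\
  psi (G1 (br (lt a) (lh b)) * G2 (lh a)) = psi (G1 (lt a) * G2 (br (lh b) (lh a))).
Proof.
move=> G1c G2c; pose w := [:: false; true]; have uw : uniq w by [].
have E (r : bool -> F) : slotprod w r = r false * r true.
  by rewrite /slotprod !big_cons big_nil mulr1.
split.
  pose r x y (z : bool) : F := if z then x else y.
  rewrite -[X in psi X = _](E (r (G1 (br (lt a) (lh b))) (G2 (lh a)))).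
  rewrite -[X in _ = psi X](E (r (G1 (lt a)) (G2 (br (lh b) (lh a))))).
  by apply: (val_slot_4T (p := true) (q := false) uw G1c G2c) => // -[].
pose r x y (z : bool) : F := if z then x else y.
rewrite -[X in psi X = _](E (r (G2 (lh a)) (G1 (br (lt a) (lh b))))).
rewrite -[X in _ = psi X](E (r (G2 (br (lh b) (lh a))) (G1 (lt a)))).
by apply: (val_slot_4T (p := false) (q := true) uw G1c G2c) => // -[].
Qed.

(** The nested brackets that STU_2 produces along an opened cycle; the last element of [p] is
    innermost. *)
Definition nu p (z : F) := foldr (fun x acc => br acc (lh x)) z p.
Definition ad p (z : F) := foldl (fun acc x => br (lh x) acc) z p.

Lemma lctx_nu p : lctx (nu p).
Proof.
elim: p => [|x p IH]; first exact: lctx_id.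
exact: (lctx_brl (lh x) IH).
Qed.

Lemma lctx_ad p : lctx (ad p).
Proof.
elim: p => [|x p IH]; first exact: lctx_id.
exact: (lctx_comp IH (lctx_brr (lh x) lctx_id)).
Qed.

(** Each use of 4T for the arrow [K] moves one bracket from its tail to its head, innermost first,
    which reverses the nesting. *)
Lemma nu_ad K p G X Y : lctx G ->
  psi (X * br (G (lh K)) (nu p (lt K)) * Y) = psi (X * br (G (ad p (lh K))) (lt K) * Y).
Proof.
elim/last_ind: p G => // p x IH G Gc.
rewrite /nu /ad foldr_rcons foldl_rcons -/(nu _ _) -/(ad _ _).
have -> : psi (X * br (G (lh K)) (nu p (br (lt K) (lh x))) * Y) =
    psi (X * br (G (br (lh x) (lh K))) (nu p (lt K)) * Y).
  rewrite /br -!/(br (lt K) _) -!/(br (lh x) _) !mulrBr !mulrBl !raddfB; congr (_ - _).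
    rewrite !mulrA -!(mulrA (X * _)).
    have [+ _] := pair_4T K x (lctx_mulr Y (lctx_nu p)) (lctx_mull X Gc).
    exact.
  rewrite !mulrA -!(mulrA (X * _)).
  have [_ +] := pair_4T K x (lctx_mull X (lctx_nu p)) (lctx_mulr Y Gc).
  exact.
by rewrite (IH (fun y => G (br (lh x) y)) (lctx_comp Gc (lctx_brr (lh x) lctx_id))).
Qed.

Definition tokens c p : F := \prod_(b <- pairmap (fun c x => br (lt x) (lh c)) c p) b.

(** The innermost bracket of two heads is undone by 4T for the arrow [x] whose tail waits on the
    right, and leaves a token there; each such step reverses one bracket and so costs a sign. *)
Lemma ad_tokens K c p X Y :
  psi (br (ad p (lh c)) (lt K) * X * (\prod_(x <- p) lt x * Y)) =
  psi (br (lh (last c p)) (lt K) * X * (tokens c p * Y)) *~ (-1) ^+ size p.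
Proof.
elim: p c X => [|x p IH] c X; first by rewrite /tokens /= !big_nil.
rewrite /tokens /= !big_cons -/(tokens x p) -/(ad p _) exprS mulN1r mulrNz.
have brNl (y z : F) : br (- y) z = - br y z by rewrite brN brNr opprK [in RHS]brN opprK.
rewrite (brN (lh x)) (lctxE_N _ (lctx_ad p)) brNl !mulNr raddfN; congr (- _).
have adc := lctx_mulr X (lctx_brl (lt K) (lctx_ad p)).
have [H _] := pair_4T x c (lctx_mulr (\prod_(z <- p) lt z * Y) lctx_id) adc.
have E := IH x (X * br (lt x) (lh c)).
by rewrite !mulrA in H E *; rewrite -H E.
Qed.

Definition off K p : F := br (lh K) (nu p (lt K)) * \prod_(x <- p) lt x.

Lemma prod_prev K p : uniq (K :: p) ->
  \prod_(a <- K :: p) br (lt a) (lh (prev (K :: p) a)) =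
  br (lt K) (lh (last K p)) * tokens K p.
Proof.
move=> up; have /andP[Kp up'] := up; rewrite big_cons prev_nth mem_head.
rewrite (memNindex Kp) -last_nth; congr (_ * _).
rewrite /tokens (big_nth K) (big_nth (1 : F)) size_pairmap !big_mkord; apply: eq_bigr => i _.
rewrite (nth_pairmap K) // prev_nth inE mem_nth ?orbT //.
by rewrite index_uniq.
Qed.

(** One sign for each spoke: [size p] of them come from [ad_tokens], the last one from the
    orientation of the bracket at [K]. *)
Lemma tokens_off K p Y : uniq (K :: p) ->
  psi (\prod_(a <- K :: p) br (lt a) (lh (prev (K :: p) a)) * Y) =
  psi (off K p * Y) *~ (-1) ^+ (size p).+1.
Proof.
move=> up; rewrite prod_prev // /off.
have := nu_ad K p 1 (\prod_(x <- p) lt x * Y) lctx_id; rewrite !mul1r -!mulrA => ->.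
have := ad_tokens K K p 1 Y; rewrite !mulr1 => ->.
rewrite -mulrzA -exprD addnS exprS mulN1r mulrNz -signr_odd oddD addbb expr0 mulr1z.
by rewrite (brN (lt K)) mulNr raddfN.
Qed.

End Official.

(** * Sums over selections from a list *)

Section ListSums.
Context (T : Type) (A : zmodType).
Implicit Types (s h : seq T) (x y : T).

Fixpoint pick_sum s (G : T -> seq T -> A) : A :=
  if s is x :: s' then G x s' + pick_sum s' (fun y r => G y (x :: r)) else 0.

Fixpoint split_sum s (G : seq T -> seq T -> A) : A :=
  if s is x :: s' then split_sum s' (fun h h' => G (x :: h) h') + split_sum s' (fun h h' => G h (x :: h'))
  else G [::] [::].

Lemma eq_split_sum s G G' : (forall h h', G h h' = G' h h') -> split_sum s G = split_sum s G'.
Proof.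
elim: s G G' => [|x s IH] G G' GG' //=.
by congr (_ + _); apply: IH => h h'; apply: GG'.
Qed.

Lemma pick_sumD s G G' : pick_sum s (fun x r => G x r + G' x r) = pick_sum s G + pick_sum s G'.
Proof.
elim: s G G' => [|x s IH] G G' /=; first by rewrite addr0.
by rewrite (IH (fun y r => G y (x :: r))) addrACA.
Qed.

Lemma split_sumD s G G' : split_sum s (fun h h' => G h h' + G' h h') = split_sum s G + split_sum s G'.
Proof.
elim: s G G' => [|x s IH] G G' //=.
by rewrite (IH (fun h h' => G (x :: h) h')) (IH (fun h h' => G h (x :: h'))) addrACA.
Qed.

Lemma split_sum_nil s (X : seq T -> A) : split_sum s (fun h h' => if h is [::] then X h' else 0) = X s.
Proof.
elim: s X => //= x s IH X; rewrite (IH (fun h => X (x :: h))).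
rewrite [X in X + _](_ : _ = 0) ?add0r //; elim: s {IH X} => //= y s IH.
by rewrite IH addr0.
Qed.

Lemma pick_sum_split_sum s (G : T -> seq T -> seq T -> A) :
  pick_sum s (fun x r => split_sum r (G x)) = split_sum s (fun h h' => pick_sum h (fun x r => G x r h')).
Proof.
elim: s G => //= x s IH G; rewrite split_sumD pick_sumD -addrA; congr (_ + _).
by rewrite (IH (fun y h h' => G y (x :: h) h')) (IH (fun y h h' => G y h (x :: h'))).
Qed.

Lemma pick_sum_sum s (f : T -> A) : pick_sum s (fun x _ => f x) = \sum_(x <- s) f x.
Proof. by elim: s => [|x s IH] /=; rewrite ?big_nil // big_cons IH. Qed.

End ListSums.

Section EqListSums.
Context (T : eqType) (A : zmodType).
Implicit Types (s h : seq T) (x y : T).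

Lemma eq_pick_sum s (G G' : T -> seq T -> A) :
  (forall x r, perm_eq (x :: r) s -> G x r = G' x r) -> pick_sum s G = pick_sum s G'.
Proof.
elim: s G G' => //= x s IH G G' GG'; rewrite GG' //; congr (_ + _).
apply: IH => y r yr; apply: GG'.
by rewrite -(cat1s y) -(cat1s x r) (perm_catCA [:: y] [:: x]) /= perm_cons.
Qed.

Lemma eq_split_sum_perm s (G G' : seq T -> seq T -> A) :
  (forall h h', perm_eq (h ++ h') s -> G h h' = G' h h') -> split_sum s G = split_sum s G'.
Proof.
elim: s G G' => [|x s IH] G G' GG' /=; first exact: GG'.
congr (_ + _); apply: IH => h h' hh'; apply: GG'; first by rewrite /= perm_cons.
by rewrite -cat1s perm_catCA /= perm_cons.
Qed.

End EqListSums.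

Section Cycles.
Context (T : Type) (N : T -> T -> int) (b : T).

(** With [n] equal to [size h], the sum over the paths from [k] to [b] through all of [h] of the
    products of entries of [N]; the length makes the recursion structural. *)
Fixpoint pathsum n (k : T) (h : seq T) : int :=
  if n is n'.+1 then pick_sum h (fun l r => N k l * pathsum n' l r) else N k b.

(** The weighted count of cycles through [b] and all of [h]. An empty [h] gives 0, not [N b b]: a
    cycle has at least two elements. *)
Definition cyclesum (h : seq T) : int := pick_sum h (fun l r => N b l * pathsum (size r) l r).

End Cycles.

Lemma mulrz_pick_sum (T : Type) (A : zmodType) (x : A) (s : seq T) (G : T -> seq T -> int) :
  x *~ pick_sum s G = pick_sum s (fun y r => x *~ G y r).
Proof. by elim: s G => [|y s IH] G /=; rewrite ?mulr0z // mulrzDr IH. Qed.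

Lemma split_sum_mulrz (T : Type) (A : zmodType) (n : int) (s : seq T) (G : seq T -> seq T -> A) :
  split_sum s G *~ n = split_sum s (fun y r => G y r *~ n).
Proof. by elim: s G => [|y s IH] G //=; rewrite mulrzDl !IH. Qed.

Section Unroll.
Context (T : eqType) (A : zmodType) (N : T -> T -> int) (b : T).
Context (labels : seq T) (C : seq T -> A) (W : nat -> seq T -> A).
Hypothesis Cstep : forall k s S, (0 < size s)%N -> last k s = b ->
  perm_eq ((k :: s) ++ S) labels ->
  C (k :: s) = W (size s).+1 S *~ N k b + \sum_(l <- S) C [:: l, k & s] *~ N k l.

(** Each use of [Cstep] closes the chain or lengthens it by one arrow of [S]. Carrying this to the
    end traces a path back to [b], and [h'] collects the arrows that it misses. *)
Lemma unroll k s S : (0 < size s)%N -> last k s = b -> perm_eq ((k :: s) ++ S) labels ->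
  C (k :: s) =
  split_sum S (fun h h' => W ((size s).+1 + size h) h' *~ pathsum N b (size h) k h).
Proof.
have [n] := ubnP (size S); elim: n => // n IH in k s S *.
move=> /ltnSE Sn s0 sb pS; rewrite (Cstep s0 sb pS) -pick_sum_sum.
rewrite [pick_sum _ _](_ : _ = pick_sum S (fun l r => split_sum r (fun h h' =>
    W ((size s).+2 + size h) h' *~ pathsum N b (size h) l h *~ N k l))); last first.
  apply: eq_pick_sum => l r lr; rewrite (IH l (k :: s) r) ?split_sum_mulrz //.
    by have := perm_size lr => /= rS; rewrite rS.
  apply: perm_trans pS.
  by rewrite (perm_trans _ (_ : perm_eq ((k :: s) ++ l :: r) _)) ?perm_cat2l //; perm_count.
rewrite pick_sum_split_sum -[W _ S *~ _](split_sum_nil S (fun h => W (size s).+1 h *~ N k b)) -split_sumD.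
apply: eq_split_sum_perm => -[|x h] h' hh'; first by rewrite /= addr0 addn0.
rewrite add0r (_ : pathsum N b _ k _ = pick_sum (x :: h) (fun l r => N k l * pathsum N b (size h) l r)) //.
rewrite mulrz_pick_sum.
apply: eq_pick_sum => l r /perm_size /= [rh].
by rewrite rh addSnnS mulrC mulrzA.
Qed.

End Unroll.

Lemma pick_sum_map (S T : Type) (A : zmodType) (f : S -> T) (s : seq S) (G : T -> seq T -> A) :
  pick_sum (map f s) G = pick_sum s (fun x r => G (f x) (map f r)).
Proof. by elim: s G => //= x s IH G; rewrite IH. Qed.

Lemma split_sum_map (S T : Type) (A : zmodType) (f : S -> T) (s : seq S)
    (G : seq T -> seq T -> A) :
  split_sum (map f s) G = split_sum s (fun h h' => G (map f h) (map f h')).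
Proof. by elim: s G => //= x s IH G; rewrite !IH. Qed.

Lemma eq_split_sum_sub (T : eqType) (A : zmodType) (s : seq T) (G G' : seq T -> seq T -> A) :
  (forall h h', perm_eq (h ++ h') s -> subseq h s -> subseq h' s -> G h h' = G' h h') ->
  split_sum s G = split_sum s G'.
Proof.
elim: s G G' => [|x s IH] G G' GG' /=; first exact: GG'.
congr (_ + _); apply: IH => h h' hh' hs hs'; apply: GG'.
- by rewrite /= perm_cons.
- by rewrite /= eqxx.
- exact: subseq_trans hs' (subseq_cons _ _).
- by rewrite -cat1s perm_catCA /= perm_cons.
- exact: subseq_trans hs (subseq_cons _ _).
- by rewrite /= eqxx.
Qed.

Lemma cyclesum_map (S T : eqType) (f : S -> T) (N : S -> S -> int) (N' : T -> T -> int) b h :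
  uniq (b :: h) ->
  {in b :: h &, forall x y, x != y -> N' (f x) (f y) = N x y} ->
  cyclesum N' (f b) (map f h) = cyclesum N b h.
Proof.
move=> ubh NN; rewrite /cyclesum pick_sum_map; apply: eq_pick_sum => l r lr.
have bl : b != l.
  by apply: contraTneq ubh => ->; rewrite /= -(perm_mem lr) mem_head.
have lh : l \in h by rewrite -(perm_mem lr) mem_head.
rewrite NN ?mem_head ?inE ?lh ?orbT // size_map; congr (_ * _).
have : {subset r <= h} by move=> x xr; rewrite -(perm_mem lr) inE xr orbT.
have : uniq (l :: r) by rewrite (perm_uniq lr); case/andP: ubh.
move: lh bl; have [n] := ubnP (size r); elim: n => // n IH in l r {lr} *.
move=> /ltnSE rn lh bl ulr rh; case E: (size r) => [|m] /=.
  by rewrite NN ?mem_head ?inE ?lh ?orbT // eq_sym.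
rewrite pick_sum_map; apply: eq_pick_sum => x t xt.
have xr : x \in r by rewrite -(perm_mem xt) mem_head.
have xl : l != x by apply: contraTneq ulr => ->; rewrite /= xr.
have tm : size t = m by have /= := perm_size xt; rewrite E => -[].
rewrite NN ?inE ?lh ?(rh _ xr) ?orbT //; congr (_ * _).
rewrite -tm; apply: IH.
- by rewrite tm -ltnS -E.
- exact: rh.
- by apply: contraTneq ubh => ->; rewrite /= (rh _ xr).
- by rewrite (perm_uniq xt); case/andP: ulr.
- by move=> y yt; apply: rh; rewrite -(perm_mem xt) inE yt orbT.
Qed.

(** * Products of diagrams, and wheels as explicit sums of words *)

Lemma code_cat (L : eqType) (u v : word L) : arrow_word u -> arrow_word v ->
  {in u & v, forall x y, x.1 != y.1} -> code (u ++ v) = code u ++ code v.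
Proof.
move=> /andP[_ /allP au] /andP[_ /allP av] uv; rewrite /code map_cat; congr (_ ++ _).
  by apply/eq_in_map => x xu; rewrite !index_cat xu au.
have nu y : y \in v -> y \notin u by move=> yv; apply/negP => /uv/(_ yv); rewrite eqxx.
apply/eq_in_map => x xv; rewrite !index_cat (negbTE (nu _ xv)) (negbTE (nu _ (av _ xv))).
by rewrite !PoszD opprD addrACA subrr add0r.
Qed.

Lemma arrow_word_cat (L : eqType) (u v : word L) : arrow_word u -> arrow_word v ->
  {in u & v, forall x y, x.1 != y.1} -> arrow_word (u ++ v).
Proof.
move=> /andP[uu /allP au] /andP[uv /allP av] dis; apply/andP; split.
  rewrite cat_uniq uu uv andbT; apply/hasPn => y yv; apply/negP => yu.
  by have := dis _ _ yu yv; rewrite eqxx.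
by apply/allP => y; rewrite !mem_cat => /orP[/au|/av] ->; rewrite ?orbT.
Qed.

Lemma dg_cat (L : eqType) (u v : word L) : arrow_word u -> arrow_word v ->
  {in u & v, forall x y, x.1 != y.1} -> dg (u ++ v) = dg u * dg v.
Proof. by move=> au av uv; rewrite /dg code_cat // malgU_mul. Qed.

Lemma index_map_in (S T : eqType) (f : S -> T) (s : seq S) x :
  {in s, forall y, f y = f x -> y = x} -> index (f x) (map f s) = index x s.
Proof.
elim: s => //= y s IH H; rewrite IH => [|z zs]; last by apply: H; rewrite inE zs orbT.
case: eqP => [/H -> //|fy]; last by case: eqP => // yx; rewrite yx in fy.
  by rewrite eqxx.
by rewrite inE eqxx.
Qed.

Lemma dg_relabel_in (L N : eqType) (f : L -> N) (w : word L) : arrow_word w ->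
  {in w &, forall x y, f x.1 = f y.1 -> x.1 = y.1} -> dg (relabel f w) = dg w.
Proof.
move=> /andP[_ /allP aw] f_inj; rewrite /dg; congr << FMonom _ >>.
rewrite /code /relabel -map_comp; apply/eq_in_map => x xw /=.
pose g (x : L * bool) := (f x.1, x.2).
have gE t : t \in w -> index (g t) (map g w) = index t w.
  move=> tw; apply: index_map_in => -[a b] yw; case: t tw => c d tw [fac ->].
  by have /= -> := f_inj _ _ yw tw fac.
by rewrite -[(f x.1, ~~ _)]/(g (x.1, ~~ x.2)) !gE // aw.
Qed.

Definition letters (s : seq nat) : word nat := flatten [seq [:: tl x; hd x] | x <- s].

Lemma mem_letters s a b : ((a, b) \in letters s) = (a \in s).
Proof.
elim: s => //= x s IH; rewrite !inE IH !xpair_eqE.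
by case: b {IH}; rewrite ?andbT ?andbF ?orbF //= orbA orbF.
Qed.

Lemma letters_arrow s : uniq s -> arrow_word (letters s).
Proof.
move=> us; apply/andP; split; last first.
  by apply/allP => -[a b]; rewrite !mem_letters.
elim: s us => //= x s IH /andP[xs /IH us].
by rewrite inE xpair_eqE andbF !mem_letters (negbTE xs) us.
Qed.

Section SignedWords.
Notation swords := (seq (rat * word nat)).

(** Signed lists of words can be read in [free_alg], as here, and in an abstract word model, by
    [evw]: this carries the wheels computed by [resolve] over to brackets. *)
Definition dgw (l : swords) : free_alg := \sum_(c <- l) c.1 *: dg c.2.
Definition brw (z : word nat) (l : swords) : swords :=
  [seq (c.1, c.2 ++ z) | c <- l] ++ [seq (- c.1, z ++ c.2) | c <- l].
Definition nuw p z : swords := foldr (fun x acc => brw [:: hd x] acc) [:: (1, [:: z])] p.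
(** [off] brackets with the head of [K] on the left while [brw] does so on the right, hence the
    sign. *)
Definition offw K p : swords :=
  [seq (- c.1, c.2 ++ map tl p) | c <- brw [:: hd K] (nuw p (tl K))].

Lemma brw_sum (V : lmodType rat) (f : word nat -> V) z l :
  \sum_(c <- brw z l) c.1 *: f c.2 =
  \sum_(c <- l) c.1 *: f (c.2 ++ z) - \sum_(c <- l) c.1 *: f (z ++ c.2).
Proof.
rewrite big_cat !big_map -sumrN; congr (_ + _).
by apply: eq_bigr => c _; rewrite scaleNr.
Qed.

Lemma brw_perm z l t : {in l, forall c, perm_eq c.2 t} ->
  {in brw z l, forall c, perm_eq c.2 (z ++ t)}.
Proof.
move=> lt c; rewrite mem_cat => /orP[] /mapP[d /lt dt ->] /=.
  by rewrite perm_catC perm_cat2l.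
by rewrite perm_cat2l.
Qed.

Lemma offw_perm K p : {in offw K p, forall c, perm_eq c.2 (letters (K :: p))}.
Proof.
have nuP : {in nuw p (tl K), forall c, perm_eq c.2 (rcons (map hd p) (tl K))}.
  elim: p => [|x p IH] c /=; first by rewrite inE => /eqP ->.
  by move=> /(brw_perm IH).
move=> c /mapP[d /(brw_perm nuP) dt ->] /=.
apply: (@perm_trans _ (([:: hd K] ++ rcons (map hd p) (tl K)) ++ map tl p)).
  by rewrite perm_cat2r.
rewrite /letters /=; apply: (@perm_trans _ (tl K :: hd K :: map hd p ++ map tl p)).
  by rewrite -cats1; perm_count.
rewrite !perm_cons perm_catC; elim: p {nuP dt} => //= x p IH.
by rewrite perm_cons -cat1s perm_catCA /= perm_cons.
Qed.

Section Eval.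
Context (F : lalgType rat) (A : zmodType) (M : word_model F A).
Notation mono := (monom M).

Definition evw (l : swords) : F := \sum_(c <- l) c.1 *: mono c.2.

Lemma evw_brw z l : evw (brw z l) = br (evw l) (mono z).
Proof.
rewrite /evw big_cat !big_map /br mulr_suml mulr_sumr; congr (_ + _).
  by apply: eq_bigr => c _; rewrite monom_cat scalerAl.
rewrite -sumrN; apply: eq_bigr => c _; rewrite monom_cat scaleNr.
by rewrite (scaler_comm M).
Qed.

Lemma evw_off K p : evw (offw K p) = off M K p.
Proof.
have nuE : evw (nuw p (tl K)) = nu M p (lt M K).
  elim: p => [|x p IH]; first by rewrite /evw big_seq1 scale1r.
  by rewrite /= evw_brw IH.
have tlE : mono (map tl p) = \prod_(x <- p) lt M x.
  elim: p {nuE} => [|x p IH]; first by rewrite big_nil monom_nil.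
  by rewrite big_cons -IH -monom_cat.
rewrite /off -nuE -tlE brN mulNr -evw_brw /evw big_map mulr_suml -sumrN.
by apply: eq_bigr => c _; rewrite scaleNr monom_cat scalerAl.
Qed.
End Eval.

(** Once the cycle is open, each vertex is met with its cycle edge starting on the line. STU_2
    replaces this tail by the bracket of the tail of the next cycle edge with the head of the spoke;
    the last cycle edge is [k] itself. *)
Lemma resolve_wheel k i m u v : (0 < i)%N -> (i + m = k)%N ->
  all (fun z : nat * bool => z.2 || (z.1 < k)%N) (u ++ v) ->
  resolve [seq (j, k + j, k + j.+1 %% k)%N | j <- iota i m] (u ++ (tl (if m == 0%N then k else k + i)%N) :: v) =
  Some (\sum_(c <- nuw (iota i m) (tl k)) c.1 *: dg (u ++ c.2 ++ v)).
Proof.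
elim: m i u v => [|m IH] i u v i0 imk uv; first by rewrite big_seq1 scale1r.
have ki : tl (k + i)%N \notin u /\ tl (k + i)%N \notin v.
  by move: uv; rewrite all_cat => /andP[/allP uP /allP vP]; split; apply/negP => /[dup];
    [move/uP|move/vP] => /=; lia.
have Ek : (k + i.+1 %% k = if m == 0 then k else k + i.+1)%N.
  case: eqP => [m0|m0]; last by rewrite modn_small //; lia.
  by rewrite (_ : i.+1 = k) ?modnn ?addn0 //; lia.
rewrite [resolve _ _]/= !Ek ifT; last by rewrite mem_cat inE eqxx orbT.
rewrite !(subst_mid _ ki.1 ki.2).
have -> : u ++ [:: hd i; tl (if m == 0 then k else k + i.+1)%N] ++ v =
  (u ++ [:: hd i]) ++ tl (if m == 0 then k else k + i.+1)%N :: v by rewrite -catA.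
have uv1 : all (fun z : nat * bool => z.2 || (z.1 < k)%N) (u ++ hd i :: v).
  by move: uv; rewrite !all_cat.
have uv2 : all (fun z : nat * bool => z.2 || (z.1 < k)%N) ((u ++ [:: hd i]) ++ v).
  by rewrite -catA.
have imk' : (i.+1 + m)%N = k by lia.
rewrite (IH i.+1 u (hd i :: v) isT imk' uv1) (IH i.+1 (u ++ [:: hd i]) v isT imk' uv2).
rewrite /opt_sub; congr Some; symmetry.
apply: (etrans (brw_sum (fun z => dg (u ++ z ++ v)) [:: hd i] (nuw (iota i.+1 m) (tl k)))).
apply: (congr2 (fun a b : free_alg => a - b)); apply: eq_bigr => c _.
  by rewrite -!catA.
by rewrite -!catA.
Qed.

Lemma dgw_off K p : dgw (offw K p) =
  \sum_(c <- nuw p (tl K)) c.1 *: dg ([:: hd K] ++ c.2 ++ map tl p) -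
  \sum_(c <- nuw p (tl K)) c.1 *: dg (c.2 ++ hd K :: map tl p).
Proof.
have E (V : lmodType rat) (f : word nat -> V) : \sum_(c <- offw K p) c.1 *: f c.2 =
    \sum_(c <- nuw p (tl K)) c.1 *: f ([:: hd K] ++ c.2 ++ map tl p) -
    \sum_(c <- nuw p (tl K)) c.1 *: f (c.2 ++ hd K :: map tl p).
  rewrite /offw big_map; under eq_bigr do rewrite scaleNr.
  rewrite sumrN (brw_sum (fun z => f (z ++ map tl p))) opprB; congr (_ - _).
  by apply: eq_bigr => c _; rewrite -catA.
exact: (E _ (@dg nat)).
Qed.

Lemma resolve_left l r o vs w : tl r \notin w -> tl l \in w ->
  resolve ((l, r, o) :: vs) w =
  opt_sub (resolve vs (subst (tl l) [:: hd r; tl o] w))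
          (resolve vs (subst (tl l) [:: tl o; hd r] w)).
Proof. by move=> /negbTE rw lw; rewrite /= rw lw. Qed.

(** At the vertex 0 only the spoke starts on the line, so the left form of STU_2 opens the cycle
    there, and the cycle edge entering this vertex takes the role of the arrow [K]. With at least
    two spokes this edge and its successor are distinct. *)
Lemma wheel_off k : wheel k.+2 = dgw (offw k.+2 (iota 1 k.+1)).
Proof.
apply/Some_inj; rewrite -wheel_defined /wheel_skeleton /wheel_vertices.
rewrite -[iota 0 k.+2]/(0%N :: iota 1 k.+1); set n := k.+2; set v := map tl (iota 1 k.+1).
rewrite [map tl _]/= -/v map_cons addn0.
have nv (a : nat) : (a == 0%N) || (n <= a)%N -> tl a \notin v.
  by move=> an; apply/mapP => -[j]; rewrite mem_iota => jn [aj]; move: an; rewrite aj /n; lia.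
rewrite [LHS](resolve_left _ _ (_ : tl n \notin _)) ?mem_head //; last first.
  by rewrite inE negb_or nv ?leqnn ?orbT.
have ss ys : subst (tl 0%N) ys (tl 0%N :: v) = ys ++ v.
  exact: (subst_mid (u := [::]) ys isT (nv 0%N isT)).
have -> : (1 %% n = 1)%N by rewrite modn_small.
rewrite !ss.
have uv s : all (fun z : nat * bool => z.2 || (z.1 < n)%N) (s ++ v) =
    all (fun z : nat * bool => z.2 || (z.1 < n)%N) s.
  rewrite all_cat [X in _ && X](_ : _ = true) ?andbT //.
  by apply/allP => _ /mapP[j + ->]; rewrite mem_iota /n /=; lia.
have n1 : (1 + k.+1)%N = n by [].
have H1 := resolve_wheel (u := [:: hd n]) (v := v) (ltn0Sn 0) n1.
have H2 := resolve_wheel (u := [::]) (v := hd n :: v) (ltn0Sn 0) n1.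
rewrite -[[:: hd n; tl (n + 1)] ++ v]/([:: hd n] ++ tl (n + 1) :: v).
rewrite -[[:: tl (n + 1); hd n] ++ v]/([::] ++ tl (n + 1) :: (hd n :: v)).
rewrite H1 ?uv // H2; last by rewrite -[_ ++ _]/([:: hd n] ++ v) uv.
rewrite /opt_sub; congr Some; symmetry; exact: dgw_off.
Qed.

End SignedWords.

Lemma relabel_offw f K p :
  offw (f K) (map f p) = [seq (c.1, relabel f c.2) | c <- offw K p].
Proof.
have brE z l : brw (relabel f z) [seq (c.1, relabel f c.2) | c <- l] =
    [seq (c.1, relabel f c.2) | c <- brw z l].
  rewrite /brw map_cat -!map_comp; congr (_ ++ _); apply: eq_map => c /=;
  by rewrite /relabel map_cat.
have nuE : nuw (map f p) (tl (f K)) = [seq (c.1, relabel f c.2) | c <- nuw p (tl K)].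
  by elim: p => //= x p ->; rewrite -brE.
rewrite /offw nuE (brE [:: hd K]) -!map_comp; apply: eq_map => c /=.
by rewrite /relabel map_cat -!map_comp.
Qed.

Lemma offw_arrow K p : uniq (K :: p) -> {in offw K p, forall c, arrow_word c.2}.
Proof. by move=> up c /offw_perm /arrow_word_perm ->; apply: letters_arrow. Qed.

Lemma eq_dgw (V : lmodType rat) (f g : word nat -> V) (l : seq (rat * word nat)) :
  {in l, forall c, f c.2 = g c.2} ->
  \sum_(c <- l) c.1 *: f c.2 = \sum_(c <- l) c.1 *: g c.2.
Proof. by move=> fg; apply: eq_big_seq => c cl; rewrite fg. Qed.

Lemma dgw_offw K p : uniq (K :: p) -> p != [::] -> dgw (offw K p) = wheel (size p).+1.
Proof.
case: p => // x p; set q := x :: p => uq _; rewrite wheel_off.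
(* Label j of the standard wheel goes to entry j of [q], counted from 1, and the last label to
   [K]. *)
pose f j := nth 0%N (rcons q K) j.-1.
have fK : f (size q).+1 = K by rewrite /f nth_rcons ltnn eqxx.
have fq : map f (iota 1 (size q)) = q.
  rewrite -[1%N]addn0 iotaDl -map_comp -[RHS](mkseq_nth 0%N) /mkseq.
  by apply/eq_in_map => j; rewrite mem_iota /= /f nth_rcons => ->.
have E : dgw (offw K q) = \sum_(c <- offw (size q).+1 (iota 1 (size q)))
    c.1 *: dg (relabel f c.2).
  have := relabel_offw f (size q).+1 (iota 1 (size q)); rewrite fK fq => ->.
  by rewrite /dgw big_map.
rewrite E; refine (@eq_dgw free_alg (fun u => dg (relabel f u)) (@dg nat) _ _) => c co.
have uiota : uniq ((size q).+1 :: iota 1 (size q)).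
  by rewrite cons_uniq mem_iota add1n ltnn andbF iota_uniq.
apply: dg_relabel_in; first exact: (offw_arrow uiota co).
have mem_c y : y \in c.2 -> (0 < y.1 <= (size q).+1)%N.
  case: y => a b; rewrite (perm_mem (offw_perm co)) mem_letters inE mem_iota /=; lia.
have uqK : uniq (rcons q K) by rewrite rcons_uniq.
move=> y z /mem_c /andP[y0 yn] /mem_c /andP[z0 zn] fyz.
have yl : (y.1.-1 < size (rcons q K))%N by rewrite size_rcons prednK.
have zl : (z.1.-1 < size (rcons q K))%N by rewrite size_rcons prednK.
have := nth_uniq 0%N yl zl uqK; rewrite [nth _ _ _](fyz : nth 0%N _ _ = nth 0%N _ _) eqxx.
by move=> /esym/eqP E1; rewrite -(prednK y0) -(prednK z0) E1.
Qed.

(** * Removing one arrow *)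

Section Rec.
Context (F : lalgType rat) (A : zmodType) (M : word_model F A).
Notation psi := (value M).
Notation lt := (lt M).
Notation lh := (lh M).
Notation mono := (monom M).

Lemma value_mono u : arrow_word u -> psi (mono u) = class_of M (dg u).
Proof. by move=> au; rewrite -[mono u]scale1r val_monom // scale1r. Qed.

Lemma value_off K p v : uniq (K :: p) -> p != [::] -> arrow_word v ->
  {in v, forall x, x.1 \notin K :: p} ->
  psi (off M K p * mono v) = class_of M (wheel (size p).+1 * dg v).
Proof.
move=> uq p0 av vp; rewrite -evw_off -(dgw_offw uq p0) /evw /dgw.
rewrite !mulr_suml !raddf_sum; apply: eq_big_seq => c co.
have ac := offw_arrow uq co.
have dis : {in c.2 & v, forall x y, x.1 != y.1}.
  move=> [a b] y; rewrite (perm_mem (offw_perm co)) mem_letters => ap /vp.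
  by apply: contraNneq => <-.
rewrite -scalerAl -monom_cat val_monom.
  by rewrite dg_cat // scalerAl.
exact: arrow_word_cat.
Qed.

Lemma value_isolated k v : arrow_word v -> {in v, forall x, x.1 != k} ->
  psi (lh k * lt k * mono v) = class_of M (D_A * dg v).
Proof.
move=> av kv; have kE : lh k * lt k = lt k * lh k - br (lt k) (lh k) by rewrite /br opprB subrKC.
rewrite kE mulrBl raddfB -[br _ _]mul1r val_RI subr0 -!monom_cat.
have ak : arrow_word [:: tl k; hd k].
  by rewrite -(arrow_word_perm (perm_refl (letters [:: k]))) letters_arrow.
have dis : {in [:: tl k; hd k] & v, forall x y, x.1 != y.1}.
  by move=> x y; rewrite !inE => /orP[] /eqP -> /kv; rewrite eq_sym.
have ac := arrow_word_cat ak av dis.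
have E : dg [:: tl k; hd k] = D_A.
  by rewrite /D_A -(@dg_relabel_in _ _ (fun _ : nat => k) [:: tl 0%N; hd 0%N]) // => -[a ?] [b ?];
    rewrite !inE !xpair_eqE => /orP[] /andP[/eqP-> _] /orP[] /andP[/eqP-> _].
by rewrite (value_mono ac) (dg_cat ak av dis) E.
Qed.

Definition sub_word (w : word nat) (s : seq nat) := restrict (mem s) w.

Lemma sub_word_compl w ys s : uniq (ys ++ s) -> (forall a, (hd a \in w) = (a \in ys ++ s)) ->
  arrow_word w -> restrict (fun a => a \notin ys) w = sub_word w s.
Proof.
move=> us ws aw; apply: eq_in_filter => -[a b] zw /=.
have : a \in ys ++ s.
  rewrite -ws; case: b zw => zw //.
  by rewrite mem_hd_tl.
move: us; rewrite cat_uniq mem_cat => /and3P[_ /hasPn dis _].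
by case: (boolP (a \in s)) => [/dis /= ->|_]; rewrite ?orbF // => ->.
Qed.

Lemma arrow_rec (w : word nat) (k : nat) (s : seq nat) :
  arrow_word w -> uniq (k :: s) -> (forall a, (hd a \in w) = (a \in k :: s)) ->
  class_of M (dg w) = class_of M (D_A * dg (sub_word w s)) +
    split_sum s (fun h h' => class_of M (wheel (size h).+1 * dg (sub_word w h')) *~
      ((-1) ^+ (size h).+1 * cyclesum (nmx w) k h)).
Proof.
move=> aw uks ws; rewrite -value_mono // -(comb1 M w k).
rewrite (comb_first M aw uks ws).
rewrite value_isolated; first last.
- by move=> x; rewrite mem_filter => /andP[].
- exact: arrow_word_restrict.
rewrite (_ : restrict (predC1 k) w = sub_word w s); last first.
  rewrite -(@sub_word_compl w [:: k] s) //.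
  by apply: eq_filter => x /=; rewrite inE.
congr (_ + _).
(* The value of a closed chain of [j] arrows next to the remaining arrows [h']; the sign is that of
   [tokens_off]. *)
pose W j h' := class_of M (wheel j * dg (sub_word w h')) *~ (-1) ^+ j.
have Cstep l t r : (0 < size t)%N -> last l t = k -> perm_eq ((l :: t) ++ r) (k :: s) ->
  comb M w (l :: t) = W (size t).+1 r *~ nmx w l k +
    \sum_(j <- r) comb M w [:: j, l & t] *~ nmx w l j.
  move=> t0 tk pr; have ur : uniq ((l :: t) ++ r) by rewrite (perm_uniq pr).
  have wr a : (hd a \in w) = (a \in (l :: t) ++ r) by rewrite ws (perm_mem pr).
  have ult : uniq (l :: t) by move: ur; rewrite cat_uniq => /and3P[].
  have ltw a : a \in l :: t -> hd a \in w by rewrite wr mem_cat => ->.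
  rewrite (comb_step M aw ult ltw ur wr) // tk; congr (_ *~ _ + _).
  rewrite (wheelv_pullout M aw ult) // (sub_word_compl ur wr aw) tokens_off //.
  rewrite value_off // ?arrow_word_restrict //; first by case: (t) t0.
  move=> x; rewrite mem_filter => /andP[/= xr _]; move: ur; rewrite cat_uniq.
  by case/and3P => _ /hasPn/(_ _ xr).
rewrite -pick_sum_sum [LHS](_ : _ = pick_sum s (fun l r => split_sum r (fun h h' =>
    W (2 + size h)%N h' *~ pathsum (nmx w) k (size h) l h *~ nmx w k l))); last first.
  apply: eq_pick_sum => l r lr; rewrite (unroll Cstep (S := r)) ?split_sum_mulrz //.
  have lr' : perm_eq [:: k, l & r] (k :: s) by rewrite perm_cons.
  by apply: perm_trans lr'; perm_count.
rewrite pick_sum_split_sum; apply: eq_split_sum => h h'; rewrite /cyclesum.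
rewrite mulrzA -/(W _ _) mulrz_pick_sum; apply: eq_pick_sum => l r lr.
have /= [<-] := perm_size lr.
by rewrite mulrC mulrzA.
Qed.

End Rec.

HB.instance Definition _ := GRing.isZmodMorphism.Build ffree diagrams psi psiB.
HB.instance Definition _ f := GRing.isZmodMorphism.Build ffree ffree (rl f) (@rl_additive f).

Lemma psi_class c u : arrow_word u -> psi (c *: mono u) = cls (c *: dg u).
Proof. by move=> au; apply: (etrans (psi_mono c u)); rewrite au. Qed.

Lemma psi_rename f c w : injective f -> psi (rl f (c *: mono w)) = psi (c *: mono w).
Proof. by move=> fi; apply: (etrans (congr1 psi (rl_mono f c w)) (psi_relabel fi c w)). Qed.

Definition concrete_model : word_model ffree diagrams :=
  @WordModel ffree diagrams psi mono (@malg_scalerAr _) psiZ_eq0 mono_nil mono_cat ffree_ind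
    psi_mono2 psi_mono4 cls psi_class rl rl_mono psi_rename.

(** The existential hides the concrete algebra of words, so that [arrow_rec] is instantiated with an
    abstract model while its conclusion speaks of [cls]. *)
Lemma class_of_model : exists (F : lalgType rat) (M : word_model F diagrams),
  forall x, class_of M x = cls x.
Proof. by exists ffree, concrete_model. Qed.

Lemma cls_rec (w : word nat) (k : nat) (s : seq nat) :
  arrow_word w -> uniq (k :: s) -> (forall a, (hd a \in w) = (a \in k :: s)) ->
  cls (dg w) = cls (D_A * dg (sub_word w s)) +
    split_sum s (fun h h' => cls (wheel (size h).+1 * dg (sub_word w h')) *~
      ((-1) ^+ (size h).+1 * cyclesum (nmx w) k h)).
Proof.
move=> aw uks ws; case: class_of_model => F [M ME].
apply: (etrans (esym (ME _))); apply: (etrans (arrow_rec M aw uks ws)).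
apply: (congr2 (fun x y : diagrams => x + y) (ME _)); apply: eq_split_sum => h h'.
exact: (congr1 (fun x : diagrams => x *~ _) (ME _)).
Qed.

Lemma perm_insert_before (w : word nat) (x y : nat * bool) : uniq w -> x \in w ->
  perm_eq (insert_before x y w) (y :: w) /\ perm_eq (insert_after x y w) (y :: w).
Proof.
move=> uw /mem_split[u [v wE]]; rewrite wE in uw *; have [xu xv] := uniq_mid uw.
by rewrite /insert_before /insert_after !subst_mid //; split; perm_count.
Qed.

(** * Multiplication and commutativity in the quotient *)

Definition shift_labels (m : nat) (u : word nat) : word nat := relabel (addn m) u.

Lemma dg_mul_shift (u v : word nat) m : arrow_word u -> arrow_word v -> all (fun x => x.1 < m)%N v ->
  arrow_word (shift_labels m u ++ v) /\ dg u * dg v = dg (shift_labels m u ++ v).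
Proof.
move=> au av /allP vm.
have au' : arrow_word (shift_labels m u) by rewrite arrow_word_relabel //; exact: addnI.
have dis : {in shift_labels m u & v, forall x y, x.1 != y.1}.
  by move=> _ y /mapP[x _ ->] /vm /=; lia.
split; first exact: arrow_word_cat.
rewrite (dg_cat au' av dis); congr (_ * _).
by apply: dg_code; rewrite code_relabel //; exact: addnI.
Qed.

Lemma labels_bound (v : word nat) : exists m, all (fun x => x.1 < m)%N v.
Proof.
exists (\max_(x <- v) x.1).+1; apply/allP => x xv; rewrite ltnS.
by rewrite (big_rem x) //= leq_maxl.
Qed.

(** Codes forget labels, so those of [u] may be shifted past the labels of the relator; the two then
    stand on one line, where the relator keeps its form. *)
Lemma relator_mull (u : word nat) x : arrow_word u -> relator x -> lin_span relator (dg u * x).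
Proof.
move=> au; case.
- move=> p q a b aw; have [m wm] := labels_bound (p ++ [:: tl a; tl b] ++ q).
  have aw' : arrow_word (p ++ [:: tl b; tl a] ++ q).
    by rewrite (arrow_word_perm (w' := p ++ [:: tl a; tl b] ++ q)) //; perm_count.
  have wm' : all (fun x => x.1 < m)%N (p ++ [:: tl b; tl a] ++ q).
    by move: wm; rewrite !all_cat /= => /and3P[-> /and3P[-> -> _] ->].
  have [A1 E1] := dg_mul_shift au aw wm; have [_ E2] := dg_mul_shift au aw' wm'.
  apply: (eq_ind_r (lin_span relator) _ (etrans (mulrBr _ _ _) (congr2 (fun x y => x - y) E1 E2))).
  by move: A1; rewrite !catA -!(catA _ _ q) => A1; apply/span_gen/TC.
- move=> w a b bw ab aw.
  have [m wm] := labels_bound (hd b :: w).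
  have ta : tl a \in w.
    move: aw; have := bw => /andP[_ /allP] aw' aw.
    have := aw' (hd a); rewrite inE aw orbT => /(_ isT).
    by rewrite inE => /orP[/eqP[]|].
  have uw : uniq w by case/andP: bw => /andP[].
  have [p1 p2] := perm_insert_before (hd b) uw ta.
  have [p3 p4] := perm_insert_before (hd b) uw aw.
  have H z : perm_eq z (hd b :: w) ->
      dg u * dg z = dg (shift_labels m u ++ z).
    move=> pz; have az : arrow_word z by rewrite (arrow_word_perm pz).
    have zm : all (fun x => x.1 < m)%N z by rewrite (perm_all _ pz).
    by have [_ ->] := dg_mul_shift au az zm.
  set u' := shift_labels m u in H.
  have lu' c (d : bool) : c \in [:: a; b] -> (c, d) \notin u'.
    move=> cab; apply/mapP => -[y _ [cE _]]; move/allP: wm => wm.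
    have := wm (hd b); have := wm (tl a); rewrite !inE ta eqxx orbT /= => /(_ isT) am /(_ isT) bm.
    by move: cab; rewrite !inE cE => /orP[] /eqP; lia.
  have ins c d : c \in [:: a; b] -> u' ++ insert_before (c, d) (hd b) w =
      insert_before (c, d) (hd b) (u' ++ w) /\ u' ++ insert_after (c, d) (hd b) w =
      insert_after (c, d) (hd b) (u' ++ w).
    by move=> cab; rewrite /insert_before /insert_after !subst_cat !(subst_notin _ (lu' _ d cab)).
  have [i1 i2] := ins a false (mem_head _ _); have [i3 i4] := ins a true (mem_head _ _).
  have E : dg u * (dg (insert_before (tl a) (hd b) w) + dg (insert_before (hd a) (hd b) w)
      - (dg (insert_after (tl a) (hd b) w) + dg (insert_after (hd a) (hd b) w))) =
      dg (insert_before (tl a) (hd b) (u' ++ w)) + dg (insert_before (hd a) (hd b) (u' ++ w))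
      - (dg (insert_after (tl a) (hd b) (u' ++ w)) + dg (insert_after (hd a) (hd b) (u' ++ w))).
    rewrite -i1 -i2 -i3 -i4; apply: (etrans (mulrBr _ _ _)).
    apply: (congr2 (fun x y => x - y)); apply: (etrans (mulrDr _ _ _));
      by apply: (congr2 +%R); apply: H.
  apply: (eq_ind_r (lin_span relator) _ E); apply/span_gen/FourT => //.
    have bm : all (fun x => x.1 < m)%N (hd b :: w) by [].
    have [A _] := dg_mul_shift au bw bm; rewrite -(arrow_word_perm (w := shift_labels m u ++ hd b :: w)) //.
    by rewrite /u' -cat1s perm_catCA.
  by rewrite mem_cat aw orbT.
- move=> p q a aw; have [m wm] := labels_bound (p ++ [:: tl a; hd a] ++ q).
  have aw' : arrow_word (p ++ [:: hd a; tl a] ++ q).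
    by rewrite (arrow_word_perm (w' := p ++ [:: tl a; hd a] ++ q)) //; perm_count.
  have wm' : all (fun x => x.1 < m)%N (p ++ [:: hd a; tl a] ++ q).
    by move: wm; rewrite !all_cat /= => /and3P[-> /andP[-> _] ->].
  have [A1 E1] := dg_mul_shift au aw wm; have [_ E2] := dg_mul_shift au aw' wm'.
  apply: (eq_ind_r (lin_span relator) _ (etrans (mulrBr _ _ _) (congr2 (fun x y => x - y) E1 E2))).
  by move: A1; rewrite !catA -!(catA _ _ q) => A1; apply/span_gen/RI.
Qed.

Lemma cls_dg_mull (u : word nat) x y : arrow_word u -> cls x = cls y ->
  cls (dg u * x) = cls (dg u * y).
Proof.
move=> au /eqP/clsP xy; apply/eqP/clsP.
apply: (eq_ind _ (lin_span relator) _ _ (mulrBr (dg u) x y)).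
apply: (@span_lin _ (fun z => dg u * z)) xy.
- exact: mulrDr.
- by move=> a z; apply/esym/malg_scalerAr.
- by move=> z; apply: relator_mull.
Qed.

Lemma cls_dgw_mull l x y : {in l, forall c : rat * word nat, arrow_word c.2} ->
  cls x = cls y -> cls (dgw l * x) = cls (dgw l * y).
Proof.
move=> al xy; rewrite /dgw.
have E z : cls ((\sum_(c <- l) c.1 *: dg c.2) * z) = \sum_(c <- l) cls (c.1 *: (dg c.2 * z)).
  rewrite -(raddf_sum cls); apply: (congr1 cls); apply: (etrans (mulr_suml _ _ _ _)).
  by apply: eq_bigr => c _; apply/esym/scalerAl.
apply: (etrans (E x)); apply: (etrans _ (esym (E y))); apply: eq_big_seq => c cl.
by apply: clsZ; apply: cls_dg_mull => //; apply: al.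
Qed.

Lemma D_A_arrow : arrow_word [:: tl 0%N; hd 0%N]. Proof. by []. Qed.

Lemma cls_wheel_mull k x y : cls x = cls y -> cls (wheel k.+2 * x) = cls (wheel k.+2 * y).
Proof.
rewrite wheel_off; apply: cls_dgw_mull; apply: offw_arrow.
by rewrite cons_uniq mem_iota add1n ltnn andbF iota_uniq.
Qed.

Lemma index_filter_lt (T : eqType) (P : pred T) (s : seq T) x y : P x -> P y ->
  (index x (filter P s) < index y (filter P s))%N = (index x s < index y s)%N.
Proof.
move=> Px Py; elim: s => //= z s IH; case: ifP => Pz /=.
  by case: eqP => _; case: eqP => _ //; rewrite !ltnS.
have [zx zy] : z != x /\ z != y.
  by split; apply: contraFneq Pz => ->.
by rewrite (negbTE zx) (negbTE zy) ltnS IH.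
Qed.

Lemma nmx_sub_word w s a b : a \in s -> b \in s -> nmx (sub_word w s) a b = nmx w a b.
Proof. by move=> sa sb; rewrite /nmx /sub_word /restrict !index_filter_lt. Qed.

Lemma mem_sub_word w s z : (z \in sub_word w s) = (z.1 \in s) && (z \in w).
Proof. by rewrite mem_filter. Qed.

Lemma cyclesum_nil (T : Type) (N : T -> T -> int) b : cyclesum N b [::] = 0.
Proof. by []. Qed.

(* A diagram only depends, in the quotient, on the matrix [nmx]; this makes the quotient
   commutative. *)
Lemma cls_nmx (w w' : word nat) (s : seq nat) : arrow_word w -> arrow_word w' -> uniq s ->
  (forall a, (hd a \in w) = (a \in s)) -> (forall a, (hd a \in w') = (a \in s)) ->
  {in s &, forall a b, a != b -> nmx w a b = nmx w' a b} -> cls (dg w) = cls (dg w').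
Proof.
have [n] := ubnP (size s); elim: n => // n IH in s w w' *.
case: s => [|k s] ns aw aw' us ws ws' nww.
  have nil (v : word nat) : arrow_word v -> (forall a, (hd a \in v) = (a \in [::])) -> v = [::].
    case: v => // -[a b] v av /(_ a); rewrite in_nil => /negbT H.
    have : hd a \in (a, b) :: v.
      case: b H av => H av; first exact: mem_head.
      by rewrite (mem_hd_tl _ av) mem_head.
    by rewrite (negbTE H).
  by rewrite (nil w) // (nil w').
rewrite (cls_rec aw us ws) (cls_rec aw' us ws').
have sub t : subseq t s -> cls (dg (sub_word w t)) = cls (dg (sub_word w' t)).
  move=> ts; have ut : uniq t by apply: subseq_uniq ts _; case/andP: us.
  have tks a : a \in t -> a \in k :: s by move=> at'; rewrite inE (mem_subseq ts at') orbT.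
  apply: (IH t) => //.
  - by rewrite (leq_ltn_trans (size_subseq ts)).
  - exact: arrow_word_restrict.
  - exact: arrow_word_restrict.
  - by move=> a; rewrite mem_sub_word ws /=; case: (boolP (a \in t)) => // /tks ->.
  - by move=> a; rewrite mem_sub_word ws' /=; case: (boolP (a \in t)) => // /tks ->.
  - by move=> a b at' bt ab; rewrite !nmx_sub_word //; apply: nww => //; apply: tks.
apply: (congr2 (fun x y : diagrams => x + y)).
  by apply: cls_dg_mull; [exact: D_A_arrow | apply: sub].
(* The wheel with one spoke occurs with coefficient 0; [cls_wheel_mull] covers the others. *)
have term0 N (x : diagrams) : x *~ ((-1) ^+ (size ([::] : seq nat)).+1 * cyclesum N k [::]) = 0.
  by rewrite cyclesum_nil mulr0 mulr0z.
apply: eq_split_sum_sub => -[|x h] h' hh' hs hs'; first exact: (etrans (term0 _ _) (esym (term0 _ _))).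
apply: (congr2 (fun (x : diagrams) n => x *~ n)).
  by apply: cls_wheel_mull; apply: sub.
congr (_ * _); rewrite -[x :: h]map_id -[in LHS](map_id (x :: h)).
have uxh : uniq (k :: x :: h) by apply: (subseq_uniq _ us); rewrite /= eqxx.
rewrite -[k in LHS]/(id k) (@cyclesum_map _ _ id (nmx w') (nmx w)) ?map_id //.
move=> a b ax bx ab; apply: nww => //.
  by move: ax; rewrite !inE => /orP[->//|ax]; rewrite (mem_subseq hs) ?orbT // inE.
by move: bx; rewrite !inE => /orP[->//|bx]; rewrite (mem_subseq hs) ?orbT // inE.
Qed.

Lemma nmx_cat_l u v a b : arrow_word u -> arrow_word v ->
  {in u & v, forall x y, x.1 != y.1} -> hd a \in u -> hd b \in u ->
  nmx (u ++ v) a b = nmx u a b.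
Proof.
move=> au av dis ua ub; rewrite /nmx !index_cat ub ua.
by rewrite -mem_hd_tl // ua.
Qed.

Lemma nmx_cat_r u v a b : arrow_word u -> arrow_word v ->
  {in u & v, forall x y, x.1 != y.1} -> hd a \in v -> hd b \in v ->
  nmx (u ++ v) a b = nmx v a b.
Proof.
move=> au av dis va vb; have nu y : y \in v -> y \notin u.
  by move=> yv; apply/negP => /dis/(_ yv); rewrite eqxx.
have ta : tl a \in v by rewrite -mem_hd_tl.
by rewrite /nmx !index_cat !(negbTE (nu _ _)) // !ltn_add2l.
Qed.

Lemma nmx_cat_lr u v a b : arrow_word u -> arrow_word v ->
  {in u & v, forall x y, x.1 != y.1} -> hd a \in u -> hd b \in v ->
  nmx (u ++ v) a b = 0 /\ nmx (v ++ u) a b = 0.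
Proof.
move=> au av dis ua vb; have nu y : y \in v -> y \notin u.
  by move=> yv; apply/negP => /dis/(_ yv); rewrite eqxx.
have nv y : y \in u -> y \notin v.
  by move=> yv; apply/negP => /(dis _ _ yv); rewrite eqxx.
have ta : tl a \in u by rewrite -mem_hd_tl.
rewrite /nmx !index_cat (negbTE (nu _ vb)) ta ua (negbTE (nv _ ta)) (negbTE (nv _ ua)) vb.
have i1 x : x \in u -> (index x u < size u + index (hd b) v)%N.
  by rewrite -index_mem => H; rewrite (leq_trans H) // leq_addr.
have i2 x : (size v + index x u < index (hd b) v)%N = false.
  apply/negbTE; rewrite -leqNgt; apply: leq_trans (leq_addr _ _).
  by rewrite ltnW // index_mem.
by rewrite !i1 // !i2 !subrr.
Qed.

(** Whichever factor comes first, [nmx] is block diagonal: an arrow has both its ends on the same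
    side of every head of the other factor. So [cls_nmx] applies. *)
Lemma cls_dg_comm (u v : word nat) : arrow_word u -> arrow_word v ->
  cls (dg u * dg v) = cls (dg v * dg u).
Proof.
move=> au av; have [m vm] := labels_bound v; set u' := shift_labels m u.
have au' : arrow_word u' by rewrite arrow_word_relabel //; exact: addnI.
have dis : {in u' & v, forall x y, x.1 != y.1}.
  by move=> _ y /mapP[x _ ->] /(allP vm) /=; lia.
have dis' : {in v & u', forall x y, x.1 != y.1}.
  by move=> x y xv yu; rewrite eq_sym dis.
have uE : dg u = dg u' by apply/esym/dg_code; rewrite code_relabel //; exact: addnI.
rewrite uE -(dg_cat au' av dis) -(dg_cat av au' dis').
pose lab w : seq nat := [seq x.1 | x <- w & x.2].
have labP w a : (a \in lab w) = (hd a \in w).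
  apply/mapP/idP => [[[b []]]|aw]; rewrite ?mem_filter //=; first by move=> bw ->.
  by exists (hd a); rewrite // mem_filter.
have dl a : hd a \in u' -> hd a \in v -> False.
  by move=> au1 av1; have := dis _ _ au1 av1; rewrite eqxx.
apply: (@cls_nmx _ _ (undup (lab (u' ++ v)))).
- exact: arrow_word_cat.
- exact: arrow_word_cat.
- exact: undup_uniq.
- by move=> a; rewrite mem_undup labP.
- by move=> a; rewrite mem_undup labP !mem_cat orbC.
move=> a b; rewrite !mem_undup !labP !mem_cat => /orP[ua|va] /orP[ub|vb] ab.
- by rewrite nmx_cat_l // nmx_cat_r.
- by have [-> ->] := nmx_cat_lr au' av dis ua vb.
- by have [-> ->] := nmx_cat_lr av au' dis' va ub.
- by rewrite nmx_cat_r // nmx_cat_l.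
Qed.

(** * Determinants indexed by lists *)

Section ListDet.
Context (T : eqType) (N : T -> T -> int) (b : T).

Definition dmx (rs cs : seq T) : int :=
  \det (\matrix_(i < size rs, j < size rs) N (nth b rs i) (nth b cs j)).

Definition del i (s : seq T) := take i s ++ drop i.+1 s.

Lemma nth_del i (s : seq T) j : nth b (del i s) j = nth b s (bump i j).
Proof.
rewrite /del nth_cat size_take /bump; case: (ltnP i (size s)) => si.
  case: ltnP => ji; first by rewrite nth_take.
  by rewrite nth_drop; congr nth; lia.
case: ltnP => js; first by rewrite nth_take ?(leq_trans js) // leqNgt (leq_trans js) //.
by rewrite drop_oversize ?nth_nil ?nth_default //; lia.
Qed.

Lemma size_del i (s : seq T) : (i < size s)%N -> size (del i s) = (size s).-1.
Proof. by move=> si; rewrite /del size_cat size_drop size_takel; lia. Qed.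

Lemma pick_sum_ord (A : zmodType) (s : seq T) (G : T -> seq T -> A) :
  pick_sum s G = \sum_(i < size s) G (nth b s i) (del i s).
Proof.
elim: s G => [|x s IH] G /=; first by rewrite big_ord0.
by rewrite big_ord_recl /= /del take0 drop1 /= IH; congr (_ + _); apply: eq_bigr.
Qed.

Lemma dmx_move i (s : seq T) (c : T) : (i < size s)%N ->
  dmx s (c :: del i s) = (-1) ^+ i * dmx (nth b s i :: del i s) (c :: del i s).
Proof.
move=> si; rewrite {2}/dmx /= size_del // prednK ?(leq_ltn_trans _ si) //.
rewrite /dmx; case E: (size s) si => [//|n] si; set B := \matrix_(_, _) _.
set A := \matrix_(_, _) _; have -> : A = row_perm (lift_perm ord0 (Ordinal si) 1) B.
  apply/matrixP => a c'; rewrite !mxE; congr N.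
  case: (unliftP ord0 a) => [a' ->|->]; last by rewrite lift_perm_id.
  by rewrite lift_perm_lift perm1 /= nth_del.
rewrite row_permE det_mulmx det_perm odd_lift_perm odd_perm1 addbF /=.
by rewrite signr_odd mulrA -exprD addnn -signr_odd odd_double mul1r.
Qed.

(** In the expansion along row [k], the minor for a column [l] of [s] still contains the row [l].
    Moving this row to the top restores the shape, with [l] in place of [k]; the cofactor sign
    (-1)^(i+1) and the sign (-1)^i of the move combine to -1. *)
Lemma dmx_step k s :
  dmx (k :: s) (b :: s) =
  N k b * dmx s s - pick_sum s (fun l r => N k l * dmx (l :: r) (b :: r)).
Proof.
rewrite {1}/dmx (expand_det_row _ ord0) big_ord_recl; congr (_ + _).
  rewrite mxE /= /cofactor addn0 expr0 mul1r; congr (_ * \det _).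
  by apply/matrixP => i j; rewrite !mxE.
rewrite pick_sum_ord -sumrN; apply: eq_bigr => i _.
rewrite mxE /= /cofactor; have -> : \det (row' ord0 (col' (lift ord0 i)
   (\matrix_(i < (size s).+1, j < (size s).+1) N (nth b (k :: s) i) (nth b (b :: s) j)))) =
   dmx s (b :: del i s).
  congr (\det _); apply/matrixP => x y; rewrite !mxE /=; congr N.
  by case: y => -[|y] //= ys; rewrite nth_del /bump /= !add1n ltnS addnS.
rewrite dmx_move //.
rewrite add0n -mulrN; congr (_ * _); rewrite mulrA -exprD -[RHS]mulN1r; congr (_ * _).
by rewrite /= /bump /= add0n add1n addSn -signr_odd /= oddD addbb.
Qed.

Lemma mulr_split_sum (c : int) (s : seq T) (G : seq T -> seq T -> int) :
  c * split_sum s G = split_sum s (fun h h' => c * G h h').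
Proof. by elim: s G => //= x s IH G; rewrite mulrDr !IH. Qed.

Lemma mulr_pick_sum (c : int) (s : seq T) (G : T -> seq T -> int) :
  c * pick_sum s G = pick_sum s (fun y r => c * G y r).
Proof. by elim: s G => [|y s IH] G /=; rewrite ?mulr0 // mulrDr IH. Qed.

(** The analogue of [unroll], with principal minors in place of classes of diagrams and a sign at
    each step. *)
Lemma dmx_unroll k s :
  dmx (k :: s) (b :: s) =
  split_sum s (fun h h' => dmx h' h' * ((-1) ^+ size h * pathsum N b (size h) k h)).
Proof.
have [n] := ubnP (size s); elim: n => // n IH in k s *.
move=> /ltnSE sn; rewrite dmx_step.
rewrite [pick_sum _ _](_ : _ = pick_sum s (fun l r => split_sum r (fun h h' =>
    N k l * (dmx h' h' * ((-1) ^+ size h * pathsum N b (size h) l h))))); last first.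
  apply: eq_pick_sum => l r lr; rewrite IH //; last by have := perm_size lr => /= rS; rewrite rS.
  by rewrite mulr_split_sum.
rewrite pick_sum_split_sum -[N k b * _](split_sum_nil s (fun h => N k b * dmx h h)).
rewrite -[X in _ + X = _]mulN1r mulr_split_sum.
rewrite -split_sumD; apply: eq_split_sum_perm => -[|x h] h' hh'.
  by rewrite /= mulr0 addr0 expr0 mul1r mulrC.
rewrite add0r (_ : pathsum N b _ k _ = pick_sum (x :: h) (fun l r => N k l * pathsum N b (size h) l r)) //.
rewrite !mulr_pick_sum; apply: eq_pick_sum => l r /perm_size /= [rh].
by rewrite rh exprS; ring.
Qed.

(** This is [dmx_unroll] started at [b] itself. There the empty path contributes [N b b], while
    [cyclesum] of the empty list is 0 by definition. *)
Lemma dmx_cycles s : N b b = 0 ->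
  dmx (b :: s) (b :: s) =
  split_sum s (fun h h' => dmx h' h' * ((-1) ^+ size h * cyclesum N b h)).
Proof.
move=> Nbb; rewrite dmx_unroll; apply: eq_split_sum_perm => -[|x h] h' _.
  by rewrite /= Nbb mulr0.
congr (_ * (_ * _)); apply: eq_pick_sum => l r /perm_size /= [rh].
by rewrite rh.
Qed.

End ListDet.

Lemma sum_split_sum (I : finType) (T : Type) (A : zmodType) (s : seq T) (G : I -> seq T -> seq T -> A) :
  \sum_i split_sum s (G i) = split_sum s (fun h h' => \sum_i G i h h').
Proof. by elim: s G => //= x s IH G; rewrite big_split /= !IH. Qed.

Lemma split_sum_size (T : Type) (A : zmodType) (s : seq T) (Phi : nat -> A) :
  split_sum s (fun h h' => Phi (size h)) = \sum_(r < (size s).+1) Phi r *+ 'C(size s, r).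
Proof.
elim: s Phi => [|x s IH] Phi /=; first by rewrite big_ord_recl big_ord0 bin0 addr0.
rewrite (IH (fun r => Phi r.+1)) (IH Phi) [RHS]big_ord_recl /= bin0.
rewrite [X in _ + X]big_ord_recl bin0 /= addrCA; congr (_ + _).
rewrite [RHS](eq_bigr (fun i : 'I_(size s).+1 => Phi i.+1 *+ 'C(size s, i) + Phi i.+1 *+ 'C(size s, i.+1))).
  rewrite big_split /=; congr (_ + _); rewrite [RHS]big_ord_recr /= bin_small // mulr0n addr0.
  by apply: eq_bigr.
by move=> i _; rewrite /= /bump /= add1n binS mulrnDr addrC.
Qed.

(** * Sums over cablings *)

Section Agg.
Context (n : nat) (sgn : 'I_n -> int).
Notation lab := (nat * 'I_n)%type.

(** Each label of [s] stands for one copy of an arrow, and the sum runs over the choices of that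
    arrow. Labels tell parallel copies apart and fix their order. *)
Fixpoint agg (A : zmodType) (s : seq nat) (F : seq lab -> A) : A :=
  if s is x :: s' then \sum_i agg s' (fun g => F ((x, i) :: g)) *~ sgn i else F [::].

Definition relab (f : nat -> nat) (g : seq lab) : seq lab := [seq (f x.1, x.2) | x <- g].

Lemma unzip1_relab f g : unzip1 (relab f g) = map f (unzip1 g).
Proof. by rewrite /unzip1 -!map_comp. Qed.

(** This makes the sum over an increasing list of labels depend only on its length ([agg_iota]). *)
Definition stable (A : Type) (F : seq lab -> A) :=
  forall f g, uniq (unzip1 g) -> {in unzip1 g &, {mono f : x y / (x < y)%N}} ->
  F (relab f g) = F g.

Lemma eq_agg (A : zmodType) s (F F' : seq lab -> A) : (forall g, unzip1 g = s -> F g = F' g) -> agg s F = agg s F'.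
Proof.
elim: s F F' => [|x s IH] F F' FF' /=; first exact: FF'.
by apply: eq_bigr => i _; congr (_ *~ _); apply: IH => g gs; apply: FF'; rewrite /= gs.
Qed.

Lemma aggD (A : zmodType) s (F F' : seq lab -> A) : agg s (fun g => F g + F' g) = agg s F + agg s F'.
Proof.
elim: s F F' => [|x s IH] F F' //=; rewrite -big_split; apply: eq_bigr => i _.
by rewrite IH mulrzDl.
Qed.

Lemma agg_raddf (A B : zmodType) (c : {additive A -> B}) s (F : seq lab -> A) : c (agg s F) = agg s (fun g => c (F g)).
Proof.
elim: s F => [|x s IH] F //=; rewrite raddf_sum; apply: eq_bigr => i _.
by rewrite raddfMz IH.
Qed.

Lemma agg_relab (A : zmodType) f s (F : seq lab -> A) : agg (map f s) F = agg s (fun g => F (relab f g)).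
Proof. by elim: s F => [|x s IH] F //=; apply: eq_bigr => i _; rewrite IH. Qed.

Lemma agg_iota (A : zmodType) s (F : seq lab -> A) : stable F -> sorted ltn s -> agg s F = agg (iota 0 (size s)) F.
Proof.
move=> stF ss; rewrite -{1}(mkseq_nth 0%N s) /mkseq agg_relab; apply: eq_agg => g gs.
apply: stF; rewrite gs ?iota_uniq // => x y; rewrite !mem_iota !add0n /= => xs ys.
have mon : {in gtn (size s) &, {homo nth 0%N s : i j / (i < j)%N >-> (i < j)%N}}.
  exact: (sorted_ltn_nth ltn_trans).
case: (ltngtP x y) => xy; [by rewrite mon| |by rewrite xy ltnn].
by apply: negbTE; rewrite -leqNgt ltnW // mon.
Qed.

Lemma agg_split_sum (A : zmodType) s (G : nat -> seq lab -> A) (k : seq lab -> int) :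
  agg s (fun g => split_sum g (fun h h' => G (size h) h' *~ k h)) =
  split_sum s (fun t t' => agg t' (G (size t)) *~ agg t k).
Proof.
elim: s G k => [|x s IH] G k //=.
pose G1 m h := G m.+1 h; pose k1 i h := k ((x, i) :: h).
pose G2 i m h := G m ((x, i) :: h).
rewrite [LHS](eq_bigr (fun i => split_sum s (fun t t' => agg t' (G1 (size t)) *~ agg t (k1 i) *~ sgn i) +
  split_sum s (fun t t' => agg t' (G2 i (size t)) *~ agg t k *~ sgn i))); last first.
  by move=> i _; rewrite aggD (IH G1 (k1 i)) (IH (G2 i) k) mulrzDl !split_sum_mulrz.
rewrite big_split /= !sum_split_sum; congr (_ + _); apply: eq_split_sum => t t'.
  by rewrite mulrz_sumr; apply: eq_bigr => i _; rewrite mulrzz mulrzA.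
by rewrite /= mulrz_suml; apply: eq_bigr => i _; rewrite -!mulrzA mulrC.
Qed.

Lemma agg_head_split_sum (A : zmodType) s y (G : nat -> seq lab -> A) (k : seq lab -> int) :
  agg (y :: s) (fun g => if g is x :: g' then
     split_sum g' (fun h h' => G (size h) h' *~ k (x :: h)) else 0) =
  split_sum s (fun t t' => agg t' (G (size t)) *~ agg (y :: t) k).
Proof.
rewrite /=; rewrite [LHS](eq_bigr (fun i => split_sum s (fun t t' => agg t' (G (size t)) *~
   agg t (fun h => k ((y, i) :: h)) *~ sgn i))); last first.
  by move=> i _; rewrite (agg_split_sum s G (fun h => k ((y, i) :: h))) split_sum_mulrz.
rewrite sum_split_sum; apply: eq_split_sum => t t'.
by rewrite mulrz_sumr; apply: eq_bigr => i _; rewrite mulrzz mulrzA.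
Qed.

(** By stability each factor depends only on its number of labels. Label 0 always belongs to the
    cycle, and ['C(m, r)] counts the choices of the [r] labels that accompany it. *)
Lemma agg_head_binom (A : zmodType) m (G : nat -> seq lab -> A) (k : seq lab -> int) :
  (forall r, stable (G r)) -> stable k ->
  agg (iota 0 m.+1) (fun g => if g is x :: g' then
     split_sum g' (fun h h' => G (size h) h' *~ k (x :: h)) else 0) =
  \sum_(r < m.+1) (agg (iota 0 (m - r)) (G r) *~ agg (iota 0 r.+1) k) *+ 'C(m, r).
Proof.
move=> sG sk; rewrite -[iota 0 _]/(0%N :: iota 1 m) agg_head_split_sum.
pose Phi r := agg (iota 0 (m - r)) (G r) *~ agg (iota 0 r.+1) k.
rewrite (@eq_split_sum_sub _ _ _ _ (fun t t' => Phi (size t))); last first.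
  move=> h h' hh hs hs'; have := perm_size hh; rewrite size_cat size_iota => mE.
  rewrite (agg_iota (sG _)); last by apply: subseq_sorted hs' (iota_ltn_sorted _ _); exact: ltn_trans.
  rewrite (agg_iota sk) /=; first by rewrite /Phi -mE addKn.
  rewrite path_sortedE; last exact: ltn_trans.
  rewrite (subseq_sorted _ hs (iota_ltn_sorted _ _)) ?andbT; last exact: ltn_trans.
  by apply/allP => x /(mem_subseq hs); rewrite mem_iota => /andP[].
by rewrite split_sum_size size_iota.
Qed.

End Agg.

Lemma pairwise_index (T : eqType) (s : seq T) : uniq s ->
  pairwise (fun x y => index x s < index y s)%N s.
Proof.
move=> us; case: s us => [//|x0 s] us; set t := x0 :: s in us *.
by apply/(pairwiseP x0) => i j si sj ij; rewrite !index_uniq.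
Qed.

Lemma map_index_iota (T : eqType) (s : seq T) : uniq s -> [seq index x s | x <- s] = iota 0 (size s).
Proof.
case: s => [//|x0 s] us; set t := x0 :: s in us *.
apply: (@eq_from_nth _ 0%N); rewrite size_map ?size_iota // => i si.
by rewrite (nth_map x0) // index_uniq // nth_iota.
Qed.

(** * Cablings with labelled copies *)

Section LabelledWords.
Context (D : gauss).
Notation n := (narrows D).
Notation lab := (nat * 'I_n)%type.

Lemma gword_uniq : uniq (gword D).
Proof. by rewrite (perm_uniq (gwordP D)) enum_uniq. Qed.

Lemma mem_gword x : x \in gword D.
Proof. by rewrite (perm_mem (gwordP D)) mem_enum. Qed.

Lemma position_inj (x y : 'I_n * bool) : position x = position y -> x = y.
Proof. by move=> xy; rewrite -(nth_index x (mem_gword x)) -/(position x) xy nth_index ?mem_gword. Qed.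

Definition lword (g : seq lab) : word lab :=
  flatten [seq [seq (a, x.2) | a <- g & a.2 == x.1] | x <- gword D].

Definition cword g : word nat := relabel fst (lword g).

Definition ltp : rel (lab * bool) := fun x y =>
  (position (x.1.2, x.2) < position (y.1.2, y.2))%N ||
  ((x.1.2, x.2) == (y.1.2, y.2)) && (x.1.1 < y.1.1)%N.

Lemma ltp_trans : transitive ltp.
Proof.
move=> [[b j] f] [[a i] e] [[c k] h]; rewrite /ltp /= => /orP[ij|/andP[/eqP[-> ->] ab]].
  by move=> /orP[jk|/andP[/eqP[<- <-] _]]; rewrite ?ij ?(ltn_trans ij jk).
by move=> /orP[-> //|/andP[/eqP[<- <-] bc]]; rewrite eqxx (ltn_trans ab bc) orbT.
Qed.

Lemma ltp_irr : irreflexive ltp.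
Proof. by move=> x; rewrite /ltp !ltnn andbF. Qed.

Lemma mem_lword g a e : ((a, e) \in lword g) = (a \in g).
Proof.
apply/flatten_mapP/idP => [[x _ /mapP[b + [-> _]]]|ag]; first by rewrite mem_filter => /andP[].
by exists (a.2, e); rewrite ?mem_gword //; apply/mapP; exists a; rewrite // mem_filter eqxx.
Qed.

Lemma mem_cword g a e : ((a, e) \in cword g) = (a \in unzip1 g).
Proof.
apply/mapP/mapP => [[[b f] bg [-> _]]|[b bg ->]]; first by exists b; rewrite // -(mem_lword g b f).
by exists (b, e); rewrite // mem_lword.
Qed.

Lemma sorted_lword g : sorted ltn (unzip1 g) -> sorted ltp (lword g).
Proof.
rewrite (sorted_pairwise ltn_trans) (sorted_pairwise ltp_trans) /unzip1 pairwise_map => sg.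
have := pairwise_index gword_uniq; rewrite /lword.
have gen s : pairwise (fun x y => position x < position y)%N s ->
    pairwise ltp (flatten [seq [seq (a, x.2) | a <- g & a.2 == x.1] | x <- s]); last exact: gen.
elim: s => //= -[i e] s IH /andP[/allP xs ps]; rewrite pairwise_cat IH // andbT.
apply/andP; split.
  apply/allrelP => u v /mapP[a + ->] /flatten_mapP[y ys /mapP[b + ->]].
  rewrite !mem_filter => /andP[/eqP ai _] /andP[/eqP bj _] /=.
  by rewrite /ltp /= ai bj -surjective_pairing (xs _ ys).
rewrite pairwise_map; apply: (@sub_in_pairwise _ [pred a | a.2 == i] (relpre fst ltn)).
- move=> a b; rewrite !inE => /eqP ai /eqP bi /= ab.
  by rewrite /ltp /= ai bi eqxx ab orbT.
- exact: filter_all.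
- exact: pairwise_filter.
Qed.

Lemma uniq_lword g : sorted ltn (unzip1 g) -> uniq (lword g).
Proof. by move=> /sorted_lword; apply: sorted_uniq; [exact: ltp_trans|exact: ltp_irr]. Qed.

Lemma arrow_lword g : sorted ltn (unzip1 g) -> arrow_word (lword g).
Proof.
move=> sg; rewrite /arrow_word uniq_lword //; apply/allP => -[a e] /=.
by rewrite !mem_lword.
Qed.

Lemma label_inj (g : seq lab) a b : uniq (unzip1 g : seq nat) -> a \in g -> b \in g -> a.1 = b.1 -> a = b.
Proof.
move=> ug ag bg ab; have sz : size (unzip1 g) = size g by rewrite size_map.
rewrite -(nth_index a ag) -(nth_index a bg); congr nth.
apply/eqP; rewrite -(nth_uniq 0%N _ _ ug) ?sz ?index_mem //.
by rewrite !(nth_map a) ?index_mem // !nth_index // ab.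
Qed.

Lemma sorted_labels_uniq (g : seq lab) : sorted ltn (unzip1 g) -> uniq (unzip1 g : seq nat).
Proof. by apply: sorted_uniq; [exact: ltn_trans|exact: ltnn]. Qed.

Lemma arrow_cword g : sorted ltn (unzip1 g) -> arrow_word (cword g).
Proof.
move=> sg; have ug := sorted_labels_uniq sg; rewrite /arrow_word map_inj_in_uniq.
  rewrite uniq_lword //=; apply/allP => -[a e]; rewrite mem_cword /=.
  by rewrite mem_cword.
move=> [a e] [b f]; rewrite !mem_lword => ag bg [ab ->].
by rewrite (label_inj ug ag bg ab).
Qed.

Lemma dg_lword g : sorted ltn (unzip1 g) -> dg (cword g) = dg (lword g).
Proof.
move=> sg; apply: dg_relabel_in; first exact: arrow_lword.
move=> [a e] [b f]; rewrite !mem_lword; exact: label_inj (sorted_labels_uniq sg).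
Qed.

(** The entries of [nmx (cword g)], computed without [g] from the order of the endpoints. The
    diagonal is set to 0, as [dmx_cycles] requires; cycles through distinct arrows never see it. *)
Definition NN (a b : lab) : int :=
  if a.1 == b.1 then 0 else (ltp (tl a) (hd b))%:Z - (ltp (hd a) (hd b))%:Z.

Lemma index_cword g x y : sorted ltn (unzip1 g) -> x.1 \in g -> y.1 \in g ->
  (index (x.1.1, x.2) (cword g) < index (y.1.1, y.2) (cword g))%N = ltp x y.
Proof.
case: x y => [a e] [b f] /= sg ag bg.
have ix c h : c \in g -> index (c.1, h) (cword g) = index (c, h) (lword g).
  move=> cg; rewrite -[(c.1, h)]/((fun z : lab * bool => (z.1.1, z.2)) (c, h)).
  apply: index_map_in => -[c' h']; rewrite mem_lword => cg' [] cc -> /=.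
  by rewrite (label_inj (sorted_labels_uniq sg) cg' cg cc).
have srt := sorted_ltn_index ltp_trans (sorted_lword sg).
have aw : (a, e) \in lword g by rewrite mem_lword.
have bw : (b, f) \in lword g by rewrite mem_lword.
rewrite !ix //; apply/idP/idP => [/srt -> //|ab].
rewrite ltnNge leq_eqVlt; apply/negP => /orP[/eqP E|/srt ba].
  have ba : (b, f) = (a, e) by rewrite -(nth_index (a, e) aw) -E nth_index.
  by move: ab; rewrite ba ltp_irr.
by have := ltp_trans ab (ba bw aw); rewrite ltp_irr.
Qed.

Lemma nmx_cword g a b : sorted ltn (unzip1 g) -> a \in g -> b \in g -> a.1 != b.1 ->
  nmx (cword g) a.1 b.1 = NN a b.
Proof.
move=> sg ag bg ab; rewrite /nmx /NN (negbTE ab).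
by rewrite (@index_cword g (tl a) (hd b)) // (@index_cword g (hd a) (hd b)).
Qed.

Lemma sub_cword g h : uniq (unzip1 g) -> subseq h g -> sub_word (cword g) (unzip1 h) = cword h.
Proof.
move=> ug hg; have uug : uniq g by apply: map_uniq ug.
have hE : h = [seq a <- g | a.1 \in unzip1 h].
  rewrite {1}(subseq_uniqP uug hg); apply: eq_in_filter => a ag.
  apply/idP/mapP => [ah|[b bh ab]]; first by exists a.
  by rewrite (label_inj ug ag (mem_subseq hg bh) ab).
rewrite {2}hE /sub_word /restrict /cword /relabel filter_map /lword filter_flatten.
congr (map _ (flatten _)); rewrite -map_comp; apply: eq_map => x /=.
by rewrite filter_map -!filter_predI; congr map; apply: eq_filter => a /=; rewrite andbC.
Qed.

Lemma stable_dg : stable (fun g => if sorted ltn (unzip1 g) then dg (cword g) else 0).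
Proof.
move=> f g ug fm.
have finj : {in unzip1 g &, injective f}.
  move=> x y xg yg fxy; have := fm _ _ xg yg; have := fm _ _ yg xg; rewrite fxy ltnn.
  by case: ltngtP.
have -> : cword (relab f g) = relabel f (cword g).
  rewrite /cword /relabel /lword -!map_comp !map_flatten -!map_comp; congr flatten.
  apply: eq_map => x /=; rewrite -!map_comp /relab filter_map -!map_comp.
  by apply: eq_map => a.
have -> : sorted ltn (unzip1 (relab f g)) = sorted ltn (unzip1 g).
  by rewrite unzip1_relab sorted_map; apply: (@eq_in_sorted _ (mem (unzip1 g))) => //; apply/allP.
case: ifP => // sg; apply: dg_relabel_in; first exact: arrow_cword.
by move=> [x e] [y h]; rewrite !mem_cword => xg yg; apply: finj.
Qed.

Lemma NN_relab f g : uniq (unzip1 g) -> {in unzip1 g &, {mono f : x y / (x < y)%N}} ->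
  {in g &, forall a b, NN (f a.1, a.2) (f b.1, b.2) = NN a b}.
Proof.
move=> ug fm a b ag bg; have a1 := map_f fst ag; have b1 := map_f fst bg.
rewrite /NN /ltp /= fm //; congr (if _ then _ else _).
by have := fm _ _ a1 b1; have := fm _ _ b1 a1; case: (ltngtP a.1 b.1) => ab;
   case: (ltngtP (f a.1) (f b.1)) => fab.
Qed.

Lemma stable_cyc : stable (fun g => if g is x :: h then
  (-1) ^+ (size h).+1 * cyclesum NN x h else 0).
Proof.
move=> f [//|x h] ug fm; rewrite /= size_map; congr (_ * _).
apply: (@cyclesum_map _ _ (fun a : lab => (f a.1, a.2))); first exact: map_uniq ug.
by move=> a b ag bg _; apply: (NN_relab ug fm).
Qed.

Lemma stable_dmx : stable (fun g => if g is x :: h then dmx NN x g g else 1).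
Proof.
move=> f [//|x h] ug fm; rewrite /dmx /= size_map; congr (\det _).
apply/matrixP => i j; rewrite !mxE.
rewrite -[_ :: _]/(map (fun a : lab => (f a.1, a.2)) (x :: h)) !(nth_map x) //.
by apply: (NN_relab ug fm); apply: mem_nth.
Qed.

Lemma cword_rec x g : sorted ltn (unzip1 (x :: g)) ->
  cls (dg (cword (x :: g))) = cls (D_A * dg (cword g)) +
    split_sum g (fun h h' => cls (wheel (size h).+1 * dg (cword h')) *~
      ((-1) ^+ (size h).+1 * cyclesum NN x h)).
Proof.
move=> sg; have ug := sorted_labels_uniq sg.
have ugg : uniq (x :: g) by apply: map_uniq ug.
apply: (etrans (@cls_rec _ x.1 (unzip1 g) (arrow_cword sg) _ _)).
- exact: ug.
- by move=> a; rewrite mem_cword.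
rewrite (@sub_cword (x :: g) g) ?subseq_cons //; apply: (congr1 (fun z => _ + z)).
rewrite split_sum_map; apply: eq_split_sum_sub => h h' _ hs hs'.
rewrite (@sub_cword (x :: g) h') ?(subseq_trans hs') ?subseq_cons // size_map.
congr (cls _ *~ (_ * _)); apply: cyclesum_map.
  by apply: subseq_uniq ugg; rewrite /= eqxx.
move=> a b ah bh ab.
have sub : {subset x :: h <= x :: g}.
  by apply: mem_subseq; rewrite /= eqxx.
rewrite nmx_cword ?sub //; apply: contraNneq ab => /(label_inj ug (sub _ ah) (sub _ bh)).
by move=> ->.
Qed.

End LabelledWords.

Lemma mul_agg (n : nat) (sgn : 'I_n -> int) (R : pzRingType) (c : R) s (F : seq (nat * 'I_n) -> R) :
  c * agg sgn s F = agg sgn s (fun g => c * F g).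
Proof.
elim: s F => [|x s IH] F //=; rewrite mulr_sumr; apply: eq_bigr => i _.
by rewrite -IH mulrzAr.
Qed.

(** * Recursions for Z and for the determinants *)

Section Recursions.
Context (D : gauss).
Notation n := (narrows D).
Notation lab := (nat * 'I_n)%type.

(** This is m! times the part of degree [m] of [Zinv] ([Zsum_Zinv]), with no factorials left inside
    the sum. *)
Definition Zsum m : free_alg := agg (@sign D) (iota 0 m) (fun g => dg (cword g)).

Definition Asum m : int :=
  agg (@sign D) (iota 0 m) (fun g => if g is x :: h then dmx (@NN D) x g g else 1).

(** The weight of all cycles through [r.+1] labelled copies: it multiplies the wheel with [r.+1]
    spokes in [Zsum_rec] and the smaller determinants in [Asum_rec]. *)
Definition Ksum r : int := agg (@sign D) (iota 0 r.+1)
  (fun g => if g is x :: h then (-1) ^+ (size h).+1 * cyclesum (@NN D) x h else 0).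

Lemma Ksum0 : Ksum 0 = 0.
Proof.
rewrite /Ksum /=; apply: big1 => i _.
by rewrite cyclesum_nil mulr0 mul0rz.
Qed.

Let sdg (g : seq lab) := if sorted ltn (unzip1 g) then dg (cword g) else 0.

Lemma Zsum_sdg m : Zsum m = agg (@sign D) (iota 0 m) sdg.
Proof.
by apply: eq_agg => g gs; rewrite /sdg gs iota_ltn_sorted.
Qed.

Lemma cls_mul_Zsum c m : cls (c * Zsum m) = agg (@sign D) (iota 0 m) (fun g => cls (c * sdg g)).
Proof. by rewrite Zsum_sdg mul_agg agg_raddf. Qed.

Lemma Zsum_rec m : cls (Zsum m.+1) = cls (D_A * Zsum m) *~ sl D +
  \sum_(r < m.+1) (cls (wheel r.+1 * Zsum (m - r)) *~ Ksum r) *+ 'C(m, r).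
Proof.
rewrite {1}/Zsum agg_raddf.
rewrite (@eq_agg _ _ _ _ _ (fun g => (if g is x :: g' then cls (D_A * sdg g') else 0) +
  (if g is x :: g' then split_sum g' (fun h h' => cls (wheel (size h).+1 * sdg h') *~
     ((-1) ^+ (size h).+1 * cyclesum (@NN D) x h)) else 0))); last first.
  move=> [//|x g] gs; have sg : sorted ltn (unzip1 (x :: g)) by rewrite gs iota_ltn_sorted.
  apply: (etrans (cword_rec sg)).
  have sh h : subseq h g -> sdg h = dg (cword h).
    move=> hg; rewrite /sdg (subseq_sorted ltn_trans (map_subseq _ hg)) //.
    by rewrite (subseq_sorted ltn_trans _ sg) // subseq_cons.
  rewrite (sh g (subseq_refl g)); apply: (congr1 (fun z => _ + z)).
  by apply: eq_split_sum_sub => h h' _ _ hs'; rewrite (sh h' hs').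
rewrite aggD; congr (_ + _).
  rewrite -[iota 0 _]/(0%N :: iota 1 m) /= -mulrz_sumr; congr (_ *~ _).
  rewrite (cls_mul_Zsum D_A m) (@agg_iota _ (@sign D) _ (iota 1 m)); first by rewrite size_iota.
  - by move=> f g ug fm; rewrite /sdg (stable_dg ug fm).
  - exact: iota_ltn_sorted.
rewrite (@agg_head_binom _ _ _ _ (fun r h' => cls (wheel r.+1 * sdg h'))
  (fun g => if g is x :: h then (-1) ^+ (size h).+1 * cyclesum (@NN D) x h else 0)).
- by apply: eq_bigr => r _; rewrite (cls_mul_Zsum (wheel r.+1) (m - r)).
- by move=> r f g ug fm; rewrite /sdg (stable_dg ug fm).
- exact: stable_cyc.
Qed.

Let dm (g : seq lab) : int := if g is x :: h then dmx (@NN D) x g g else 1.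

Lemma Asum_rec m : Asum m.+1 = - \sum_(r < m.+1) (Asum (m - r) * Ksum r) *+ 'C(m, r).
Proof.
rewrite {1}/Asum.
(* [dmx_cycles] carries (-1)^(size h) and [Ksum] one sign more, hence the factor -1. *)
rewrite (@eq_agg _ _ _ _ _ (fun g => -1 * (if g is x :: g' then split_sum g' (fun h h' =>
    dm h' *~ ((-1) ^+ (size h).+1 * cyclesum (@NN D) x h)) else 0))); last first.
  move=> [//|x g] gs.
  rewrite dmx_cycles; last by rewrite /NN eqxx.
  rewrite mulr_split_sum; apply: eq_split_sum => h h'.
  rewrite exprS !mulN1r mulrzz mulNr mulrN opprK; congr (_ * _).
  case: h' => [|y h'] /=; first by rewrite /dmx det_mx00.
  rewrite /dmx; congr (\det _); apply/matrixP => i j; rewrite !mxE.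
  by congr (NN _ _); apply: set_nth_default.
rewrite -mul_agg mulN1r; congr (- _).
rewrite (@agg_head_binom _ _ _ _ (fun r h' => dm h')
  (fun g => if g is x :: h then (-1) ^+ (size h).+1 * cyclesum (@NN D) x h else 0)).
- by apply: eq_bigr => r _; rewrite mulrzz.
- by move=> r; exact: stable_dmx.
- exact: stable_cyc.
Qed.

End Recursions.

(** * From labelled sequences to multiplicities *)

Section Counts.
Context (n : nat) (sgn : 'I_n -> int) (V : lmodType rat) (B : nat).
Notation lab := (nat * 'I_n)%type.
Notation mult := {ffun 'I_n -> nat}.
Notation bmult := {ffun 'I_n -> 'I_B.+1}.
Implicit Types (Phi : mult -> V) (k : bmult) (i : 'I_n).

Definition counts (g : seq lab) : mult := [ffun i => count_mem i (unzip2 g)].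

Definition bval k : mult := [ffun i => k i : nat].
Definition weight k : rat := \prod_i ((sgn i)%:~R ^+ k i / (k i)`!%:R).
(** The bound [B] makes the multiplicities a finite type; it is harmless as soon as it is at least
    [N]. *)
Definition msum N Phi : V := \sum_(k : bmult | (\sum_i (k i : nat))%N == N) weight k *: Phi (bval k).
Definition incr i (f : mult) : mult := [ffun j => (f j + (j == i))%N].

Lemma fact_unit (m : nat) : (m`!%:R : rat) != 0.
Proof. by rewrite pnatr_eq0 -lt0n fact_gt0. Qed.

Lemma msum_step N i Phi : (N < B)%N ->
  \sum_(k : bmult | (\sum_j (k j : nat))%N == N.+1) ((k i)%:R * weight k) *: Phi (bval k) =
  (sgn i)%:~R *: msum N (fun f => Phi (incr i f)).
Proof.
move=> NB; rewrite (bigID (fun k : bmult => k i == 0 :> nat)) /= big1 ?add0r; last first.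
  by move=> k /andP[_ /eqP ->]; rewrite mul0r scale0r.
(* [up] and [down] match the multiplicities of total [N], which stay in range as [N < B], with those
   of total [N.+1] that contain [i]. The weights agree because k s^k / k! = s s^(k-1) / (k-1)!. *)
pose up k : bmult := [ffun j => inord (k j + (j == i))].
pose down k : bmult := [ffun j => inord (k j - (j == i))].
have kN k M j : (\sum_j (k j : nat))%N == M -> (k j <= M)%N.
  by move=> /eqP <-; rewrite (bigD1 j) //= leq_addr.
have upE k j : (\sum_j (k j : nat))%N == N -> up k j = (k j + (j == i))%N :> nat.
  move=> /kN kj; rewrite ffunE inordK // ltnS (leq_trans _ NB) //.
  by rewrite (leq_trans (leq_add (kj j) (leq_b1 _))) ?addn1.
have downE k j : down k j = (k j - (j == i))%N :> nat.
  by rewrite ffunE inordK // (leq_ltn_trans (leq_subr _ _)).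
have sumi : (\sum_j (j == i) = 1)%N.
  by rewrite (bigD1 i) //= eqxx big1 // => j /negbTE ->.
rewrite (reindex_onto up down) /=; last first.
  move=> k /andP[kM k0]; apply/ffunP => j; apply: val_inj; rewrite {1}/up ffunE /= inordK downE.
    by rewrite subnK //; case: eqP => // ->; rewrite lt0n.
  rewrite ltnS subnK; first by rewrite -ltnS.
  by case: eqP => // ->; rewrite lt0n.
rewrite /msum scaler_sumr; apply: eq_big => [k|k /andP[/andP[kN1 kp] /eqP ku]].
  apply/idP/idP => [/andP[/andP[/eqP kM k0] /eqP ku]|kM].
    have kE j : k j = (up k j - (j == i))%N :> nat by rewrite -{1}ku downE.
    apply/eqP; rewrite (eq_bigr _ (fun j _ => kE j)).
    rewrite sumnB ?kM ?sumi ?subn1 // => j _; case: eqP => // ->.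
    by rewrite lt0n.
  apply/andP; split.
    rewrite (eq_bigr _ (fun j _ => upE k j kM)) big_split /=. rewrite sumi (eqP kM) addn1 eqxx /=.
    by rewrite upE // eqxx addn1.
  by apply/eqP/ffunP => j; apply: val_inj; rewrite /= downE upE // addnK.
have kM : (\sum_j (k j : nat))%N == N.
  have kE j : k j = (up k j - (j == i))%N :> nat by rewrite -{1}ku downE.
  rewrite (eq_bigr _ (fun j _ => kE j)) sumnB; first by rewrite (eqP kN1) sumi subn1.
  by move=> j _; case: eqP => // ->; rewrite lt0n.
rewrite scalerA; congr (_ *: Phi _); last first.
  by apply/ffunP => j; rewrite [LHS]ffunE upE // [RHS]ffunE ffunE.
rewrite /weight (bigD1 i) //= [in RHS](bigD1 i) //= upE // eqxx addn1 exprS factS.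
rewrite (eq_bigr (fun j => (sgn j)%:~R ^+ k j / (k j)`!%:R)); last first.
  by move=> j /negbTE ji; rewrite upE // ji addn0.
rewrite !mulrA; congr (_ * _); rewrite natrM; field.
by rewrite fact_unit /= nat1r pnatr_eq0.
Qed.

Lemma msum_euler N Phi : (N < B)%N ->
  N.+1%:R *: msum N.+1 Phi = \sum_i (sgn i)%:~R *: msum N (fun f => Phi (incr i f)).
Proof.
move=> NB; rewrite -(eq_bigr _ (fun i _ => msum_step i Phi NB)) exchange_big /=.
rewrite scaler_sumr; apply: eq_bigr => k /eqP kN.
rewrite -scaler_suml scalerA -mulr_suml -natr_sum; congr (_%:R * _ *: _).
by rewrite kN.
Qed.

Lemma msum0 Phi : msum 0 Phi = Phi [ffun=> 0%N].
Proof.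
rewrite /msum (big_pred1 [ffun=> ord0]) => [|k].
  have -> : bval [ffun=> ord0] = [ffun=> 0%N] by apply/ffunP => i; rewrite !ffunE.
  by rewrite /weight big1 ?scale1r // => i _; rewrite ffunE expr0 fact0 divr1.
rewrite sum_nat_eq0; apply/forallP/eqP => [k0|-> i]; last by rewrite ffunE.
by apply/ffunP => i; apply: val_inj; rewrite ffunE /=; apply/eqP/k0.
Qed.

(** A multiplicity k of total m comes from m! / prod k_i! sequences. The proof adds one label at a
    time and uses [msum_euler]. *)
Lemma agg_counts s Phi : (size s <= B)%N ->
  agg sgn s (fun g => Phi (counts g)) = (size s)`!%:R *: msum (size s) Phi.
Proof.
elim: s Phi => [|x s IH] Phi /= sB.
  by rewrite msum0 fact0 scale1r; congr Phi; apply/ffunP => i; rewrite !ffunE.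
rewrite factS mulnC natrM -scalerA msum_euler // scaler_sumr; apply: eq_bigr => i _.
rewrite (@eq_agg _ _ _ _ _ (fun g => Phi (incr i (counts g)))); last first.
  move=> g _; congr Phi; apply/ffunP => j; rewrite !ffunE /= addnC eq_sym.
  by case: eqP => // ->.
by rewrite (IH (fun f => Phi (incr i f))) ?(ltnW sB) // -scaler_int !scalerA mulrC.
Qed.

End Counts.

Section Cable.
Context (D : gauss).
Notation n := (narrows D).
Notation lab := (nat * 'I_n)%type.

Lemma dg_cable (g : seq lab) : sorted ltn (unzip1 g) -> dg (cword g) = dg (cable (counts g)).
Proof.
move=> sg; have ug : uniq g := map_uniq (sorted_labels_uniq sg).
rewrite dg_lword //.
(* [cable] numbers the copies of each arrow from 0, so a label is replaced by its rank among the
   copies of its arrow. *)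
pose f (a : lab) := (a.2, index a [seq b <- g | b.2 == a.2]).
rewrite -(@dg_relabel_in _ _ f) ?arrow_lword //; last first.
  move=> [a e] [b h]; rewrite !mem_lword /= => ag bg [ab].
  rewrite ab => iab.
  have bb : b \in [seq b0 <- g | b0.2 == b.2] by rewrite mem_filter eqxx.
  have aa : a \in [seq b0 <- g | b0.2 == b.2] by rewrite mem_filter ab eqxx.
  by rewrite -(nth_index a aa) iab nth_index.
congr dg; rewrite /relabel /lword /cable map_flatten -map_comp; congr flatten.
apply: eq_map => -[i e] /=; rewrite -map_comp ffunE.
have -> : count_mem i (unzip2 g) = size [seq a <- g | a.2 == i].
  by rewrite size_filter count_map.
rewrite -map_index_iota ?filter_uniq // -map_comp.
by apply/eq_in_map => a; rewrite mem_filter => /andP[/eqP ai _]; rewrite /= /f ai.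
Qed.

Lemma Zsum_Zinv m : Zsum D m = m`!%:R *: Zinv D m.
Proof.
have -> : Zsum D m = agg (@sign D) (iota 0 m) (fun g => dg (cable (counts g))).
  by apply: eq_agg => g gs; apply: dg_cable; rewrite gs iota_ltn_sorted.
have := @agg_counts _ (@sign D) free_alg m (iota 0 m) (fun f => dg (cable f)).
rewrite size_iota => /(_ (leqnn m)) H; apply: (etrans H).
apply: (congr1 (fun z => _ *: z)); apply: eq_bigr => k _.
rewrite (_ : cable (bval k) = cable (fun i => k i)) //.
by congr flatten; apply: eq_map => x; rewrite ffunE.
Qed.

End Cable.

(** * Determinants with parallel arrows *)

Section ColumnDet.
Context (T : eqType).
Implicit Types (x : T) (rs s t : seq T) (cs : seq (T -> int)) (f : T -> int).

(* Columns are given as functions, so that they can be added and replaced. *)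
Definition dcol x0 rs cs : int :=
  \det (\matrix_(i < size rs, j < size rs) nth (fun _ => 0) cs j (nth x0 rs i)).

Lemma dmx_dcol N x0 s : dmx N x0 s s = dcol x0 s [seq N^~ y | y <- s].
Proof.
by congr (\det _); apply/matrixP => i j; rewrite !mxE (nth_map x0).
Qed.

Lemma eq_dcol x0 rs f f' cs : {in rs, f =1 f'} -> dcol x0 rs (f :: cs) = dcol x0 rs (f' :: cs).
Proof.
move=> ff; congr (\det _); apply/matrixP => i [[|j] jl]; rewrite !mxE //=.
by apply: ff; apply: mem_nth.
Qed.

Lemma dcol_add x0 x rs f f' cs :
  dcol x0 (x :: rs) ((fun y => f y + f' y) :: cs) = dcol x0 (x :: rs) (f :: cs) + dcol x0 (x :: rs) (f' :: cs).
Proof.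
rewrite /dcol -[LHS]det_tr -[X in X + _]det_tr -[X in _ + X]det_tr.
rewrite -[X in X + _]mul1r -[X in _ + X]mul1r.
apply: (@determinant_multilinear _ _ _ _ _ ord0).
- by rewrite !scale1r; apply/matrixP => i j; rewrite !mxE.
- by apply/matrixP => i j; rewrite !mxE.
- by apply/matrixP => i j; rewrite !mxE.
Qed.

Lemma dcol_dup x0 x y rs f cs : dcol x0 [:: x, y & rs] [:: f, f & cs] = 0.
Proof.
rewrite /dcol -det_tr; apply: (@determinant_alternate _ _ _ ord0 (lift ord0 ord0)) => // j.
by rewrite !mxE.
Qed.

Lemma dcol_unit x0 x rs f cs : {in rs, forall y, f y = 0} ->
  dcol x0 (x :: rs) (f :: cs) = f x * dcol x0 rs cs.
Proof.
move=> f0; rewrite /dcol (expand_det_col _ ord0) big_ord_recl big1 ?addr0.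
  rewrite mxE /= /cofactor addn0 expr0 mul1r; congr (_ * \det _).
  by apply/matrixP => i j; rewrite !mxE.
by move=> i _; rewrite mxE [X in X * _](f0 (nth x0 rs i)) ?mul0r // mem_nth.
Qed.

Lemma dmx_size N x0 s n : size s = n ->
  dmx N x0 s s = \det (\matrix_(i < n, j < n) N (nth x0 s i) (nth x0 s j)).
Proof. by move=> <-. Qed.

Lemma dmx_perm N x0 y0 s t : perm_eq s t -> dmx N x0 s s = dmx N y0 t t.
Proof.
move=> st; have sz := perm_size st.
have [p pE] := @tuple_permP _ _ s (in_tuple t) st.
rewrite (dmx_size N x0 sz) /dmx; set A := \matrix_(_, _) _; set B := \matrix_(_, _) _.
have -> : A = row_perm p (col_perm p B).
  have nE (i : 'I_(size t)) : nth x0 s i = nth y0 t (p i).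
    by rewrite pE (nth_map i) ?size_enum_ord // nth_ord_enum (tnth_nth y0).
  by apply/matrixP => i j; rewrite !mxE !nE.
rewrite row_permE col_permE !det_mulmx !det_perm mulrCA odd_permV.
by rewrite -signr_addb addbb mulr1.
Qed.

End ColumnDet.

Section CountDet.
Context (D : gauss).
Notation n := (narrows D).
Notation lab := (nat * 'I_n)%type.
Notation NN := (@NN D).
Implicit Types (a b c : lab) (g : seq lab) (i j : 'I_n).

Definition span_mx i j : int := direction i * (head_in_span i j)%:Z.

Lemma position_neq i j e f : (i, e) != (j, f) -> position (i, e) != position (j, f).
Proof. by apply: contraNneq => /position_inj ->. Qed.

Lemma span_mx_ii i : span_mx i i = 0.
Proof.
rewrite /span_mx (_ : head_in_span i i = false) ?mulr0 //; apply/negbTE; rewrite /head_in_span.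
by lia.
Qed.

Lemma NN_diff a b : a.1 != b.1 -> a.2 != b.2 -> NN a b = span_mx a.2 b.2.
Proof.
case: a b => [a i] [b j] /= ab ij; rewrite /NN /span_mx /= (negbTE ab) /ltp /=.
rewrite /tl /hd !xpair_eqE (negbTE ij) /= !orbF /direction /head_in_span /tl /hd.
have := @position_neq i i true false; have := @position_neq i j true true.
have := @position_neq i j false true; rewrite !xpair_eqE !eqxx (negbTE ij) /= => /(_ isT) + /(_ isT) + /(_ isT).
move: (position (i, true)) (position (i, false)) (position (j, true)) => x y z.
by case: (ltngtP y z); case: (ltngtP x z); case: (ltngtP x y) => //; lia.
Qed.

Lemma NN_same a b : a.1 != b.1 -> a.2 = b.2 ->
  NN a b = (direction b.2 == 1)%:Z - (a.1 < b.1)%N%:Z.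
Proof.
case: a b => [a i] [b j] /= ab <-; rewrite /NN /= (negbTE ab) /ltp /=.
rewrite /tl /hd !xpair_eqE !eqxx /= orbF ltnn /direction.
by case: ltnP.
Qed.

Lemma NN_diag a : NN a a = 0.
Proof. by rewrite /NN eqxx. Qed.

(** No copy of the same arrow in [r] has a label between those of [a] and [b], so the columns of [a]
    and [b] agree up to one entry: in row [b] for direction 1, in row [a] for direction -1.
    Splitting off this difference, plus or minus a unit column, leaves a determinant with one arrow
    less. *)
Lemma dmx_dup x0 a b r : uniq (unzip1 [:: a, b & r]) -> a.2 = b.2 -> (a.1 < b.1)%N ->
  {in r, forall c, c.2 = b.2 -> (c.1 < b.1)%N = (c.1 < a.1)%N} ->
  dmx NN x0 [:: a, b & r] [:: a, b & r] =
  if direction b.2 == 1 then - dmx NN x0 (a :: r) (a :: r) else dmx NN x0 (b :: r) (b :: r).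
Proof.
move=> ug ab1 ab gap.
have [/andP[an bn] ur] : (a.1 \notin b.1 :: unzip1 r) && (b.1 \notin unzip1 r) /\ uniq (unzip1 r).
  by move: ug => /= /andP[-> /andP[-> ->]].
have anb : a.1 != b.1 by rewrite ltn_eqF.
have bna : b.1 != a.1 by rewrite eq_sym.
have rN c : c \in r -> NN c a = NN c b.
  move=> cr; have ca : c.1 != a.1.
    by apply: contraNneq an => <-; rewrite inE (map_f fst cr) orbT.
  have cb : c.1 != b.1 by apply: contraNneq bn => <-; rewrite (map_f fst cr).
  case: (eqVneq c.2 b.2) => c2; first by rewrite !NN_same ?ab1 // gap.
  by rewrite !NN_diff ?ab1.
case: ifP => d1.
  rewrite (@dmx_perm _ _ _ x0 _ [:: b, a & r]); last by apply/seq.permP => p /=; rewrite addnCA.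
  rewrite dmx_dcol /= (@eq_dcol _ _ _ _ (fun c => NN c a + - (c == b)%:Z)); last first.
    move=> c; rewrite !inE => /or3P[/eqP ->|/eqP ->|cr].
    - by rewrite NN_diag NN_same // ab1 d1 eqxx ltnNge (ltnW ab).
    - by rewrite NN_diag NN_same // d1 ab (_ : (a == b) = false) //; apply: contraNF anb => /eqP ->.
    - rewrite rN // (_ : (c == b) = false) ?subr0 //; apply: contraNF bn => /eqP <-; exact: map_f.
  rewrite dcol_add dcol_dup add0r dcol_unit ?eqxx ?mulN1r; first by rewrite dmx_dcol.
  move=> c; rewrite inE => /predU1P[->|cr].
    by rewrite (_ : (a == b) = false) //; apply: contraNF anb => /eqP ->.
  rewrite (_ : (c == b) = false) //; apply: contraNF bn => /eqP <-; exact: map_f.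
rewrite dmx_dcol /= (@eq_dcol _ _ _ _ (fun c => NN c b + (c == a)%:Z)); last first.
  move=> c; rewrite !inE => /or3P[/eqP ->|/eqP ->|cr].
  - by rewrite NN_diag NN_same // d1 ab eqxx.
  - rewrite NN_diag NN_same // ab1 d1 ltnNge (ltnW ab) (_ : (b == a) = false) //.
    by apply: contraNF anb => /eqP ->.
  - rewrite rN // (_ : (c == a) = false) ?addr0 //; apply: contraNF an => /eqP <-.
    by rewrite inE (map_f fst cr) orbT.
rewrite dcol_add dcol_dup add0r dcol_unit ?eqxx ?mul1r; first by rewrite dmx_dcol.
move=> c cr; rewrite (_ : (c == a) = false) //; apply: contraNF an => /eqP <-.
exact: (map_f fst cr).
Qed.

(** An arrow without copies gives an identity column, which keeps the size fixed; each copy after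
    the first contributes the factor of [dmx_dup], minus the direction. *)
Definition count_mx (f : {ffun 'I_n -> nat}) : 'M[int]_n :=
  \matrix_(i, j) if f j == 0%N then (i == j)%:Z else (- direction j) ^+ (f j).-1 * span_mx i j.

Lemma det_count_incr (f : {ffun 'I_n -> nat}) j : f j != 0%N ->
  \det (count_mx (incr j f)) = - direction j * \det (count_mx f).
Proof.
move=> fj; have -> : count_mx (incr j f) =
    count_mx f *m diag_mx (\row_k if k == j then - direction j else 1).
  rewrite mul_mx_diag; apply/matrixP => i k; rewrite !mxE ffunE.
  case: (eqVneq k j) => [->|_]; last by rewrite addn0 mulr1.
  rewrite addn1 (negbTE fj) /=; case: (f j) fj => //= m _.
  by rewrite exprSr mulrAC.
rewrite det_mulmx det_diag mulrC (bigD1 j) //= big1 ?mxE ?eqxx ?mulr1 //.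
by move=> k /negbTE kj; rewrite mxE kj.
Qed.

Lemma dmx_uniq x0 g : uniq (unzip1 g) -> uniq (unzip2 g) ->
  dmx NN x0 g g = \det (count_mx (counts g)).
Proof.
move=> u1 u2; pose s := unzip2 g; pose C i j : int := if j \in s then span_mx i j else (i == j)%:Z.
have -> : dmx NN x0 g g = dmx C x0.2 s s.
  have sz : size g = size s by rewrite size_map.
  rewrite (dmx_size _ _ sz) /dmx; congr (\det _); apply/matrixP => i j; rewrite !mxE /C mem_nth //.
  rewrite /s !(nth_map x0) ?sz //; case: (eqVneq i j) => [->|ij]; first by rewrite NN_diag span_mx_ii.
  have gi (k : 'I_(size s)) : (k < size g)%N by rewrite sz.
  have gi1 (k : 'I_(size s)) : (k < size (unzip1 g))%N by move: (gi k); rewrite -(size_map fst g).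
  apply: NN_diff.
    by rewrite -!(nth_map x0 0%N fst (gi _)) (nth_uniq _ (gi1 _) (gi1 _) u1).
  by rewrite -!(nth_map x0 x0.2 snd (gi _)) (nth_uniq _ (ltn_ord i) (ltn_ord j) u2).
(* Adding arrows without copies adds identity columns, and these do not change the determinant. *)
have ext ms : uniq (ms ++ s) -> dmx C x0.2 (ms ++ s) (ms ++ s) = dmx C x0.2 s s.
  elim: ms => //= m ms IH /andP[mn /IH <-]; rewrite dmx_dcol /= dcol_unit.
    by rewrite dmx_dcol /C ifN ?eqxx ?mul1r //; apply: contraNN mn; rewrite mem_cat orbC => ->.
  move=> y ys; rewrite /C ifN; last by apply: contraNN mn; rewrite mem_cat orbC => ->.
  by rewrite (_ : (y == m) = false) //; apply: contraNF mn => /eqP <-.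
rewrite -(ext [seq j <- enum 'I_n | j \notin s]); last first.
  rewrite cat_uniq filter_uniq ?enum_uniq // u2 andbT /=; apply/hasPn => j js.
  by rewrite mem_filter negb_and negbK js.
rewrite (@dmx_perm _ _ _ x0.2 _ (enum 'I_n)); last first.
  apply: uniq_perm; rewrite ?enum_uniq //.
    rewrite cat_uniq filter_uniq ?enum_uniq // u2 andbT /=; apply/hasPn => j js.
    by rewrite mem_filter negb_and negbK js.
  by move=> j; rewrite mem_cat mem_filter mem_enum andbT; case: (j \in s).
rewrite (dmx_size _ _ (size_enum_ord n)); congr (\det _); apply/matrixP => i j.
rewrite !mxE !nth_ord_enum /C ffunE count_uniq_mem //.
by case: (j \in s) => //; rewrite expr0 mul1r.
Qed.

Lemma dmx_counts x0 g : sorted ltn (unzip1 g) -> dmx NN x0 g g = \det (count_mx (counts g)).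
Proof.
have [m] := ubnP (size g); elim: m => // m IH in g *; move=> /ltnSE gm sg.
have ug := sorted_labels_uniq sg; have uug : uniq g := map_uniq ug.
case: (boolP [forall j, count_mem j (unzip2 g) <= 1])%N => [/forallP c1|].
  apply: dmx_uniq => //; apply: count_mem_uniq => j.
  by have := c1 j; rewrite -has_pred1 has_count; case: (count _ _) => [|[]].
rewrite negb_forall => /existsP[j]; rewrite -ltnNge => cj.
have : (1 < size [seq c <- g | c.2 == j])%N.
  by rewrite size_filter; move: cj; rewrite count_map.
(* [a] and [b] are the copies of arrow [j] with the smallest labels, so all other copies lie beyond
   both, as [dmx_dup] requires. *)
case E: [seq c <- g | c.2 == j] => [|a [|b h]] // _.
have hE c : (c \in [:: a, b & h]) = (c.2 == j) && (c \in g) by rewrite -E mem_filter.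
have /andP[/eqP aj ag] : (a.2 == j) && (a \in g) by rewrite -hE mem_head.
have /andP[/eqP bj bg] : (b.2 == j) && (b \in g) by rewrite -hE !inE eqxx orbT.
have : sorted ltn (unzip1 [:: a, b & h]).
  by rewrite -E; apply: (subseq_sorted ltn_trans) sg; apply: map_subseq; apply: filter_subseq.
move=> /= /andP[ab]; rewrite path_sortedE; last exact: ltn_trans.
move=> /andP[/allP bh _].
have anb : a != b by apply: contraTneq ab => ->; rewrite ltnn.
pose r := [seq c <- g | (c != a) && (c != b)].
have pr : perm_eq g [:: a, b & r].
  apply: uniq_perm => //=.
    by rewrite !inE !mem_filter !eqxx !andbF !orbF anb /= filter_uniq.
  move=> c; rewrite !inE mem_filter; case: (eqVneq c a) => [->|_]; first by rewrite ag.
  by case: (eqVneq c b) => [->|_]; rewrite ?bg.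
have ra : perm_eq [seq c <- g | c != b] (a :: r).
  apply: uniq_perm; rewrite ?filter_uniq //=.
    by rewrite !mem_filter !eqxx /= filter_uniq.
  move=> c; rewrite !inE !mem_filter; case: (eqVneq c a) => [->|_]; first by rewrite anb ag.
  by [].
have rb : perm_eq [seq c <- g | c != a] (b :: r).
  apply: uniq_perm; rewrite ?filter_uniq //=.
    by rewrite !mem_filter !eqxx andbF /= filter_uniq.
  move=> c; rewrite !inE !mem_filter; case: (eqVneq c b) => [->|_].
    by rewrite eq_sym anb bg.
  by rewrite andbT.
have cnt c s : perm_eq [seq z <- g | z != c] (s :: r) -> s.2 = j ->
    counts g = incr j (counts [seq z <- g | z != c]) /\ counts [seq z <- g | z != c] j != 0%N.
  move=> ps sj; split.
    apply/ffunP => k; rewrite !ffunE.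
    rewrite (seq.permP (perm_map snd pr)) (seq.permP (perm_map snd ps)) /= aj bj sj eq_sym.
    by rewrite addnC addnAC eq_sym.
  by rewrite ffunE (seq.permP (perm_map snd ps)) /= sj eqxx.
have IHc c s : perm_eq [seq z <- g | z != c] (s :: r) -> s.2 = j ->
   dmx NN x0 (s :: r) (s :: r) = \det (count_mx (counts [seq z <- g | z != c])).
  move=> ps sj; rewrite -(dmx_perm _ x0 x0 ps); apply: IH.
    by rewrite (perm_size ps) (leq_trans _ gm) // (perm_size pr).
  by apply: (subseq_sorted ltn_trans) sg; apply: map_subseq; apply: filter_subseq.
rewrite (dmx_perm _ x0 x0 pr) dmx_dup ?aj ?bj //; last 2 first.
- by rewrite -(perm_uniq (perm_map fst pr)).
- move=> c; rewrite mem_filter => /andP[/andP[ca cb] cg] cj'.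
  have : c \in [:: a, b & h] by rewrite hE cj' eqxx.
  rewrite !inE (negbTE ca) (negbTE cb) /= => /(map_f fst)/bh /= bc.
  by rewrite ltnNge (ltnW bc) ltnNge (ltnW (ltn_trans ab bc)).
rewrite (IHc _ _ ra aj) (IHc _ _ rb bj).
have [Ea ca] := cnt _ _ ra aj; have [Eb cb] := cnt _ _ rb bj.
case: ifP => dj; first by rewrite Ea det_count_incr // (eqP dj) mulN1r.
rewrite Eb det_count_incr // (_ : direction j = -1) ?opprK ?mul1r //.
by move: dj; rewrite /direction; case: ifP.
Qed.

End CountDet.

Lemma ser_pow_deg1 (R : lalgType rat) (c : R) k N :
  ser_pow (ser_deg1 c) k N = if N == k then c ^+ k else 0.
Proof.
elim: k N => [|k IH] N; first by rewrite /ser_pow /= /ser1 expr0; case: (N == 0%N).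
rewrite /ser_pow iterS -/(ser_pow _ _) /ser_mul; case: N => [|N].
  by rewrite big_ord_recl big_ord0 addr0 /ser_deg1 mul0r.
rewrite big_ord_recl /= {1}/ser_deg1 /= mul0r add0r big_ord_recl /= {1}/ser_deg1 /= subSS subn0 IH.
rewrite big1 ?addr0 => [|i _]; last by rewrite /ser_deg1 /= mul0r.
by rewrite eqSS exprS; case: eqP => // _; rewrite mulr0.
Qed.

Lemma ser_exp_deg1 (R : lalgType rat) (c : R) N :
  ser_exp (ser_deg1 c) N = (N`!%:R)^-1 *: c ^+ N.
Proof.
rewrite /ser_exp big_ord_recr /= ser_pow_deg1 eqxx big1 ?add0r // => i _.
by rewrite ser_pow_deg1 gtn_eqF ?scaler0.
Qed.

(** * The Alexander polynomial at e^x *)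

Section TruncatedExp.
Context (K : nat).
Implicit Types (p q : {poly rat}) (c : rat).

(** Polynomials modulo x^K replace power series, so that determinants and substitution are
    available. *)
Definition eqc p q := forall i, (i < K)%N -> p`_i = q`_i.

Lemma eqc_refl p : eqc p p. Proof. by []. Qed.
Lemma eqc_sym p q : eqc p q -> eqc q p. Proof. by move=> pq i iK; rewrite pq. Qed.
Lemma eqc_trans p q r : eqc p q -> eqc q r -> eqc p r.
Proof. by move=> pq qr i iK; rewrite pq ?qr. Qed.

Lemma eqcD p p' q q' : eqc p p' -> eqc q q' -> eqc (p + q) (p' + q').
Proof. by move=> pp qq i iK; rewrite !coefD pp ?qq. Qed.

Lemma eqcM p p' q q' : eqc p p' -> eqc q q' -> eqc (p * q) (p' * q').
Proof.
move=> pp qq i iK; rewrite !coefM; apply: eq_bigr => j _.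
by rewrite pp ?qq // (leq_ltn_trans _ iK) ?leq_subr // -ltnS.
Qed.

Lemma eqcX p q k : eqc p q -> eqc (p ^+ k) (q ^+ k).
Proof. by move=> pq; elim: k => // k IH; rewrite !exprS; apply: eqcM. Qed.

Lemma eqc_det n (A B : 'M[{poly rat}]_n) : (forall i j, eqc (A i j) (B i j)) -> eqc (\det A) (\det B).
Proof.
move=> AB; rewrite /determinant; apply: (big_ind2 eqc) => // [*|s _]; first exact: eqcD.
apply: eqcM => //; apply: (big_ind2 eqc) => // *; exact: eqcM.
Qed.

Definition expc c : {poly rat} := \poly_(i < K) (c ^+ i / i`!%:R).

Lemma expcD c c' : eqc (expc c * expc c') (expc (c + c')).
Proof.
move=> i iK; rewrite addrC coefM coef_poly iK exprDn mulr_suml; apply: eq_bigr => -[j /= ji] _.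
have jK : (j < K)%N by rewrite (leq_ltn_trans _ iK).
rewrite !coef_poly jK (leq_ltn_trans (leq_subr _ _) iK) -mulr_natr.
rewrite -(@bin_fact i j) // !natrM.
have fn m : (m`!%:R : rat) != 0 by rewrite pnatr_eq0 -lt0n fact_gt0.
have bn : ('C(i, j)%:R : rat) != 0 by rewrite pnatr_eq0 -lt0n bin_gt0.
by field; rewrite !fn bn.
Qed.

Lemma expc0 : eqc (expc 0) 1.
Proof.
move=> i iK; rewrite coef_poly iK coef1 expr0n; case: i {iK} => [|i] /=.
  by rewrite fact0 divr1.
by rewrite mul0r.
Qed.

Lemma expcX c k : eqc (expc c ^+ k) (expc (c *+ k)).
Proof.
elim: k => [|k IH]; first by rewrite mulr0n; apply: eqc_sym expc0.
rewrite exprS mulrS; apply: eqc_trans (expcD _ _); exact: eqcM.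
Qed.

End TruncatedExp.

Section AlexanderSeries.
Context (D : gauss).
Notation n := (narrows D).

Definition exp_mx K : 'M[{poly rat}]_n := \matrix_(i, j)
  ((i == j)%:R + (head_in_span i j)%:R * (1 - expc K (- (sign j * direction j)%:~R))).

(** X times the Alexander matrix; its entries are polynomials because the exponents s d are 1 or
    -1. *)
Definition arrow_poly_mx : 'M[{poly int}]_n := \matrix_(i, j)
  ((i == j)%:R * 'X + (head_in_span i j)%:R * ('X - (if sign j * direction j == 1 then 1 else 'X^2))).

Lemma sign_dirP (j : 'I_n) : sign j * direction j = 1 \/ sign j * direction j = -1.
Proof. by rewrite /sign /direction; case: ifP; case: ifP; auto. Qed.

Lemma det_arrow_poly : tofrac (\det arrow_poly_mx) = Xfrac ^+ n * alexander D.
Proof.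
rewrite -det_map_mx -detZ /alexander; congr (\det _); apply/matrixP => i j.
have X0 : Xfrac != 0 by rewrite tofrac_eq0 polyX_eq0.
rewrite !mxE; rewrite (bigD1 j) //= big1 ?addr0; last first.
  by move=> k /negbTE kj; rewrite !mxE kj subr0 mulr0n /= ?subr0 ?mulr0.
rewrite !mxE eqxx mulr1n rmorphD !rmorphM /= !rmorph_nat rmorphB /= -/Xfrac [RHS]mulrDr.
congr (_ + _); first by rewrite mulrC.
rewrite [RHS]mulrCA; congr (_ * _); rewrite mulrBr mulr1; congr (_ - _).
case: (sign_dirP j) => ->; first by rewrite /= tofrac1 exprN1 divff.
by rewrite opprK expr1z /= tofracXn expr2.
Qed.

Definition theta K (q : {poly int}) : {poly rat} := map_poly intr q \Po expc K 1.

Lemma theta_alexander K p m : alexander D = laurent p m ->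
  eqc K (theta K p * expc K (-1) ^+ m) (\det (exp_mx K)).
Proof.
move=> ap; have X0 : Xfrac != 0 by rewrite tofrac_eq0 polyX_eq0.
pose E := expc K 1; pose E' := expc K (-1).
have EE k : eqc K (E ^+ k * E' ^+ k) 1.
  rewrite -exprMn; apply: (@eqc_trans _ _ (1 ^+ k)); last by rewrite expr1n.
  apply: eqcX; apply: eqc_trans (expcD _ _) _; rewrite subrr; exact: expc0.
(* Clearing denominators gives an identity of polynomials, into which e^x can be substituted;
   afterwards [E'] serves as the inverse of [E] modulo x^K. *)
have pE : \det arrow_poly_mx * 'X^m = p * 'X^n.
  apply/eqP; rewrite -tofrac_eq !tofracM det_arrow_poly ap /laurent !tofracXn.
  by rewrite -mulrA mulfVK ?expf_neq0 // mulrC.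
have thE q : theta K q = (comp_poly E \o map_poly intr) q by [].
have thD a b : theta K (a + b) = theta K a + theta K b by rewrite thE rmorphD.
have thB a b : theta K (a - b) = theta K a - theta K b by rewrite thE rmorphB.
have thM a b : theta K (a * b) = theta K a * theta K b by rewrite thE rmorphM.
have thXn a k : theta K (a ^+ k) = theta K a ^+ k by rewrite thE rmorphXn.
have tX : theta K 'X = E by rewrite /theta map_polyX comp_polyX.
have dE : eqc K (theta K (\det arrow_poly_mx)) (E ^+ n * \det (exp_mx K)).
  rewrite thE -det_map_mx -detZ; apply: eqc_det => i j.
  rewrite mxE [X in eqc _ X _](_ : _ = theta K (arrow_poly_mx i j)) // !mxE.
  have -> : theta K ((i == j)%:R * 'X + (head_in_span i j)%:R *
      ('X - (if sign j * direction j == 1 then 1 else 'X^2))) =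
      (i == j)%:R * E + (head_in_span i j)%:R * (E - (if sign j * direction j == 1 then 1 else E ^+ 2)).
    rewrite thD !thM thB !tX; congr (_ * _ + _ * (_ - _)).
    - by rewrite thE rmorph_nat.
    - by rewrite thE rmorph_nat.
    - by case: ifP => _; rewrite ?thXn ?tX // thE rmorph1.
  rewrite [X in eqc _ _ X]mulrDr [X in eqc _ _ (X + _)]mulrC; apply: eqcD => //.
  rewrite [X in eqc _ _ X]mulrCA; apply: eqcM => //; rewrite mulrBr mulr1; apply: eqcD => // k kK; rewrite !coefN; congr (- _); move: k kK.
  case: (sign_dirP j) => -> /=.
    by apply: eqc_sym; have := EE 1%N; rewrite !expr1; apply.
  rewrite opprK expr2; exact: eqc_refl.
apply: (@eqc_trans _ _ (theta K p * E ^+ n * E' ^+ n * E' ^+ m)).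
  rewrite -!mulrA; apply: eqcM => //; rewrite mulrA -[X in eqc _ X]mul1r; apply: eqcM => //.
  exact: eqc_sym.
have -> : theta K p * E ^+ n = theta K (\det arrow_poly_mx) * E ^+ m.
  by have := congr1 (theta K) pE; rewrite !thM !thXn tX.
rewrite [X in eqc _ X](_ : _ = theta K (\det arrow_poly_mx) * E' ^+ n * (E ^+ m * E' ^+ m)); last by ring.
rewrite -[X in eqc _ _ X]mulr1; apply: eqcM; last exact: EE.
apply: (@eqc_trans _ _ (E ^+ n * \det (exp_mx K) * E' ^+ n)); first by apply: eqcM.
rewrite mulrAC -[X in eqc _ _ X]mul1r; exact: eqcM.
Qed.

Lemma coef_theta K p m N : (N < K)%N ->
  (theta K p * expc K (-1) ^+ m)`_N = laurent_at_exp p m N.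
Proof.
move=> NK; rewrite /theta comp_polyE mulr_suml coef_sum /laurent_at_exp.
rewrite (size_map_inj_poly (@intr_inj _)) //; apply: eq_bigr => i _.
rewrite coef_map /= -scalerAl coefZ; congr (_ * _).
rewrite (eqcM (@expcX K 1 i) (@expcX K (-1) m)) // expcD // coef_poly NK ser_exp_deg1.
by rewrite mulNrn /GRing.scale /= mulrC rmorphB /= -!pmulrn.
Qed.

Definition det_weight B N : rat := msum (@sign D) B N (fun f => (\det (count_mx f))%:~R : rat^o).

Lemma exp_mx_coef B i j : exp_mx B.+1 i j = \sum_(k < B.+1)
  (((sign j)%:~R ^+ k / k`!%:R) *
   (if k == 0%N :> nat then (i == j)%:R else - (- direction j)%:~R ^+ k * (head_in_span i j)%:R))%:P * 'X^k.
Proof.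
rewrite mxE /expc poly_def [in LHS]big_ord_recl big_ord_recl /= expr0 fact0 !divr1 mul1r !expr0.
rewrite scale1r mulr1 opprD addrA subrr add0r polyC_natr; congr (_ + _).
rewrite mulrN mulr_sumr -sumrN; apply: eq_bigr => k _.
rewrite -polyC_natr -mul_polyC mulrA -polyCM -mulNr -polyCN; congr (_%:P * _).
have -> : (- (sign j * direction j)%:~R : rat) = (sign j)%:~R * (- direction j)%:~R.
  by rewrite -rmorphM mulrN rmorphN.
by rewrite /bump /= add1n exprMn; ring.
Qed.

(** Conjugation by the diagonal matrix of directions cancels the row factor of [span_mx] and
    completes (-d)^(f-1) to -(-d)^f, which is the coefficient of x^f in 1 - e^(-s d x) up to the
    weight s^f / f!. *)
Lemma count_mx_conj (f : {ffun 'I_n -> nat}) : \det (count_mx f) =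
  \det (\matrix_(i, j) if f j == 0%N then (i == j)%:R else
    - ((- direction j) ^+ f j * (head_in_span i j)%:R) : int).
Proof.
set A := \matrix_(_, _) _; pose d : 'rV[int]_n := \row_i direction i.
have dd i : direction i * direction i = 1 by rewrite /direction; case: ifP.
have -> : count_mx f = diag_mx d *m A *m diag_mx d.
  rewrite mul_mx_diag mul_diag_mx; apply/matrixP => i j; rewrite !mxE.
  case: (f j) => [|k] /=.
    by case: eqP => [->|_]; rewrite ?mulr0 ?mul0r // mulr1 dd.
  rewrite exprS /span_mx; transitivity ((- direction j) ^+ k * (direction i * (head_in_span i j)%:Z) *
    (direction j * direction j)); first by rewrite dd mulr1.
  by rewrite natz; ring.
rewrite !det_mulmx !det_diag mulrC mulrA -big_split /= big1 ?mul1r // => i _.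
by rewrite !mxE dd.
Qed.

(** The determinant is multilinear in its columns: choosing one power of x in each column, of total
    degree [N], yields the sum over multiplicities. The transpose makes the Leibniz products run
    over columns. *)
Lemma coef_exp_mx B N : (N <= B)%N -> (\det (exp_mx B.+1))`_N = det_weight B N.
Proof.
move=> NB; rewrite -det_tr /determinant.
pose c (j i : 'I_n) (k : 'I_B.+1) : rat := ((sign j)%:~R ^+ k / k`!%:R) *
   (if k == 0%N :> nat then (i == j)%:R else - (- direction j)%:~R ^+ k * (head_in_span i j)%:R).
rewrite (eq_bigr (fun s : 'S_n => \sum_(k : {ffun 'I_n -> 'I_B.+1})
   ((-1) ^+ s * \prod_j c j (s j) (k j))%:P * 'X^(\sum_j k j)%N)); last first.
  move=> s _; rewrite (eq_bigr (fun j => \sum_(k < B.+1) (c j (s j) k)%:P * 'X^k)).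
    rewrite bigA_distr_bigA /= mulr_sumr; apply: eq_bigr => k _.
    rewrite big_split /= rmorphM rmorph_prod rmorph_sign /= -mulrA; congr (_ * (_ * _)).
    exact: prodrXr.
  by move=> j _; rewrite mxE exp_mx_coef.
rewrite coef_sum (eq_bigr (fun s : 'S_n => \sum_(k : {ffun 'I_n -> 'I_B.+1} | (\sum_j k j)%N == N)
   ((-1) ^+ s * \prod_j c j (s j) (k j)))); last first.
  move=> s _; rewrite coef_sum [RHS]big_mkcond; apply: eq_bigr => k _.
  by rewrite coefCM coefXn eq_sym; case: eqP => _; rewrite ?mulr1 ?mulr0.
rewrite exchange_big /det_weight /msum; apply: eq_bigr => k _.
rewrite count_mx_conj -(det_map_mx intr) -det_tr /determinant.
have scE (x : rat) (y : rat^o) : x *: y = x * y by [].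
rewrite scE [RHS]mulr_sumr; apply: eq_bigr => s _.
rewrite /weight [RHS]mulrCA; congr (_ * _); rewrite -big_split; apply: eq_bigr => j _.
rewrite /c !mxE ffunE; congr (_ * _); case: eqP => _; first by rewrite (rmorph_nat intr).
by rewrite (rmorphN intr) (rmorphM intr) (rmorphXn intr) (rmorph_nat intr) mulNr.
Qed.

End AlexanderSeries.

(** * The Euler operator *)

Section Euler.
Context (R : lalgType rat) (V : zmodType) (q : {additive R -> V}) (C : R -> Prop).
Hypothesis scAr : forall (c : rat) (x y : R), x * (c *: y) = c *: (x * y).
Hypothesis CD : forall x y, C x -> C y -> C (x + y).
Hypothesis CM : forall x y, C x -> C y -> C (x * y).
Hypothesis CZ : forall (c : rat) x, C x -> C (c *: x).
Hypothesis C1 : C 1.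
Hypothesis qZ : forall (c : rat) x y, q x = q y -> q (c *: x) = q (c *: y).
Hypothesis qM : forall x y y', C x -> q y = q y' -> q (x * y) = q (x * y').
Hypothesis qC : forall x y, C x -> C y -> q (x * y) = q (y * x).

Implicit Types (a b c U P Q : series R) (n k : nat).

Definition euler a : series R := fun n => n%:R *: a n.
(** [C] stands for the combinations of diagrams. The map [q] is assumed compatible with products,
    and commutative, for these alone, so all coefficients are kept in [C]. *)
Definition allC a := forall n, C (a n).
Definition eqq a b := forall n, q (a n) = q (b n).

Lemma C0 : C 0. Proof. by rewrite -(scale0r 1); apply: CZ. Qed.

Lemma Csum (I : Type) (r : seq I) (P : pred I) (F : I -> R) :
  (forall i, P i -> C (F i)) -> C (\sum_(i <- r | P i) F i).
Proof. by move=> CF; apply: big_ind => //; exact: C0. Qed.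

Lemma qMC x y z : C x -> C y -> C z -> q (x * (y * z)) = q (y * (x * z)).
Proof.
move=> Cx Cy Cz; rewrite (@qM x (y * z) (z * y)) ?mulrA //; last exact: qC.
by rewrite qC // ?mulrA //; apply: CM.
Qed.

Lemma allC_mul a b : allC a -> allC b -> allC (ser_mul a b).
Proof. by move=> Ca Cb n; apply: Csum => i _; apply: CM. Qed.

Lemma allC_ser1 : allC (ser1 R).
Proof. by move=> n; rewrite /ser1; case: eqP => _; [exact: C1|exact: C0]. Qed.

Lemma allC_pow a k : allC a -> allC (ser_pow a k).
Proof.
move=> Ca; elim: k => [|k IH]; first exact: allC_ser1.
by rewrite /ser_pow iterS; apply: allC_mul.
Qed.

Lemma allC_exp a : allC a -> allC (ser_exp a).
Proof. by move=> Ca n; apply: Csum => k _; apply: CZ; apply: allC_pow. Qed.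

Lemma allC_euler a : allC a -> allC (euler a).
Proof. by move=> Ca n; apply: CZ. Qed.

Lemma euler_mul a b n : euler (ser_mul a b) n = ser_mul (euler a) b n + ser_mul a (euler b) n.
Proof.
rewrite /euler /ser_mul scaler_sumr -big_split; apply: eq_bigr => -[i /= lin] _.
by rewrite scAr -scalerAl -scalerDl -natrD subnKC.
Qed.

Lemma mul_triple a b c n : ser_mul a (ser_mul b c) n =
  \sum_(i < n.+1) \sum_(j < n.+1) (if (i + j <= n)%N then a i * (b j * c (n - (i + j))%N) else 0).
Proof.
apply: eq_bigr => i _; rewrite /ser_mul (big_ord_widen n.+1 (fun j => b j * c (n - i - j)%N)); last first.
  by rewrite ltnS leq_subr.
rewrite mulr_sumr [LHS]big_mkcond; apply: eq_bigr => j _.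
have := ltn_ord i; rewrite ltnS => il; rewrite ltnS leq_subRL // subnDA.
by [].
Qed.

Lemma mul_left_comm a b c : allC a -> allC b -> allC c ->
  eqq (ser_mul a (ser_mul b c)) (ser_mul b (ser_mul a c)).
Proof.
move=> Ca Cb Cc n; rewrite !mul_triple exchange_big !raddf_sum; apply: eq_bigr => i _.
rewrite !raddf_sum; apply: eq_bigr => j _; rewrite addnC; case: ifP => // _.
exact: qMC.
Qed.

Lemma mul_comm a b : allC a -> allC b -> eqq (ser_mul a b) (ser_mul b a).
Proof.
move=> Ca Cb n; rewrite /ser_mul (reindex_inj rev_ord_inj) !raddf_sum /=.
apply: eq_bigr => i _; rewrite subSS subKn; last by rewrite -ltnS.
exact: qC.
Qed.

Lemma eqq_mull a b b' : allC a -> eqq b b' -> eqq (ser_mul a b) (ser_mul a b').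
Proof. by move=> Ca bb n; rewrite !raddf_sum; apply: eq_bigr => i _; apply: qM. Qed.

Lemma eqq_trans a b c : eqq a b -> eqq b c -> eqq a c.
Proof. by move=> ab bc n; rewrite ab. Qed.

Lemma euler_ser1 n : euler (ser1 R) n = 0.
Proof. by rewrite /euler /ser1; case: n => [|n]; rewrite ?scale0r ?scaler0. Qed.

Lemma euler_pow U k : allC U ->
  eqq (euler (ser_pow U k.+1)) (fun n => k.+1%:R *: ser_mul (euler U) (ser_pow U k) n).
Proof.
move=> CU; elim: k => [|k IH] n.
  rewrite /ser_pow iterS [iter 0 _ _]/= euler_mul raddfD /= [X in _ + q X]big1 ?raddf0 ?addr0 ?scale1r //.
  by move=> i _; rewrite euler_ser1 mulr0.
rewrite /ser_pow iterS euler_mul raddfD /= -/(ser_pow U k.+1).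
have CE := allC_euler CU; have Ck := allC_pow k CU.
have /(_ n) -> : eqq (ser_mul U (euler (ser_pow U k.+1)))
    (fun n => k.+1%:R *: ser_mul (euler U) (ser_pow U k.+1) n).
  apply: eqq_trans (eqq_mull CU IH) _ => m.
  have -> : ser_mul U (fun n0 => k.+1%:R *: ser_mul (euler U) (ser_pow U k) n0) m =
      k.+1%:R *: ser_mul U (ser_mul (euler U) (ser_pow U k)) m.
    by rewrite /ser_mul scaler_sumr; apply: eq_bigr => i _; rewrite scAr.
  by apply: qZ; rewrite (mul_left_comm CU CE Ck) /ser_pow iterS.
by rewrite -raddfD -[X in X + _]scale1r -scalerDl nat1r.
Qed.

Lemma pow_small U k n : U 0%N = 0 -> (n < k)%N -> ser_pow U k n = 0.
Proof.
move=> U0; elim: k n => // k IH n nk; rewrite /ser_pow iterS; apply: big1 => -[[|i] /= il] _.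
  by rewrite U0 mul0r.
by rewrite -/(ser_pow U k) IH ?mulr0 //; lia.
Qed.

Lemma euler_mul_pow_small U k n : U 0%N = 0 -> (n <= k)%N -> ser_mul (euler U) (ser_pow U k) n = 0.
Proof.
move=> U0 nk; apply: big1 => -[[|i] /= il] _; first by rewrite /euler scale0r mul0r.
by rewrite pow_small ?mulr0 //; lia.
Qed.

(* The factor [euler U] has no constant term, so that the second factor may be truncated. *)
Lemma euler_mul_trunc U (f : nat -> rat) (s : series R) n : U 0%N = 0 ->
  (forall m, (m < n)%N -> s m = \sum_(k < n) f k *: ser_pow U k m) ->
  ser_mul (euler U) s n = \sum_(k < n) f k *: ser_mul (euler U) (ser_pow U k) n.
Proof.
move=> U0 sE; transitivity (\sum_(i < n.+1) \sum_(k < n) f k *: (euler U i * ser_pow U k (n - i)%N)).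
  apply: eq_bigr => -[[|i] /= il] _.
    by rewrite /euler scale0r mul0r big1 // => k _; rewrite mul0r scaler0.
  rewrite sE; last lia.
  by rewrite mulr_sumr; apply: eq_bigr => k _; rewrite scAr.
by rewrite exchange_big; apply: eq_bigr => k _; rewrite /ser_mul scaler_sumr.
Qed.

Lemma euler_exp U : allC U -> U 0%N = 0 -> eqq (euler (ser_exp U)) (ser_mul (euler U) (ser_exp U)).
Proof.
move=> CU U0 n; have fn m : (m`!%:R : rat) != 0 by rewrite pnatr_eq0 -lt0n fact_gt0.
rewrite (@euler_mul_trunc U (fun k => k`!%:R^-1) _ n U0) => [|m mn]; last first.
  rewrite /ser_exp (big_ord_widen n (fun k => k`!%:R^-1 *: ser_pow U k m)) // big_mkcond.
  by apply: eq_bigr => k _; case: ltnP => // mk; rewrite pow_small ?scaler0.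
rewrite {1}/euler /ser_exp scaler_sumr big_ord_recl.
rewrite (_ : n%:R *: _ = 0) ?add0r; last first.
  by rewrite scalerA mulrC -scalerA -/(euler _ n) euler_ser1 scaler0.
rewrite !raddf_sum; apply: eq_bigr => k _; rewrite scalerA mulrC -scalerA -/(euler _ n).
rewrite (qZ _ (euler_pow k CU n)) scalerA; congr (q (_ *: _)).
by rewrite /= /bump /= add1n factS natrM; field; rewrite fn nat1r pnatr_eq0.
Qed.

Lemma euler_exp_mul P Q : allC P -> allC Q -> P 0%N = 0 -> Q 0%N = 0 ->
  let Y := ser_mul (ser_exp P) (ser_exp Q) in
  eqq (euler Y) (fun n => ser_mul (euler P) Y n + ser_mul (euler Q) Y n).
Proof.
move=> CP CQ P0 Q0 Y n; rewrite euler_mul !raddfD /=.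
have [CEP CEQ] := (allC_exp CP, allC_exp CQ).
have [CeP CeQ] := (allC_euler CP, allC_euler CQ).
congr (_ + _).
  have CeE := allC_euler CEP.
  rewrite (mul_comm CeE CEQ) (eqq_mull CEQ (euler_exp CP P0)).
  rewrite (mul_left_comm CEQ CeP CEP); apply: (eqq_mull CeP); exact: mul_comm.
rewrite (eqq_mull CEP (euler_exp CQ Q0)); exact: mul_left_comm.
Qed.

End Euler.

(** * The logarithm *)

Section Log.
Context (a : qseries) (a0 : a 0%N = 1).
Let b : qseries := fun m => a m - ser1 rat^o m.
Let G n : qseries := fun m => \sum_(k < n) ((-1) ^+ k : rat) *: ser_pow b k m.

Let b0 : b 0%N = 0. Proof. by rewrite /b a0 subrr. Qed.

Let scA (c : rat) (x y : rat^o) : x * (c *: y) = c *: (x * y).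
Proof. exact: mulrCA. Qed.

Let ser1_mul (s : qseries) n : ser_mul (ser1 rat^o) s n = s n.
Proof.
rewrite /ser_mul big_ord_recl /= subn0 mul1r big1 ?addr0 // => i _.
by rewrite /ser1 /= mul0r.
Qed.

Lemma mul_alternating n m : ser_mul a (G n) m = ser1 rat^o m - (-1) ^+ n * ser_pow b n m.
Proof.
elim: n => [|n IH].
  by rewrite expr0 mul1r subrr; apply: big1 => i _; rewrite /G big_ord0 mulr0.
have aE i : a i = ser1 rat^o i + b i by rewrite /b addrC subrK.
transitivity (ser_mul a (G n) m + (-1) ^+ n * ser_mul a (ser_pow b n) m).
  rewrite /ser_mul [in RHS]mulr_sumr -big_split; apply: eq_bigr => i _.
  rewrite /G big_ord_recr /= [LHS]mulrDr; congr (_ + _).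
  exact: (mulrCA (a i)).
have -> : ser_mul a (ser_pow b n) m = ser_pow b n m + ser_pow b n.+1 m.
  rewrite [ser_pow b n.+1]/ser_pow iterS -[X in X + _]ser1_mul /ser_mul -big_split.
  by apply: eq_bigr => i _; rewrite aE mulrDl.
by rewrite IH exprS mulN1r mulNr opprK mulrDr addrA subrK.
Qed.

(** The Euler derivative of log a is that of [b] times the alternating sum [G] of the powers of [b].
    Below degree [n], [G n] is inverse to [a]; this suffices, since the derivative of [b] has no
    constant term. *)
Lemma euler_log n : ser_mul a (euler (ser_log a)) n = (n%:R : rat) * a n.
Proof.
have qM (x y y' : rat^o) : True -> idfun y = idfun y' -> idfun (x * y) = idfun (x * y').
  by move=> _ /= ->.
have qC (x y : rat^o) : True -> True -> idfun (x * y) = idfun (y * x).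
  by move=> _ _; apply: mulrC.
have qZ (c : rat) (x y : rat^o) : idfun x = idfun y -> idfun (c *: x) = idfun (c *: y).
  by move=> /= ->.
have EL m : (m <= n)%N -> euler (ser_log a) m = ser_mul (euler b) (G n) m.
  move=> mn.
  transitivity (\sum_(k < n) ((-1) ^+ k : rat) *: ser_mul (euler b) (ser_pow b k) m); last first.
    rewrite /ser_mul /G; under eq_bigr do rewrite scaler_sumr.
    rewrite exchange_big; apply: eq_bigr => i _; rewrite mulr_sumr.
    by apply: eq_bigr => k _; rewrite scA.
  rewrite /euler /ser_log big_add1 big_mkord scaler_sumr.
  rewrite (big_ord_widen n (fun k => m%:R *: (((-1) ^+ k.+2 / k.+1%:R : rat) *: ser_pow b k.+1 m))) //.
  rewrite big_mkcond; apply: eq_bigr => k _; case: ltnP => mk; last first.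
    by rewrite (euler_mul_pow_small b0) ?scaler0.
  (* For rational coefficients nothing is divided out: [q] is the identity and [C] holds
     everywhere. *)
  have /(_ m) /= := @euler_pow _ _ idfun (fun _ => True) scA (fun _ _ _ _ => I) (fun _ _ _ _ => I)
    (fun _ _ _ => I) I qZ qM qC b k (fun _ => I).
  rewrite {1}/euler => H; rewrite scalerA mulrC -scalerA H scalerA !exprS; congr (_ *: _).
  by field; rewrite nat1r pnatr_eq0.
transitivity (ser_mul a (ser_mul (euler b) (G n)) n).
  by apply: eq_bigr => i _; rewrite EL // leq_subr.
have /(_ n) /= -> := @mul_left_comm _ _ idfun (fun _ => True) (fun _ _ _ _ => I) qM qC a (euler b) (G n)
  (fun _ => I) (fun _ => I) (fun _ => I).
case: n {EL} => [|n]; first by rewrite mul0r; apply: big1 => -[[|//] ?] _; rewrite /euler scale0r mul0r.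
have sE m : (m < n.+1)%N -> ser_mul a (G n.+1) m = ser1 rat^o m.
  by move=> mn; rewrite mul_alternating pow_small // mulr0 subr0.
rewrite {1}/ser_mul big_ord_recr /= subnn sE // mulr1 big1 ?add0r.
  by rewrite /euler /b /ser1 /= subr0.
move=> -[[|i] /= il] _; first by rewrite /euler scale0r mul0r.
by rewrite sE; [rewrite /ser1 subn_eq0 leqNgt il mulr0 | lia].
Qed.

End Log.

(** * Solving the recursion for Z *)

Section Assembly.
Context (R : lalgType rat) (V : zmodType) (q : {additive R -> V}) (C : R -> Prop).
Hypothesis scAr : forall (c : rat) (x y : R), x * (c *: y) = c *: (x * y).
Hypothesis CD : forall x y, C x -> C y -> C (x + y).
Hypothesis CM : forall x y, C x -> C y -> C (x * y).
Hypothesis CZ : forall (c : rat) x, C x -> C (c *: x).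
Hypothesis C1 : C 1.
Hypothesis qZ : forall (c : rat) x y, q x = q y -> q (c *: x) = q (c *: y).
Hypothesis qM : forall x y y', C x -> q y = q y' -> q (x * y) = q (x * y').
Hypothesis qC : forall x y, C x -> C y -> q (x * y) = q (y * x).
Context (dA : R) (w : nat -> R) (sl : int) (K : nat -> int) (Zs z : series R).
Context (As : nat -> int) (a : qseries).
Hypothesis CdA : C dA.
Hypothesis Cw : forall r, C (w r.+2).
Hypothesis K0 : K 0%N = 0.
Hypothesis Zrec : forall m, q (Zs m.+1) = q (dA * Zs m) *~ sl +
  \sum_(r < m.+1) (q (w r.+1 * Zs (m - r)%N) *~ K r) *+ 'C(m, r).
Hypothesis Zsz : forall m, Zs m = m`!%:R *: z m.
Hypothesis z0 : z 0%N = 1.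
Hypothesis As0 : As 0%N = 1.
Hypothesis Arec : forall m, As m.+1 = - \sum_(r < m.+1) (As (m - r)%N * K r) *+ 'C(m, r).
Hypothesis Asa : forall m, (As m)%:~R = m`!%:R * (a m : rat).

Let fn m : (m`!%:R : rat) != 0. Proof. by rewrite pnatr_eq0 -lt0n fact_gt0. Qed.

Let kap r : rat := (K r)%:~R / r`!%:R.

Let binE m r : (r <= m)%N -> ('C(m, r)%:R : rat) = m`!%:R / (r`!%:R * (m - r)`!%:R).
Proof. by move=> rm; rewrite -(bin_fact rm) !natrM mulfK // mulf_neq0. Qed.

Let a0 : a 0%N = 1.
Proof. by have := Asa 0; rewrite As0 fact0 mul1r => <-. Qed.

Let a_rec m : m.+1%:R * (a m.+1 : rat) = - \sum_(r < m.+1) (a (m - r)%N : rat) * kap r.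
Proof.
apply: (mulfI (fn m)); rewrite mulrA -natrM mulnC -factS -Asa Arec rmorphN rmorph_sum /= mulrN mulr_sumr.
congr (- _); apply: eq_bigr => -[r /= rm] _.
rewrite -mulr_natr !intrM Asa -[('C(m, r))%:R%:~R]/(_) natz -pmulrn binE // /kap; field.
by rewrite !fn.
Qed.

(** Both sides have the same convolution with [a], the left one by [euler_log] and the right one by
    [a_rec]. As [a 0 = 1], strong induction leaves only the top terms. *)
Lemma log_kap r : r.+1%:R * (ser_log a r.+1 : rat) = - kap r.
Proof.
have [m] := ubnP r; elim: m r => // m IH r /ltnSE rm.
have := euler_log a0 r.+1; rewrite a_rec /ser_mul (reindex_inj rev_ord_inj) /= big_ord_recl /=.
rewrite /euler /= subn1 subnn scale0r mulr0 add0r => H.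
have {}H : \sum_(i < r.+1) (a (r - i)%N : rat) * (i.+1%:R * (ser_log a i.+1 : rat)) =
     - \sum_(i < r.+1) (a (r - i)%N : rat) * kap i.
  rewrite -H; apply: eq_bigr => i _; rewrite /bump /= add1n !subSS.
  by rewrite subSn ?leq_subr // subKn // -ltnS.
move: H; rewrite -sumrN !big_ord_recr /= subnn a0 !mul1r.
rewrite (eq_bigr (fun i : 'I_r => - ((a (r - i)%N : rat) * kap i))); first by move/addrI.
by move=> i _; rewrite IH ?mulrN // (leq_trans _ rm).
Qed.

Let P : series R := ser_deg1 (sl%:~R *: dA).
Let Q : series R := ser_opp (fun n => (ser_log a n : rat) *: w n).
Let Y := ser_mul (ser_exp P) (ser_exp Q).

Let C_0 : C 0. Proof. by rewrite -(scale0r 1); apply: CZ. Qed.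

Let log0 : ser_log a 0%N = 0. Proof. by rewrite /ser_log big_geq. Qed.
Let log1 : ser_log a 1%N = 0.
Proof. by have := log_kap 0; rewrite mul1r /kap K0 mul0r oppr0. Qed.

Let CP : allC C P. Proof. by move=> n; rewrite /P /ser_deg1; case: eqP => _ //; apply: CZ. Qed.
Let CQ : allC C Q.
Proof.
move=> [|[|n]]; rewrite /Q /ser_opp ?log0 ?log1 ?scale0r ?oppr0 //.
by rewrite -scaleNr; apply: CZ.
Qed.

Let exp0 U : ser_exp U 0%N = 1 :> R.
Proof. by rewrite /ser_exp big_ord1 /= fact0 invr1 scale1r /ser_pow /ser1. Qed.

Lemma assembly m : q (z m) = q (Y m).
Proof.
have [N] := ubnP m; elim: N m => // N IH [|m] /ltnSE mN.
  by rewrite z0 /Y /ser_mul big_ord1 !exp0 mulr1.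
have cancel x y : q (m.+1%:R *: x) = q (m.+1%:R *: y) -> q x = q y.
  have m0 : (m.+1%:R : rat) != 0 by rewrite pnatr_eq0.
  by move=> /(qZ (m.+1%:R^-1)); rewrite !scalerA mulVf // !scale1r.
apply: cancel.
have Q0 : Q 0%N = 0 by rewrite /Q /ser_opp log0 scale0r oppr0.
have /(_ m.+1) -> := @euler_exp_mul _ _ q C scAr CD CM CZ C1 qZ qM qC P Q CP CQ erefl Q0.
(* In degree [m.+1] the recursion is multiplication by the Euler derivatives of [P] and [Q]: by
   [log_kap], the coefficient of degree [r.+1] of the latter is [kap r *: w r.+1]. *)
have X (s : series R) :
    sl%:~R *: (dA * s m) + \sum_(r < m.+1) kap r *: (w r.+1 * s (m - r)%N) =
    ser_mul (euler P) s m.+1 + ser_mul (euler Q) s m.+1.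
  congr (_ + _).
    rewrite /ser_mul big_ord_recl /euler /= scale0r mul0r add0r big_ord_recl /= /P /ser_deg1 /=.
    rewrite scale1r scalerAl subSS subn0 big1 ?addr0 // => i _.
    by rewrite scaler0 mul0r.
  rewrite /ser_mul [RHS]big_ord_recl /euler /= scale0r mul0r add0r; apply: eq_bigr => r _.
  rewrite /bump /= add1n subSS /Q /ser_opp -scaleNr scalerA mulrN log_kap opprK.
  by rewrite scalerAl.
rewrite -/Y -X.
have -> : q (m.+1%:R *: z m.+1) = q (m`!%:R^-1 *: Zs m.+1).
  rewrite Zsz scalerA factS natrM; congr (q (_ *: _)); field.
  exact: fn.
rewrite (qZ _ (y := sl%:~R *: (dA * Zs m) +
   \sum_(r < m.+1) ((K r)%:~R * 'C(m, r)%:R) *: (w r.+1 * Zs (m - r)%N))); last first.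
  rewrite Zrec raddfD raddf_sum /= -raddfMz scaler_int; congr (_ + _); apply: eq_bigr => r _.
  by rewrite -raddfMz -raddfMn -scaler_int -scaler_nat scalerA mulrC.
rewrite scalerDr scaler_sumr !raddfD !raddf_sum /=; congr (_ + _).
  rewrite Zsz scAr !scalerA mulrAC mulVf // mul1r.
  by apply: qZ; apply: qM => //; apply: IH.
apply: eq_bigr => -[r /= rm] _; rewrite Zsz scAr !scalerA.
have -> : m`!%:R^-1 * ((K r)%:~R * 'C(m, r)%:R) * (m - r)`!%:R = kap r :> rat.
  by rewrite binE // /kap; field; rewrite !fn.
(* The wheel with one spoke has coefficient 0; the others lie in [C], as [qM] requires. *)
case: r rm => [|r] rm; first by rewrite /kap K0 mul0r !scale0r.
by apply: qZ; apply: qM => //; apply: IH; lia.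
Qed.

End Assembly.

Section Laurent.
Context (D : gauss) (p : {poly int}) (m : nat) (hp : alexander D = laurent p m).

(** Sums over labelled sequences become sums over multiplicities by [dmx_counts] and [agg_counts],
    and these are coefficients of the determinant at e^x by [coef_exp_mx]. *)
Lemma Asum_laurent N : (Asum D N)%:~R = N`!%:R * (laurent_at_exp p m N : rat).
Proof.
rewrite -(@coef_theta N.+1) // (theta_alexander hp) // coef_exp_mx // /det_weight.
apply: (etrans _ (etrans (@agg_counts _ (@sign D) rat^o N (iota 0 N)
  (fun f => (\det (count_mx f))%:~R) _) _)); last by rewrite size_iota.
  rewrite /Asum (agg_raddf _ (intr : {additive int -> rat})); apply: eq_agg => g gs.
  congr (_%:~R); case: g gs => [|x g] gs; last by apply: dmx_counts; rewrite gs iota_ltn_sorted.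
  (* For the empty sequence all columns of [count_mx] are identity columns, in agreement with the
     value 1 in [Asum]. *)
  rewrite (_ : count_mx _ = 1%:M) ?det1 //; apply/matrixP => i j; rewrite !mxE ffunE /=.
  by case: (i == j).
by rewrite size_iota.
Qed.

End Laurent.

(** The domain on which multiplication is shown to pass to the quotient: [free_alg] also contains
    words that are not codes of diagrams. *)
Inductive arrow_span : free_alg -> Prop :=
| ArrowSpan_dg (u : word nat) : arrow_word u -> arrow_span (dg u)
| ArrowSpanD x y : arrow_span x -> arrow_span y -> arrow_span (x + y)
| ArrowSpanZ c x : arrow_span x -> arrow_span (c *: x).

Lemma dg_nil (L : eqType) : dg ([::] : word L) = 1.
Proof. by congr << _ >>; rewrite /mone /one /= fmoneE. Qed.

Lemma arrow_span1 : arrow_span 1.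
Proof. by rewrite -(dg_nil nat); apply: ArrowSpan_dg. Qed.

Lemma arrow_spanM x y : arrow_span x -> arrow_span y -> arrow_span (x * y).
Proof.
move=> xC yC; elim: xC => [u au|x1 x2 _ IH1 _ IH2|c x1 _ IH].
- elim: yC => [v av|y1 y2 _ IH1 _ IH2|c y1 _ IH].
  + have [k kP] := labels_bound v; have [auv ->] := dg_mul_shift au av kP.
    exact: ArrowSpan_dg.
  + rewrite (mulrDr (dg u) y1 y2); exact: ArrowSpanD.
  + rewrite -(malg_scalerAr c (dg u) y1); exact: ArrowSpanZ.
- rewrite (mulrDl x1 x2 y); exact: ArrowSpanD.
- rewrite -(scalerAl c x1 y); exact: ArrowSpanZ.
Qed.

Lemma cls_add x y x1 x2 y1 y2 : x = x1 + x2 -> y = y1 + y2 ->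
  cls x1 = cls y1 -> cls x2 = cls y2 -> cls x = cls y.
Proof.
move=> -> -> h1 h2; apply: (etrans (raddfD cls x1 x2)).
by apply: (etrans _ (esym (raddfD cls y1 y2))); apply: (congr2 (fun a b => a + b)).
Qed.

Lemma cls_scale (c : rat) x y x1 y1 : c *: x1 = x -> c *: y1 = y ->
  cls x1 = cls y1 -> cls x = cls y.
Proof. by move=> <- <-; apply: clsZ. Qed.

Lemma cls_mull x y y' : arrow_span x -> cls y = cls y' -> cls (x * y) = cls (x * y').
Proof.
move=> xC yy; elim: xC => [u au|x1 x2 _ IH1 _ IH2|c x1 _ IH].
- exact: cls_dg_mull.
- exact: (cls_add (mulrDl x1 x2 y) (mulrDl x1 x2 y') IH1 IH2).
- exact: (cls_scale (scalerAl c x1 y) (scalerAl c x1 y') IH).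
Qed.

Lemma cls_mulC x y : arrow_span x -> arrow_span y -> cls (x * y) = cls (y * x).
Proof.
move=> xC yC; elim: xC => [u au|x1 x2 _ IH1 _ IH2|c x1 _ IH].
- elim: yC => [v av|y1 y2 _ IH1 _ IH2|c y1 _ IH].
  + exact: cls_dg_comm.
  + exact: (cls_add (mulrDr (dg u) y1 y2) (mulrDl y1 y2 (dg u)) IH1 IH2).
  + exact: (cls_scale (malg_scalerAr c (dg u) y1) (scalerAl c y1 (dg u)) IH).
- exact: (cls_add (mulrDl x1 x2 y) (mulrDr y x1 x2) IH1 IH2).
- exact: (cls_scale (scalerAl c x1 y) (malg_scalerAr c y x1) IH).
Qed.

Lemma arrow_span_sum (l : seq (rat * word nat)) : {in l, forall c, arrow_word c.2} ->
  arrow_span (dgw l).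
Proof.
rewrite /dgw; elim: l => [|c l IH] al.
  rewrite big_nil -(scale0r (1 : free_alg)); exact: (ArrowSpanZ 0 arrow_span1).
rewrite big_cons; apply: ArrowSpanD.
  by apply: ArrowSpanZ; apply: ArrowSpan_dg; apply: al; apply: mem_head.
by apply: IH => d dl; apply: al; rewrite inE dl orbT.
Qed.

Lemma wheel_span k : arrow_span (wheel k.+2).
Proof.
rewrite wheel_off; apply: arrow_span_sum; apply: offw_arrow.
by rewrite cons_uniq mem_iota add1n ltnn andbF iota_uniq.
Qed.

Theorem theorem3p26 (K : wknot) (D : gauss) (p : {poly int}) (m : nat)
    (hD : K D) (hp : alexander D = laurent p m) :
  Asw_eq (Zinv D)
    (ser_mul (ser_exp (ser_deg1 ((sl D)%:~R *: D_A)))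
             (ser_exp (ser_opp (wmap (ser_log (laurent_at_exp p m)))))).
Proof.
move=> n; apply/clsP/eqP.
apply: (@assembly free_alg diagrams cls arrow_span _ ArrowSpanD arrow_spanM ArrowSpanZ
  arrow_span1 clsZ cls_mull cls_mulC D_A wheel (sl D) (Ksum D) (Zsum D) (Zinv D) (Asum D)).
- by move=> c x y; apply/esym/malg_scalerAr.
- exact: ArrowSpan_dg D_A_arrow.
- exact: wheel_span.
- exact: Ksum0.
- exact: Zsum_rec.
- exact: Zsum_Zinv.
- have := Zsum_Zinv D 0; rewrite fact0 scale1r => <-.
  apply: (etrans _ (dg_nil nat)); rewrite /Zsum /= /cword /lword.
  by elim: (gword D).
- by [].
- exact: Asum_rec.
- exact: Asum_laurent.
Qed.
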